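(* Let $\mathcal{B}=\mathcal{B}_I$ be as defined in the context. Let $\kappa<\frac{1}{\sqrt{6}}$ and let $\alpha$ be an irrational real number with finite irrationality measure. Then there is $x_0(\alpha)$ such that for all $x\ge x_0(\alpha)$, $$\sup_{0\le y\le 1}|B(x,y,\alpha)-yB(x)|\ll\frac{x}{\exp(\kappa\sqrt{\log x\log\log x})}.$$ In particular, the sequence $(\alpha n)_{n\in\mathcal{B}}$ is uniformly distributed modulo 1 (i.e. $\lim_{x\to\infty}|\{n\in\mathcal{B}(x):\{\alpha n\}\in[a,b]\}|/B(x)=b-a$ for all $0\le a<b\le1$) provided $B(x)\gg x\exp(-\kappa'\sqrt{\log x\log\log x})$ for some constant $\kappa'<\frac{1}{\sqrt{6}}$.
   Context: For each natural number $n$, let $I(n)$ be a subset of $\mathbb{R}$ which is either empty, an interval, or a union of at most $K_0$ intervals, where $K_0$ is a constant independent of $n$. Let $\mathcal{B}=\mathcal{B}_I$ be the set of positive integers consisting of $n=1$ together with all $n\ge 2$ whose prime factorization $n=p_1\cdots p_k$, $p_1\le p_2\le\cdots\le p_k$, satisfies $p_j\in I\big(\prod_{1\le i<j}p_i\big)$ for all $1\le j\le k$ (the empty product being $1$). Write $\mathcal{B}(x)=\mathcal{B}\cap[1,x]$, $B(x)=|\mathcal{B}(x)|$, and for $0\le y\le 1$, $B(x,y,\alpha)=|\{n\in\mathcal{B}(x):\{\alpha n\}\le y\}|$, where $\{u\}$ is the fractional part of $u$. If $a_j/q_j$ are the continued fraction convergents of the irrational $\alpha$, its irrationality measure is $\mu(\alpha)=1+\limsup_{j\ge1}\frac{\log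 q_{j+1}}{\log q_j}$. *)

(* Defs.v *)
From mathcomp Require Import all_boot all_order all_algebra finmap.
From mathcomp Require Import all_classical all_reals all_analysis.

Set Implicit Arguments.
Unset Strict Implicit.
Unset Printing Implicit Defensive.

Import Order.TTheory GRing.Theory Num.Theory.
Import numFieldNormedType.Exports.

Local Open Scope classical_set_scope.
Local Open Scope ring_scope.

Definition interval_family (R : realType) (K0 : nat) (I : nat -> set R) : Prop :=
  forall n : nat,
    [\/ I n = set0, is_interval (I n) |
        exists2 J : 'I_K0 -> set R,
          (forall k, is_interval (J k)) & I n = \bigcup_k J k].

(* The prime factorization of n is a nondecreasing sequence s of primes; the
   empty sequence gives n = 1, and 0 has no such sequence. *)
Definition setB (R : realType) (I : nat -> set R) : set nat :=
  [set n | exists s : seq nat,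
     [/\ sorted leq s, all prime s, n = (\prod_(p <- s) p)%N &
         forall j, (j < size s)%N ->
           I (\prod_(p <- take j s) p)%N (nth 0%N s j)%:R]].

Definition upto (R : realType) (A : set nat) (x : R) : set nat :=
  A `&` [set n | n%:R <= x].

(* fset_set is only meaningful on finite sets. *)
Lemma finite_upto (R : realType) (A : set nat) (x : R) :
  finite_set (upto A x).
Proof.
apply: (sub_finite_set (B := `I_(Num.truncn x).+1)); last exact: finite_II.
move=> n [_ /= nx]; rewrite ltnS -(@natrK R n); exact: le_truncn.
Qed.

Definition card_upto (R : realType) (A : set nat) (x : R) : nat :=
  #|` fset_set (upto A x)|.

Definition frac_part (R : realType) (u : R) : R := u - (Num.floor u)%:~R.

(* B(x, y, alpha) *)
Definition cardfrac_upto (R : realType) (A : set nat) (x y alpha : R) : nat :=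
  card_upto (A `&` [set n | frac_part (alpha * n%:R) <= y]) x.

Definition sup_discrepancy (R : realType) (A : set nat) (alpha x : R) : R :=
  sup [set `|(cardfrac_upto A x y alpha)%:R - y * (card_upto A x)%:R|
        | y in [set y | 0 <= y <= 1]].

(* Uniform distribution modulo 1 of (alpha n), n in A. *)
Definition equidistributed_mod1 (R : realType) (A : set nat) (alpha : R) : Prop :=
  forall a b : R, 0 <= a -> a < b -> b <= 1 ->
    (fun x : R =>
       (card_upto (A `&` [set n | a <= frac_part (alpha * n%:R) <= b]) x)%:R
         / (card_upto A x)%:R) @ +oo --> b - a.

Fixpoint complete_quotient (R : realType) (alpha : R) (j : nat) : R :=
  if j is i.+1 then (frac_part (complete_quotient alpha i))^-1 else alpha.

Definition partial_quotient (R : realType) (alpha : R) (j : nat) : int :=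
  Num.floor (complete_quotient alpha j).

(* Denominator q_j of the j-th convergent: q_0 = 1, q_1 = c_1 and
   q_j = c_j q_(j-1) + q_(j-2), with c_j the partial quotients. *)
Fixpoint convergent_den (R : realType) (alpha : R) (j : nat) : int :=
  match j with
  | 0 => 1
  | i.+1 =>
      match i with
      | 0 => partial_quotient alpha j
      | k.+1 => partial_quotient alpha j * convergent_den alpha i
                  + convergent_den alpha k
      end
  end.

(* The limsup does not depend on the finitely many j with q_j = 1, for which
   the quotient of logarithms takes the value x / 0 = 0. *)
Definition irrationality_measure (R : realType) (alpha : R) : \bar R :=
  (1 + limn_esup (fun j : nat =>
         (ln (convergent_den alpha j.+1)%:~R
            / ln (convergent_den alpha j)%:~R)%:E))%E.

Definition error_term (R : realType) (kappa x : R) : R :=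
  x / expR (kappa * Num.sqrt (ln x * ln (ln x))).

(* Main.v *)
(* Fejer's kernel reduces the discrepancy to the sums of cos(2 pi h alpha n + phi)
   over n in B_I, for h up to a power of Y = exp(S), where
   S = sqrt(log x loglog x).

   Write n = m p with p the largest prime factor of n. Then n is in B_I if and
   only if m is in B_I and p is in I(m), so that for fixed m the prime p ranges
   over at most K0 intervals. The n without prime factors above exp(9S/10) are
   few, by Rankin's method. For large m and p in a dyadic block, the
   Cauchy-Schwarz inequality gives a bilinear estimate; it is applied to the
   maximum over the initial segments of the block, which a dyadic decomposition
   controls, so that I(m) may depend on m in an arbitrary way. For small m the
   intervals are treated one at a time: the primes are the rough numbers other
   than 1 and the rough composites; Legendre's sieve with Rankin's bound deals
   with the rough numbers, and the composites are again split at a prime factor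
   and fall under the bilinear estimate.

   Finite irrationality measure gives |sin(pi d alpha)| >= T^(-A) for all
   0 < d <= T, where A is fixed; T is taken to be a power of Y, so that the losses
   are powers of Y = x^o(1). The final saving is exp(-0.41 S), and
   0.41 > 1 / sqrt 6. *)

Require Import Defs.
From mathcomp Require Import all_boot all_order all_algebra finmap.
From mathcomp Require Import all_classical all_reals all_analysis.
From mathcomp Require Import ring lra zify.

Set Implicit Arguments.
Unset Strict Implicit.
Unset Printing Implicit Defensive.

Import Order.TTheory GRing.Theory Num.Theory.
Import numFieldNormedType.Exports.

Local Open Scope classical_set_scope.
Local Open Scope ring_scope.

(** * Trigonometric sums *)

Section Trig.
Variable R : realType.
Implicit Types (u v a s t phi V delta : R).

Lemma cos_pi4 : (cos (pi / 4) : R) ^+ 2 = 1 / 2.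
Proof.
have := cos_mulr2n (pi / 4 : R); rewrite (_ : pi / 4 *+ 2 = pi / 2); last by lra.
rewrite cos_pihalf; lra.
Qed.

Lemma sin_pi_ge_half u : 0 <= u <= 1 / 2 -> u <= sin (pi * u).
Proof.
move=> /andP[u0 u1].
have pi2 := @pi_ge2 R.
have [u4|u4] := leP u (1 / 4).
- have [->|un0] := eqVneq u 0; first by rewrite mulr0 sin0.
  have up : 0 < pi * u by rewrite mulr_gt0 ?pi_gt0// lt_def un0.
  have [c] := @MVT R sin cos 0 (pi * u) up (fun x _ => is_derive_sin x)
     (continuous_subspaceT (@continuous_sin R)).
  rewrite in_itv/= => /andP[c0 cu]; rewrite sin0 !subr0 => ->.
  have c4 : c <= pi / 4 by apply: (le_trans (ltW cu)); rewrite ler_pM2l ?pi_gt0//; lra.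
  have cc : cos (pi / 4) <= cos c.
    have [->//|cn] := eqVneq c (pi / 4).
    apply: ltW; rewrite ltr_cos ?in_itv/= ?lt_neqAle ?cn//; lra.
  have cp : 0 < cos (pi / 4 : R) by apply: cos_gt0_pihalf; lra.
  have c2 : 1 / 2 <= cos c by apply: le_trans cc; have := cos_pi4; nra.
  by rewrite mulrA; apply: ler_peMl => //; nra.
- have s4 : sin (pi / 4) <= sin (pi * u).
    apply: ltW; rewrite ltr_sin ?in_itv/=; nra.
  have sp : 0 < sin (pi / 4 : R) by apply: sin_gt0_pihalf; lra.
  have := sin2cos2 (pi / 4 : R); rewrite cos_pi4; nra.
Qed.

Lemma sin_pi_ge u : 0 <= u <= 1 -> Num.min u (1 - u) <= sin (pi * u).
Proof.
move=> /andP[u0 u1]; rewrite ge_min.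
have [uh|uh] := leP u (1 / 2); first by rewrite sin_pi_ge_half ?u0.
rewrite (_ : pi * u = pi - pi * (1 - u)); last by ring.
rewrite sinB sinpi cospi mul0r sub0r mulN1r opprK sin_pi_ge_half ?orbT//; lra.
Qed.

Lemma sinDpin (x : R) (n : nat) : `|sin (x + pi * n%:R)| = `|sin x|.
Proof.
elim: n => [|n IH]; first by rewrite mulr0 addr0.
by rewrite -natr1 mulrDr mulr1 addrA sinDpi normrN.
Qed.

Lemma sinDpiz (x : R) (k : int) : `|sin (x + pi * k%:~R)| = `|sin x|.
Proof.
case: k => n; first exact: sinDpin.
by rewrite -(sinDpin _ n.+1) NegzE mulrNz mulrN subrK.
Qed.

Lemma sin_dist t delta : (forall k : int, delta <= `|t - k%:~R|) ->
  delta <= `|sin (pi * t)|.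
Proof.
move=> H; set u := t - (Num.floor t)%:~R.
have ut : t = u + (Num.floor t)%:~R by rewrite subrK.
have u0 : 0 <= u by rewrite subr_ge0 floor_le_tmp.
have u1 : u < 1 by rewrite ltrBlDl -[X in _ + X]/1%:~R -intrD floorD1_gt.
rewrite ut mulrDr sinDpiz.
apply: le_trans (ler_norm _); apply: le_trans (sin_pi_ge _); last by lra.
rewrite le_min; apply/andP; split.
  by have := H (Num.floor t); rewrite -/u ger0_norm.
have := H (Num.floor t + 1); rewrite intrD opprD addrA -/u distrC ger0_norm//.
rewrite subr_ge0 ltW//.
Qed.

Lemma norm_sinB x y : `|sin (x - y)| <= `|sin x| + `|sin y| :> R.
Proof.
rewrite sinB; apply: (le_trans (ler_normB _ _)); rewrite !normrM.
by apply: lerD; [apply: ler_piMr|apply: ler_piMl]; rewrite ?cos_max.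
Qed.

Definition cosn a phi (n : nat) : R := cos (a * n%:R *+ 2 + phi).

Lemma cosn_le1 a phi n : `|cosn a phi n| <= 1.
Proof. exact: cos_max. Qed.

Lemma sum_cosn_telescope a phi (m n : nat) : (m <= n)%N ->
  (\sum_(m <= i < n) cosn a phi i) * (sin a *+ 2)
  = sin (a * n%:R *+ 2 + phi - a) - sin (a * m%:R *+ 2 + phi - a).
Proof.
move=> mn.
rewrite big_distrl/= -(telescope_sumr (fun k : nat => sin (a * k%:R *+ 2 + phi - a)))//.
apply: eq_bigr => i _; rewrite /cosn.
rewrite (_ : a * i.+1%:R *+ 2 + phi - a = (a * i%:R *+ 2 + phi) + a).
  rewrite sinB sinD; ring.
by rewrite -natr1; ring.
Qed.

Lemma sum_cosn a phi (m n : nat) : `|\sum_(m <= i < n) cosn a phi i| * `|sin a| <= 1.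
Proof.
have [mn|/ltnW nm] := leqP m n; last by rewrite big_geq// normr0 mul0r.
rewrite -normrM -(ler_pM2r (x := 2))//.
rewrite -[X in _ * X]ger0_norm// -normrM -mulrA mulr_natr sum_cosn_telescope// mul1r.
by apply: (le_trans (ler_normB _ _)); have := sin_max (a * n%:R *+ 2 + phi - a);
  have := sin_max (a * m%:R *+ 2 + phi - a); lra.
Qed.

(* min(V, 1/s), with the convention 1/0 = +oo *)
Definition cap V s : R := if V * s <= 1 then V else s^-1.

Lemma cap_ge0 V s : 0 <= V -> 0 <= s -> 0 <= cap V s.
Proof. by rewrite /cap => V0 s0; case: ifP => // _; rewrite invr_ge0. Qed.

Lemma cap_le V s : 0 <= s -> cap V s <= V.
Proof.
rewrite /cap => s0; case: (leP (V * s) 1) => // Vs.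
have {}s0 : 0 < s by rewrite lt_def s0 andbT; apply: contraTneq Vs => ->; rewrite mulr0 -leNgt ler01.
by rewrite -(ler_pM2r s0) mulVf ?gt_eqF// ltW.
Qed.

Lemma cap_le_inv V s delta : 0 < delta -> delta <= s -> cap V s <= delta^-1.
Proof.
move=> d0 ds; have s0 := lt_le_trans d0 ds.
have sd : s^-1 <= delta^-1 by rewrite lef_pV2.
rewrite /cap; case: ifP => // h; apply: le_trans sd.
by rewrite -(ler_pM2r s0) mulVf ?gt_eqF.
Qed.

Lemma le_cap x V s : 0 <= s -> x <= V -> x * s <= 1 -> x <= cap V s.
Proof.
rewrite /cap => s0 xV xs; case: (leP (V * s) 1) => // h.
have {}s0 : 0 < s by rewrite lt_def s0 andbT; apply: contraTneq h => ->; rewrite mulr0 -leNgt ler01.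
by rewrite -(ler_pM2r s0) mulVf ?gt_eqF.
Qed.

Lemma sum_nat_const_le (f : nat -> R) (c : R) m n :
  (forall i, (m <= i < n)%N -> f i <= c) -> \sum_(m <= i < n) f i <= (n - m)%:R * c.
Proof.
move=> H; rewrite mulr_natl -sumr_const_nat; exact: ler_sum_nat.
Qed.

Lemma sum_cosn_cap a phi (m n : nat) V : (n - m)%:R <= V ->
  `|\sum_(m <= i < n) cosn a phi i| <= cap V `|sin a|.
Proof.
move=> nV; apply: le_cap => //; last exact: sum_cosn.
apply: le_trans nV; apply: (le_trans (ler_norm_sum _ _ _)).
rewrite -[leRHS]mulr1; apply: sum_nat_const_le => i _; exact: cosn_le1.
Qed.

(* the multiples a, 2a, ..., (T-1)a stay away from pi Z *)
Definition sin_separated a (T : nat) delta :=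
  forall d : nat, (0 < d < T)%N -> delta <= `|sin (a * d%:R)|.

Lemma sin_separated_near a T delta xi (n m : nat) :
  sin_separated a T delta -> (n < m < n + T)%N ->
  `|sin (a * n%:R + xi)| < delta / 2 -> delta / 2 <= `|sin (a * m%:R + xi)|.
Proof.
move=> sepa /andP[nm mn] H.
have := @norm_sinB (a * m%:R + xi) (a * n%:R + xi).
rewrite (_ : a * m%:R + xi - (a * n%:R + xi) = a * (m - n)%:R).
  by have := sepa (m - n)%N; rewrite subn_gt0 nm ltn_subLR ?mn ?(ltnW nm)//= => /(_ isT); lra.
by rewrite natrB 1?ltnW//; ring.
Qed.

Lemma sum_cap_block a T delta xi V (m k : nat) : 0 < delta -> 0 <= V ->
  sin_separated a T delta -> (k <= T)%N ->
  \sum_(m <= i < m + k) cap V `|sin (a * i%:R + xi)| <= V + T%:R * (delta / 2)^-1.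
Proof.
move=> d0 V0 sepa.
have d2 : 0 < delta / 2 by lra.
have d3 : 0 <= (delta / 2)^-1 by rewrite invr_ge0 ltW.
suff H : forall j l, (j <= T)%N -> \sum_(l <= i < l + j) cap V `|sin (a * i%:R + xi)| <= V + j%:R * (delta / 2)^-1.
  move=> kT; apply: (le_trans (H _ _ kT)); rewrite lerD2l ler_wpM2r// ler_nat//.
elim=> [|j IH] l jT; first by rewrite addn0 big_geq// mul0r addr0.
rewrite big_ltn ?addnS ?ltnS ?leq_addr//.
have [near|far] := ltP `|sin (a * l%:R + xi)| (delta / 2).
  apply: lerD; first exact: cap_le.
  apply: (@le_trans _ _ (((l + j).+1 - l.+1)%:R * (delta / 2)^-1)).
    apply: sum_nat_const_le => i /andP[li il]; apply: cap_le_inv => //.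
    by apply: (sin_separated_near sepa _ near); lia.
  by rewrite ler_wpM2r// ler_nat; lia.
apply: (@le_trans _ _ ((delta / 2)^-1 + (V + j%:R * (delta / 2)^-1))).
  apply: lerD; first exact: cap_le_inv.
  by rewrite -addSn; apply: IH; lia.
by rewrite -natr1; lra.
Qed.

Lemma sum_blocks (f : nat -> R) (T : nat) (c : R) (N : nat) : (0 < T)%N -> 0 <= c ->
  (forall m k, (k <= T)%N -> \sum_(m <= i < m + k) f i <= c) ->
  \sum_(0 <= i < N) f i <= (N%:R / T%:R + 1) * c.
Proof.
move=> T0 c0 H.
have H2 : forall q, \sum_(0 <= i < q * T) f i <= q%:R * c.
  elim=> [|q IH]; first by rewrite mul0n big_geq// mul0r.
  rewrite (@big_cat_nat _ _ _ (q * T)) ?leq_mul2r ?leqnSn ?orbT//=.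
  by rewrite -natr1 mulrDl mul1r lerD// mulSn addnC; apply: H.
rewrite {1}(divn_eq N T) (@big_cat_nat _ _ _ (N %/ T * T)) ?leq_addr//=.
rewrite mulrDl mul1r lerD//; last by apply: H; rewrite ltnW// ltn_mod.
apply: (le_trans (H2 _)); rewrite ler_wpM2r// ler_pdivlMr ?ltr0n// -natrM ler_nat.
exact: leq_trunc_div.
Qed.

Lemma sum_cap a T delta xi V N : (0 < T)%N -> 0 < delta -> 0 <= V ->
  sin_separated a T delta ->
  \sum_(0 <= i < N) cap V `|sin (a * i%:R + xi)|
    <= (N%:R / T%:R + 1) * (V + T%:R * (delta / 2)^-1).
Proof.
move=> T0 d0 V0 sepa; apply: sum_blocks => //.
  by rewrite addr_ge0// mulr_ge0// invr_ge0; lra.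
by move=> m k kT; apply: sum_cap_block.
Qed.

End Trig.

(** * Bilinear sums and the dyadic maximal inequality *)

Section Bilinear.
Variable R : realType.
Implicit Types (f g : nat -> R) (F K : nat -> nat -> R).

Lemma cauchy_sum f n : (\sum_(0 <= i < n) f i) ^+ 2 <= n%:R * \sum_(0 <= i < n) f i ^+ 2.
Proof.
elim: n => [|n IH]; first by rewrite !big_geq// expr0n mul0r.
rewrite !big_nat_recr//=; move: IH.
set s := \sum_(0 <= i < n) f i; set q := \sum_(0 <= i < n) f i ^+ 2; set x := f n.
case: n @s @q @x => [|n] s q x IH.
  by rewrite /s /q !big_geq// !add0r mul1r.
have q0 : 0 <= q by apply: sumr_ge0 => i _; exact: sqr_ge0.
have n0 : 0 < n.+1%:R :> R by [].
have : n.+1%:R * (2 * s * x) <= n.+1%:R * (q + n.+1%:R * x ^+ 2).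
  by have := sqr_ge0 (s - n.+1%:R * x); nra.
rewrite ler_pM2l// -(natr1 n.+1); nra.
Qed.

Lemma sum_nat_shift f m n : \sum_(m <= i < n) f i = \sum_(0 <= i < n - m) f (m + i)%N.
Proof.
by rewrite -{1}(add0n m) big_addn; apply: eq_bigr => i _; rewrite addnC.
Qed.

Fixpoint dyadic (k : nat) f : R :=
  (\sum_(0 <= n < 2 ^ k) f n) ^+ 2 +
  (if k is j.+1 then dyadic j f + dyadic j (fun n => f (2 ^ j + n)%N) else 0).

Lemma dyadic_ge k f : (\sum_(0 <= n < 2 ^ k) f n) ^+ 2 <= dyadic k f.
Proof.
have dyadic_ge0 : forall j g, 0 <= dyadic j g.
  by elim=> [|j IH] g /=; rewrite ?addr0 ?addr_ge0// sqr_ge0.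
by case: k => [|k] /=; rewrite ?addr0// lerDl addr_ge0.
Qed.

Lemma dyadic_ge0 k f : 0 <= dyadic k f.
Proof. exact: le_trans (sqr_ge0 _) (dyadic_ge k f). Qed.

(* Rademacher-Menshov: [0, t) is a disjoint union of at most k + 1 dyadic
   intervals. *)
Lemma prefix_sum_sq k f t : (t <= 2 ^ k)%N ->
  (\sum_(0 <= n < t) f n) ^+ 2 <= k.+1%:R * dyadic k f.
Proof.
elim: k f t => [|k IH] f t tk.
  rewrite mul1r; case: t tk => [|[|//]] _; last exact: (dyadic_ge 0 f).
  by rewrite big_geq// expr0n dyadic_ge0.
rewrite [dyadic _ _]/=; set S2 := (X in X + _); set D1 := dyadic k f; set D2 := dyadic k _.
have S20 : 0 <= S2 by exact: sqr_ge0.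
have D10 : 0 <= D1 by exact: dyadic_ge0.
have D20 : 0 <= D2 by exact: dyadic_ge0.
have k0 : 0 <= k%:R :> R by [].
have [tk2|tk2] := leqP t (2 ^ k).
  apply: (le_trans (IH f t tk2)); rewrite -/D1 -(natr1 k.+1) -(natr1 k); nra.
rewrite (@big_cat_nat _ _ _ (2 ^ k))//= 1?ltnW//.
rewrite (sum_nat_shift _ (2 ^ k)).
set A := \sum_(_ <= _ < _) _; set B := \sum_(_ <= _ < _) _.
have HA : A ^+ 2 <= D1 by exact: dyadic_ge.
have HB : B ^+ 2 <= k.+1%:R * D2.
  by apply: IH; rewrite leq_subLR addnn -mul2n -expnS.
rewrite -(natr1 k.+1); set c := k.+1%:R in HB *.
have c1 : 1 <= c by rewrite /c -natr1; lra.
rewrite -(ler_pM2l (x := c)); last lra.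
have := sqr_ge0 (c * A - B).
have : 0 <= c * S2 by apply: mulr_ge0 => //; lra.
have : c * c * A ^+ 2 <= c * c * D1 by apply: ler_wpM2l => //; nra.
have : c * A ^+ 2 <= c * D1 by apply: ler_wpM2l => //; lra.
have : 0 <= c * c * S2 by apply: mulr_ge0 => //; nra.
have : c * B ^+ 2 <= c * (c * D2) by apply: ler_wpM2l => //; lra.
nra.
Qed.

Lemma sum_dyadic k (m : nat) F K : (forall n n', 0 <= K n n') ->
  (forall n n', \sum_(0 <= r < m) F r n * F r n' <= K n n') ->
  \sum_(0 <= r < m) dyadic k (F r)
    <= k.+1%:R * \sum_(0 <= n < 2 ^ k) \sum_(0 <= n' < 2 ^ k) K n n'.
Proof.
move=> K0 H.
have sq : forall (j : nat) (G L : nat -> nat -> R), (forall n n', \sum_(0 <= r < m) G r n * G r n' <= L n n') ->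
   \sum_(0 <= r < m) (\sum_(0 <= n < 2 ^ j) G r n) ^+ 2
   <= \sum_(0 <= n < 2 ^ j) \sum_(0 <= n' < 2 ^ j) L n n'.
  move=> j G L HL.
  under eq_bigr do rewrite expr2 big_distrlr/=.
  rewrite exchange_big/=; apply: ler_sum => n _; rewrite exchange_big/=.
  by apply: ler_sum => n' _; exact: HL.
elim: k F K K0 H => [|k IH] F K K0 H.
  by rewrite mul1r /=; under eq_bigr do rewrite addr0; exact: sq.
rewrite /=; under eq_bigr do rewrite addrA; rewrite !big_split/= -(natr1 k.+1).
set T := \sum_(0 <= n < 2 ^ k.+1) _.
have h1 := sq k.+1 F K H.
have h2 := IH F K K0 H.
have h3 := IH (fun r n => F r (2 ^ k + n)%N) (fun n n' => K (2 ^ k + n)%N (2 ^ k + n')%N)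
   (fun _ _ => K0 _ _) (fun _ _ => H _ _).
set T1 := \sum_(0 <= n < 2 ^ k) _ in h2.
set T2 := \sum_(0 <= n < 2 ^ k) _ in h3.
suff : T1 + T2 <= T.
  have : 0 <= k.+1%:R :> R by []. 
  by rewrite -/T in h1; set x := k.+1%:R in h2 h3 *; nra.
have e2 : (2 ^ k.+1 = 2 ^ k + 2 ^ k)%N by rewrite expnS mul2n addnn.
have split2 : forall g, \sum_(0 <= n < 2 ^ k.+1) g n =
    \sum_(0 <= n < 2 ^ k) g n + \sum_(0 <= n < 2 ^ k) g (2 ^ k + n)%N.
  move=> g; rewrite e2 (@big_cat_nat _ _ _ (2 ^ k))//= ?leq_addr//.
  by rewrite (sum_nat_shift _ (2 ^ k)) addnK.
rewrite /T split2; apply: lerD; apply: ler_sum => n _; rewrite split2 ?lerDl ?lerDr sumr_ge0//.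
Qed.

Definition pmax f (N : nat) : R := \big[Num.max/0]_(t < N.+1) `|\sum_(0 <= n < t) f n|.

Lemma pmax_ge0 f N : 0 <= pmax f N.
Proof. by rewrite /pmax; elim/big_ind: _ => // x y x0 y0; rewrite le_max x0. Qed.

Lemma le_pmax f N t : (t <= N)%N -> `|\sum_(0 <= n < t) f n| <= pmax f N.
Proof.
move=> tN; have tN' : (t < N.+1)%N by [].
by rewrite /pmax (bigD1 (Ordinal tN'))//= le_max lexx.
Qed.

Lemma pmax_le f N c : 0 <= c -> (forall t, (t <= N)%N -> `|\sum_(0 <= n < t) f n| <= c) ->
  pmax f N <= c.
Proof.
move=> c0 H; rewrite /pmax; elim/big_ind: _ => // [x y xc yc|i _].
  by rewrite ge_max xc.
by apply: H; rewrite -ltnS.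
Qed.

Lemma pmax_sq k f : pmax f (2 ^ k) ^+ 2 <= k.+1%:R * dyadic k f.
Proof.
have h0 : 0 <= k.+1%:R * dyadic k f by rewrite mulr_ge0// dyadic_ge0.
rewrite -[leRHS]sqr_sqrtr// lerXn2r// ?nnegrE ?pmax_ge0 ?sqrtr_ge0//.
apply: pmax_le => [|t tk]; first exact: sqrtr_ge0.
by rewrite -sqrtr_sqr ler_wsqrtr// prefix_sum_sq.
Qed.

Lemma cosnM (a phi : R) (p q r : nat) :
  cosn a phi (r * p) * cosn a phi (r * q)
  = (cosn (a * p%:R - a * q%:R) 0 r + cosn (a * p%:R + a * q%:R) (phi *+ 2) r) / 2.
Proof.
rewrite /cosn !natrM.
rewrite (_ : (a * p%:R - a * q%:R) * r%:R *+ 2 + 0 =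
  (a * (r%:R * p%:R) *+ 2 + phi) - (a * (r%:R * q%:R) *+ 2 + phi)); last by ring.
rewrite (_ : (a * p%:R + a * q%:R) * r%:R *+ 2 + phi *+ 2 =
  (a * (r%:R * p%:R) *+ 2 + phi) + (a * (r%:R * q%:R) *+ 2 + phi)); last by ring.
set x := a * _ *+ 2 + phi; set y := a * _ *+ 2 + phi.
rewrite (cosB x y) (cosD x y); field; done.
Qed.

(* Type II estimate; the maximum removes the dependence of the range of p on r. *)
Lemma bilinear_sum (a phi : R) (P : pred nat) (k m T : nat) (delta : R) :
  (0 < T)%N -> 0 < delta -> sin_separated a T delta ->
  (\sum_(0 <= r < m)
     pmax (fun n => (P (2 ^ k + n)%N)%:R * cosn a phi (r * (2 ^ k + n))) (2 ^ k)) ^+ 2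
  <= m%:R * (k.+1%:R ^+ 2 * ((2 ^ k)%:R * ((((2 ^ k)%:R / T%:R + 1)) *
       (m%:R + T%:R * (delta / 2)^-1)))).
Proof.
move=> T0 d0 sepa; apply: (le_trans (cauchy_sum _ _)); rewrite ler_wpM2l//.
set F := fun r n => (P (2 ^ k + n)%N)%:R * cosn a phi (r * (2 ^ k + n)).
apply: (@le_trans _ _ (\sum_(0 <= r < m) k.+1%:R * dyadic k (F r))).
  by apply: ler_sum => r _; exact: pmax_sq.
rewrite -mulr_sumr expr2 -mulrA ler_wpM2l//.
pose C1 n n' := cap m%:R `|sin (a * n'%:R + - (a * n%:R))|.
pose C2 n n' := cap m%:R `|sin (a * n'%:R + a * (2 ^ k + 2 ^ k + n)%:R)|.
pose K n n' : R := (C1 n n' + C2 n n') / 2.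
have C10 n n' : 0 <= C1 n n' by exact: cap_ge0.
have C20 n n' : 0 <= C2 n n' by exact: cap_ge0.
apply: (@le_trans _ _ (k.+1%:R * \sum_(0 <= n < 2 ^ k) \sum_(0 <= n' < 2 ^ k) K n n')).
  apply: sum_dyadic => [n n'|n n']; first by rewrite /K divr_ge0// addr_ge0.
  have -> : \sum_(0 <= r < m) F r n * F r n' =
     (P (2 ^ k + n)%N)%:R * (P (2 ^ k + n')%N)%:R *
     (\sum_(0 <= r < m) cosn a phi (r * (2 ^ k + n)) * cosn a phi (r * (2 ^ k + n'))).
    by rewrite mulr_sumr; apply: eq_bigr => r _; rewrite /F; ring.
  set S := \sum_(_ <= _ < _) _.
  have SK : `|S| <= K n n'.
    rewrite /S; under eq_bigr do rewrite cosnM.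
    rewrite -mulr_suml big_split/= normrM [X in _ * X]ger0_norm ?invr_ge0//.
    rewrite ler_pM2r ?invr_gt0//; apply: (le_trans (ler_normD _ _)); apply: lerD.
      apply: (le_trans (@sum_cosn_cap _ _ _ _ _ m%:R _)); first by rewrite subn0.
      rewrite /C1 -normrN -sinN; rewrite le_eqVlt; apply/orP; left; apply/eqP.
      by congr (cap _ `|sin _|); rewrite !natrD; ring.
    apply: (le_trans (@sum_cosn_cap _ _ _ _ _ m%:R _)); first by rewrite subn0.
    rewrite /C2 le_eqVlt; apply/orP; left; apply/eqP.
    by congr (cap _ `|sin _|); rewrite !natrD; ring.
  apply: le_trans SK; case: (P _); case: (P _); rewrite ?mul0r ?mulr0 ?mul0r ?mul1r ?normr_ge0 ?ler_norm//.
rewrite ler_wpM2l//.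
rewrite (_ : (2 ^ k)%:R * _ = \sum_(0 <= n < 2 ^ k) ((2 ^ k)%:R / T%:R + 1) * (m%:R + T%:R * (delta / 2)^-1)).
  apply: ler_sum => n _; rewrite /K -mulr_suml big_split/= ler_pdivrMr//.
  by rewrite mulr_natr mulr2n; apply: lerD; apply: sum_cap.
by rewrite sumr_const_nat subn0 mulr_natl.
Qed.

End Bilinear.

(** * Prime, smooth and rough numbers *)

Section Chebyshev.
Local Open Scope nat_scope.

Lemma bin_le_exp2 m k : 'C(m, k) <= 2 ^ m.
Proof.
elim: m k => [|m IH] [|k]; rewrite ?bin0 ?expn_gt0//.
by rewrite binS expnS mul2n -addnn leq_add.
Qed.

Lemma prod_primes_dvd m k N :
  (forall p, m <= p < k -> prime p -> p %| N) -> \prod_(m <= p < k | prime p) p %| N.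
Proof.
elim: k => [|k IH] H; first by rewrite big_geq// dvd1n.
have [mk|km] := leqP m k; last by rewrite big_geq// dvd1n.
rewrite big_mkcond big_nat_recr//= -big_mkcond/=.
have IH' : \prod_(m <= p < k | prime p) p %| N.
  by apply: IH => p /andP[mp pk]; apply: H; rewrite mp ltnS ltnW.
case: ifP => pk; last by rewrite muln1.
rewrite Gauss_dvd ?IH'//=; first by apply: H => //; rewrite mk ltnSn.
rewrite coprime_sym prime_coprime// big_seq_cond.
elim/big_ind: _ => [|x y hx hy|i]; first by rewrite dvdn1; apply: contraTneq pk => ->.
  by rewrite Euclid_dvdM// negb_or hx.
rewrite mem_index_iota => /andP[/andP[_ ik] pi].
by rewrite dvdn_prime2// gtn_eqF.
Qed.

Lemma prime_dvd_central n p : prime p -> n < p <= n + n -> p %| 'C(n + n, n).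
Proof.
move=> pp /andP[np pn].
have : p %| (n + n)`! by rewrite dvdn_fact// prime_gt0.
rewrite -(@bin_fact (n + n) n) ?leq_addr// addnK !Euclid_dvdM//.
have -> : p %| n`! = false.
  apply/negbTE; rewrite fact_prod big_seq_cond.
  elim/big_ind: _ => [|x y hx hy|i]; first by rewrite dvdn1; apply: contraTneq pp => ->.
    by rewrite Euclid_dvdM// negb_or hx.
  rewrite mem_index_iota => /andP[/andP[i1 iN] _]; rewrite gtnNdvd//.
  by rewrite (leq_trans _ np).
by rewrite !orbF.
Qed.

Lemma chebyshev_block j : 0 < j ->
  j * \sum_(2 ^ j <= p < 2 ^ j.+1) prime p <= 2 ^ j.+1.
Proof.
move=> j0.
have [->|j1] : j = 1 \/ 1 < j by lia.
  by rewrite mul1n /index_iota/= unlock.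
set n := 2 ^ j.
have nn : 2 ^ j.+1 = n + n by rewrite expnS mul2n addnn.
have pn : prime n = false.
  apply/negbTE/primePn; right; exists 2; last by rewrite /n -(prednK j0) expnS dvdn_mulr.
  by rewrite /= /n -[X in X < _](expn1 2) ltn_exp2l.
have pnn : prime (n + n) = false.
  apply/negbTE/primePn; right; exists 2; last by rewrite -nn expnS dvdn_mulr.
  by rewrite /= -nn -[X in X < _](expn1 2) ltn_exp2l.
have n0 : 0 < n by rewrite expn_gt0.
set c := \sum_(_ <= _ < _) _.
have : n ^ c <= 'C(n + n, n).
  apply: (@leq_trans (\prod_(n <= p < n + n | prime p) p)).
    rewrite /c nn expn_sum [leqRHS]big_mkcond/= big_seq [leqRHS]big_seq.
    apply: (big_ind2 (fun x y => x <= y)) => // [x1 x2 y1 y2|i]; first exact: leq_mul.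
    rewrite mem_index_iota => /andP[ni _]; case: (prime i) => //; by rewrite expn1.
  apply: dvdn_leq; first by rewrite bin_gt0 leq_addr.
  apply: prod_primes_dvd => p /andP[np pn2] pp; apply: prime_dvd_central => //.
  by rewrite (ltnW pn2) andbT ltn_neqAle np andbT; apply: contraFneq pn => ->.
move=> /leq_trans /(_ (bin_le_exp2 _ _)).
by rewrite /n -expnM leq_exp2l// nn.
Qed.

End Chebyshev.

Section PrimeSums.
Variable R : realType.

Lemma sum_inv_prime_block j : (0 < j)%N ->
  \sum_(2 ^ j <= p < 2 ^ j.+1 | prime p) (p%:R^-1 : R) <= 2 / j%:R.
Proof.
move=> j0.
apply: (@le_trans _ _ (\sum_(2 ^ j <= p < 2 ^ j.+1) ((prime p)%:R * (2 ^ j)%:R^-1))).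
  rewrite big_mkcond/=; apply: ler_sum_nat => p /andP[jp _].
  case: (prime p); rewrite ?mul0r// mul1r lef_pV2 ?posrE ?ltr0n ?expn_gt0 ?ler_nat//.
  by rewrite (leq_trans _ jp)// expn_gt0.
rewrite -mulr_suml -natr_sum ler_pdivrMr ?ltr0n ?expn_gt0// mulrAC ler_pdivlMr ?ltr0n//.
rewrite -[2]/(2%:R) -!natrM ler_nat mulnC -expnS; exact: chebyshev_block.
Qed.

Lemma dyadic_split (f : nat -> R) (P : pred nat) (j0 J : nat) : (j0 <= J)%N ->
  \sum_(2 ^ j0 <= p < 2 ^ J | P p) f p
  = \sum_(j0 <= j < J) \sum_(2 ^ j <= p < 2 ^ j.+1 | P p) f p.
Proof.
move=> j0J; elim: J j0J => [|J IH]; first by rewrite leqn0 => /eqP ->; rewrite !big_geq.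
rewrite leq_eqVlt => /orP[/eqP ->|]; first by rewrite !big_geq.
rewrite ltnS => jJ; rewrite big_nat_recr//= -IH// -big_cat_nat ?leq_exp2l//.
Qed.

Lemma sum_inv_prime J : \sum_(0 <= p < 2 ^ J.+1 | prime p) (p%:R^-1 : R) <=
  2 * \sum_(1 <= j < J.+1) j%:R^-1.
Proof.
rewrite (@big_cat_nat _ _ _ (2 ^ 1)) ?leq_exp2l//=.
rewrite [X in X + _]big1_seq ?add0r.
  rewrite dyadic_split// mulr_sumr; apply: ler_sum_nat => j /andP[j0 _].
  exact: sum_inv_prime_block.
move=> p /andP[pp]; rewrite mem_index_iota => /andP[_].
by rewrite ltnNge prime_gt1.
Qed.

Lemma harmonic_ln n : (0 < n)%N -> \sum_(1 <= j < n.+1) (j%:R^-1 : R) <= 1 + ln n%:R.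
Proof.
elim: n => // -[|n] IH _; first by rewrite big_nat1 ln1 invr1 addr0.
rewrite big_nat_recr//=; apply: (le_trans (lerD (IH isT) (lexx _))).
rewrite -addrA lerD2l.
have n0 : 0 < n.+1%:R :> R by [].
have n1 : 0 < n.+2%:R :> R by [].
have : ln (1 + - (n.+2%:R^-1)) <= - (n.+2%:R^-1) :> R.
  by apply: le_ln1Dx; rewrite ltrN2 invf_lt1// ltr1n.
have -> : 1 + - n.+2%:R^-1 = n.+1%:R / n.+2%:R :> R.
  by rewrite -(natr1 n.+1) in n1 *; field; rewrite gt_eqF.
rewrite ln_div ?posrE//.
move: (ln _) (ln _) (n.+2%:R^-1) => x z t; lra.
Qed.

End PrimeSums.

Section Smooth.
Variable R : realType.
Implicit Types (f g : nat -> R).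

Definition smooth (y : nat) : pred nat := pnat [pred p | (p < y)%N].
Definition rough (y : nat) : pred nat := pnat [pred p | (y <= p)%N].

Lemma smoothP y n : (0 < n)%N ->
  reflect (forall p, prime p -> (p %| n)%N -> (p < y)%N) (smooth y n).
Proof. by move=> n0; apply: (iffP (pnatP _ n0)) => H p pp /H; rewrite inE; apply. Qed.

Lemma roughP y n : (0 < n)%N ->
  reflect (forall p, prime p -> (p %| n)%N -> (y <= p)%N) (rough y n).
Proof. by move=> n0; apply: (iffP (pnatP _ n0)) => H p pp /H; rewrite inE; apply. Qed.

Lemma sum_dvd f (P : pred nat) (k X : nat) : (0 < k)%N ->
  \sum_(1 <= n < X.+1 | P n && (k %| n)%N) f n
  = \sum_(1 <= m < (X %/ k).+1 | P (k * m)%N) f (k * m)%N.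
Proof.
move=> k0; elim: X => [|X IH]; first by rewrite div0n !big_geq.
rewrite big_mkcond big_nat_recr//= -big_mkcond/= IH.
case: (boolP (k %| X.+1)%N) => kX; last first.
  by rewrite andbF addr0 divnS// (negbTE kX).
rewrite andbT divnS// kX add1n [RHS]big_mkcond [in RHS]big_nat_recr//= -big_mkcond/=.
suff -> : (k * (X %/ k).+1 = X.+1)%N by [].
by rewrite -add1n -[(1 + _)%N]/((true + _)%N) -kX -divnS// mulnC divnK.
Qed.

Lemma sum_pred_split f (P Q : pred nat) a b :
  \sum_(a <= n < b | P n) f n
  = \sum_(a <= n < b | P n && ~~ Q n) f n + \sum_(a <= n < b | P n && Q n) f n.
Proof. by rewrite (bigID Q)/= addrC. Qed.

Lemma smoothS_nprime k n : ~~ prime k -> smooth k.+1 n = smooth k n.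
Proof.
move=> kp; have [->|n0] := posnP n; first by [].
apply/smoothP/smoothP => // H p pp pn; last by rewrite ltnS ltnW// H.
have := H p pp pn; rewrite ltnS leq_eqVlt => /orP[/eqP pk|//].
by rewrite -pk pp in kp.
Qed.

Lemma roughS_nprime k n : ~~ prime k -> rough k.+1 n = rough k n.
Proof.
move=> kp; have [->|n0] := posnP n; first by [].
apply/roughP/roughP => // H p pp pn; first by rewrite ltnW// H.
have := H p pp pn; rewrite leq_eqVlt => /orP[/eqP pk|//].
by rewrite pk pp in kp.
Qed.

Lemma smoothS_prime k n : prime k -> smooth k.+1 n && ~~ (k %| n)%N = smooth k n.
Proof.
move=> kp; have [->|n0] := posnP n; first by rewrite dvdn0 andbF.
apply/andP/smoothP => // [[/smoothP H kn] p pp pn|H].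
  have := H n0 p pp pn; rewrite ltnS leq_eqVlt => /orP[/eqP pk|//].
  by rewrite -pk pn in kn.
split; first by apply/smoothP => // p pp pn; rewrite ltnS ltnW// H.
by apply/negP => kn; have := H k kp kn; rewrite ltnn.
Qed.

Lemma roughS_prime k n : prime k -> rough k n && ~~ (k %| n)%N = rough k.+1 n.
Proof.
move=> kp; have [->|n0] := posnP n; first by rewrite dvdn0 andbF.
apply/andP/roughP => // [[/roughP H kn] p pp pn|H].
  have := H n0 p pp pn; rewrite leq_eqVlt => /orP[/eqP pk|//].
  by rewrite pk pn in kn.
split; first by apply/roughP => // p pp pn; rewrite ltnW// H.
by apply/negP => kn; have := H k kp kn; rewrite ltnn.
Qed.

Lemma smoothM y m n : smooth y (m * n) = smooth y m && smooth y n.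
Proof. exact: pnatM. Qed.

Lemma roughM y m n : rough y (m * n) = rough y m && rough y n.
Proof. exact: pnatM. Qed.

Lemma smooth_prime y p : prime p -> smooth y p = (p < y)%N.
Proof. by move=> pp; rewrite /smooth pnatE// inE. Qed.

Lemma rough_prime y p : prime p -> rough y p = (y <= p)%N.
Proof. by move=> pp; rewrite /rough pnatE// inE. Qed.

(* Iterating Buchstab's identity gives the combinatorial sieve of Legendre. *)
Lemma legendre_sieve y g X :
  `|\sum_(1 <= n < X.+1 | rough y n) g n|
  <= \sum_(1 <= e < X.+1 | smooth y e) `|\sum_(1 <= l < (X %/ e).+1) g (e * l)%N|.
Proof.
elim: y g X => [|k IH] g X.
  case: X => [|X]; first by rewrite !big_geq// normr0.
  rewrite [leRHS]big_ltn_cond//= divn1.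
  have -> : \sum_(1 <= n < X.+2 | rough 0 n) g n = \sum_(1 <= l < X.+2) g (1 * l)%N.
    rewrite big_nat_cond [RHS]big_nat_cond; apply: eq_big => n; last by rewrite mul1n.
    by rewrite andbT; case: (1 <= n < X.+2)%N / boolP => //= /andP[n1 _]; apply/roughP.
  by rewrite lerDl sumr_ge0.
have [kp|kp] := boolP (prime k); last first.
  rewrite (eq_bigl _ _ (fun n => roughS_nprime n kp)).
  by rewrite [leRHS](eq_bigl _ _ (fun n => smoothS_nprime n kp)).
have k0 := prime_gt0 kp.
have E1 : \sum_(1 <= n < X.+1 | rough k.+1 n) g n =
  \sum_(1 <= n < X.+1 | rough k n) g n
  - \sum_(1 <= n < (X %/ k).+1 | rough k n) g (k * n)%N.
  rewrite [X in _ = X - _](@sum_pred_split _ _ (dvdn k)) sum_dvd//.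
  rewrite (eq_bigl _ _ (fun n => roughS_prime n kp)).
  rewrite [X in _ + X - _](eq_bigl (rough k)) ?addrK// => n.
  by rewrite roughM rough_prime// leqnn.
rewrite E1; apply: (le_trans (ler_normB _ _)).
rewrite [leRHS](@sum_pred_split _ _ (dvdn k)) sum_dvd//.
rewrite [X in _ <= X + _](eq_bigl _ _ (fun n => smoothS_prime n kp)).
apply: lerD; first exact: IH.
apply: (le_trans (IH (fun n => g (k * n)%N) _)).
rewrite big_mkcond [leRHS]big_mkcond/=; apply: ler_sum => e _.
rewrite smoothM (smooth_prime _ kp) ltnSn/=.
case: ifP => se.
  have -> : smooth k.+1 e.
    by move: se; rewrite -(smoothS_prime e kp) => /andP[].
  rewrite divnMA le_eqVlt; apply/orP; left; apply/eqP; congr `|_|.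
  by apply: eq_bigr => l _; rewrite mulnA.
by case: ifP.
Qed.

Lemma rankin (w : nat -> R) y X :
  (forall n, 0 <= w n) -> (forall m n, (0 < m)%N -> (0 < n)%N -> w (m * n)%N = w m * w n) ->
  w 1%N = 1 ->
  (forall p, prime p -> w p < 1) ->
  \sum_(1 <= n < X.+1 | smooth y n) w n
  <= \prod_(0 <= p < y | prime p) (1 - w p)^-1.
Proof.
move=> w0 wM w1 wp.
elim: y X => [|k IH] X.
  rewrite big_geq//; case: X => [|X]; first by rewrite big_geq.
  rewrite big_ltn_cond//= w1 big1_seq ?addr0// => n.
  rewrite mem_index_iota => /andP[sn /andP[n1 _]].
  have /smoothP := sn => /(_ (ltnW n1)) /(_ (pdiv n) (pdiv_prime n1) (pdiv_dvd n)).
  by rewrite ltn0.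
rewrite [leRHS]big_mkcond [leRHS]big_nat_recr//= -big_mkcond/=.
set G := \prod_(_ <= _ < _ | _) _ in IH *.
have [kp|kp] := boolP (prime k); last first.
  by rewrite mulr1 (eq_bigl _ _ (fun n => smoothS_nprime n kp)).
have k0 := prime_gt0 kp.
elim/ltn_ind: X => X IHX.
have [X0|X0] := posnP X.
  rewrite X0 big_geq// mulr_ge0// ?invr_ge0 ?subr_ge0 ?(ltW (wp _ kp))//.
  by apply: prodr_ge0 => p pp; rewrite invr_ge0 subr_ge0 ltW// wp.
rewrite (@sum_pred_split _ _ (dvdn k)) sum_dvd//.
rewrite (eq_bigl _ _ (fun n => smoothS_prime n kp)).
apply: (@le_trans _ _ (G + w k * (G * (1 - w k)^-1))).
  apply: lerD; first exact: IH.
  rewrite (eq_bigl (smooth k.+1)); last by move=> n; rewrite smoothM smooth_prime// ltnSn.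
  rewrite big_nat_cond (eq_bigr (fun n => w k * w n)); last first.
    by move=> n /andP[/andP[n0 _] _]; rewrite wM.
  rewrite -big_nat_cond -mulr_sumr ler_wpM2l//; apply: IHX.
  by rewrite ltn_Pdiv// prime_gt1.
have := wp _ kp; rewrite -subr_gt0 => h.
rewrite le_eqVlt; apply/orP; left; apply/eqP; field; lra.
Qed.

End Smooth.

(** * Sums over primes *)

Section Reindex.
Variable R : realType.
Implicit Types (f g : nat -> R).

Lemma sum_by_divisor f (P : pred nat) (q : nat -> nat) X :
  (forall n, (0 < n)%N -> P n -> (0 < q n)%N && (q n %| n)%N) ->
  \sum_(1 <= n < X.+1 | P n) f n =
  \sum_(1 <= m < X.+1)
     \sum_(1 <= p < X.+1 | [&& (p * m <= X)%N, P (p * m)%N & q (p * m)%N == p]) f (p * m)%N.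
Proof.
move=> H.
transitivity (\sum_(1 <= p < X.+1) \sum_(1 <= n < X.+1 | P n && (q n == p)) f n).
  rewrite [RHS](eq_bigr (fun p => \sum_(1 <= n < X.+1) if P n && (q n == p) then f n else 0)); last first.
    by move=> p _; rewrite big_mkcond.
  rewrite exchange_big/= big_mkcond; apply: eq_big_nat => n /andP[n0 nX].
  case: ifP => Pn; last by rewrite big1.
  have /andP[q0 qn] := H n n0 Pn.
  have qX : (q n < X.+1)%N by apply: leq_ltn_trans nX; exact: dvdn_leq.
  rewrite -big_mkcond (big_rem (q n))/= ?mem_index_iota ?q0// eqxx.
  rewrite big1_seq ?addr0// => p /andP[/eqP <-].
  by rewrite mem_rem_uniq ?iota_uniq// !inE eqxx.
rewrite [RHS](eq_bigr (fun m => \sum_(1 <= p < X.+1)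
   if [&& (p * m <= X)%N, P (p * m)%N & q (p * m)%N == p] then f (p * m)%N else 0)); last first.
  by move=> m _; rewrite big_mkcond.
rewrite [RHS]exchange_big/=; apply: eq_big_nat => p /andP[p0 pX].
rewrite -big_mkcond/=.
transitivity (\sum_(1 <= n < X.+1 | (P n && (q n == p)) && (p %| n)%N) f n).
  rewrite big_nat_cond [RHS]big_nat_cond; apply: eq_bigl => n.
  case: (boolP (1 <= n < X.+1)%N) => //= /andP[n0 _].
  case: (boolP (P n)) => //= Pn; case: eqP => //= <-.
  by have /andP[_ ->] := H n n0 Pn.
rewrite sum_dvd// [LHS](@big_nat_widen _ _ _ _ _ X.+1) ?ltnS ?leq_div//.
by apply: eq_bigl => m; rewrite ltnS leq_divRL// (mulnC m) andbC.
Qed.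

End Reindex.

Section Convex.
Variable R : realType.
Implicit Types (f g : nat -> R) (W : pred nat).

Definition convex_pred W :=
  forall i j k : nat, (i <= j)%N -> (j <= k)%N -> W i -> W k -> W j.

Lemma convex_pred_nat W N : convex_pred W ->
  exists s t : nat, (s <= t <= N)%N /\ forall n, (n < N)%N -> W n = (s <= n < t)%N.
Proof.
move=> cW; elim: N => [|N [s [t [/andP[st tN] H]]]].
  by exists 0%N, 0%N.
case: (boolP (W N)) => WN; last first.
  exists s, t; split; first by rewrite st ltnW.
  move=> n; rewrite ltnS leq_eqVlt => /orP[/eqP ->|nN]; last exact: H.
  by rewrite (negbTE WN); apply/esym/negbTE; rewrite negb_and -!ltnNge ltnS tN orbT.
have [ts|ts] := leqP t s.
  exists N, N.+1; split; first by rewrite leqnSn leqnn.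
  move=> n; rewrite ltnS leq_eqVlt => /orP[/eqP ->|nN]; first by rewrite WN eqxx leqnn.
  by rewrite H//; lia.
have tN' : t = N.
  apply/eqP; rewrite eqn_leq tN /= leqNgt; apply/negP => tN2.
  have Wt : W t.
    apply: (cW s t N) => //; first by rewrite H ?leqnn//; lia.
  by move: Wt; rewrite H// ltnn andbF.
exists s, N.+1; split; first by rewrite ltnSn andbT; lia.
move=> n; rewrite ltnS leq_eqVlt => /orP[/eqP ->|nN]; first by rewrite WN; lia.
by rewrite H//; lia.
Qed.

Lemma convex_predI W W' : convex_pred W -> convex_pred W' -> convex_pred (predI W W').
Proof.
by move=> h h' i j k ij jk /andP[/= a b] /andP[c d]; rewrite /= (h i j k)// (h' i j k).
Qed.

Lemma convex_sum f W N : convex_pred W ->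
  `|\sum_(0 <= n < N | W n) f n| <= 2 * pmax f N.
Proof.
move=> cW; have [s [t [/andP[st tN] H]]] := convex_pred_nat N cW.
have -> : \sum_(0 <= n < N | W n) f n = \sum_(0 <= n < t) f n - \sum_(0 <= n < s) f n.
  rewrite [X in _ = X - _](@big_cat_nat _ _ _ s 0 t)//= [X in _ = X - _]addrC addrK.
  rewrite (@big_nat_widen _ _ _ s t N)// (@big_nat_widenl _ _ _ s 0 N)//.
  rewrite big_nat_cond [RHS]big_nat_cond; apply: eq_bigl => n /=.
  by case: (boolP (n < N)%N) => //= nN; rewrite H// andbC.
apply: (le_trans (ler_normB _ _)); rewrite mulr_natl mulr2n.
by apply: lerD; apply: le_pmax => //; apply: leq_trans tN.
Qed.

(* Inclusion-exclusion on the union of the last |s|-1 intervals with the first one *)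
Lemma convex_union_sum (T : Type) (J : T -> pred nat) (s : seq T) f W N :
  (forall i, convex_pred (J i)) -> convex_pred W ->
  `|\sum_(0 <= n < N | W n && has (J ^~ n) s) f n| <= 2 ^+ size s * (2 * pmax f N).
Proof.
move=> cJ.
have e0 : 0 <= 2 * pmax f N by rewrite mulr_ge0// pmax_ge0.
suff : forall W, convex_pred W -> `|\sum_(0 <= n < N | W n && has (J ^~ n) s) f n|
    <= (2 ^+ size s - 1) * (2 * pmax f N).
  by move=> /[apply] h; apply: (le_trans h); rewrite ler_wpM2r// gerBl.
elim: s => [|i s IH] {}W cW /=.
  by rewrite big_pred0 ?normr0 ?subrr ?mul0r// => n; rewrite andbF.
have -> : \sum_(0 <= n < N | W n && (J i n || has (J ^~ n) s)) f n =
   \sum_(0 <= n < N | predI W (J i) n) f n + \sum_(0 <= n < N | W n && has (J ^~ n) s) f n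
   - \sum_(0 <= n < N | predI W (J i) n && has (J ^~ n) s) f n.
  rewrite [in LHS]big_mkcond [X in _ = X + _ - _]big_mkcond.
  rewrite [X in _ = _ + X - _]big_mkcond [X in _ = _ - X]big_mkcond -big_split -sumrB/=.
  apply: eq_bigr => n _.
  by case: (W n); case: (J i n); case: (has _ _); rewrite /= ?addr0 ?add0r ?subr0 ?addrK ?subrr ?oppr0.
apply: (le_trans (ler_normB _ _)).
have h1 := @convex_sum f (predI W (J i)) N (convex_predI cW (cJ i)).
have h2 := IH _ cW.
have h3 := IH _ (convex_predI cW (cJ i)).
have := ler_normD (\sum_(0 <= n < N | predI W (J i) n) f n)
   (\sum_(0 <= n < N | W n && has (J ^~ n) s) f n).
rewrite exprS; move: h1 h2 h3; set S1 := `|_|; set S2 := `|_|; set S3 := `|_|.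
set e := 2 * _ in e0 *; nra.
Qed.

End Convex.

Section PrimeSum.
Variable R : realType.
Implicit Types (a phi delta : R).

Definition block a phi (j r : nat) : R :=
  pmax (fun n => (prime (2 ^ j + n))%:R * cosn a phi (r * (2 ^ j + n))) (2 ^ j).

Lemma block_ge0 a phi j r : 0 <= block a phi j r.
Proof. exact: pmax_ge0. Qed.

Lemma block_shift a phi j r (W : pred nat) :
  \sum_(2 ^ j <= p < 2 ^ j.+1 | prime p && W p) cosn a phi (r * p) =
  \sum_(0 <= n < 2 ^ j | W (2 ^ j + n)%N) (prime (2 ^ j + n))%:R * cosn a phi (r * (2 ^ j + n)).
Proof.
rewrite big_mkcond sum_nat_shift [RHS]big_mkcond/= expnS mul2n -addnn addnK.
apply: eq_bigr => n _; case: (prime _); case: (W _) => //=; first by rewrite mul1r.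
by rewrite mul0r.
Qed.

Lemma convex_shift (W : pred nat) c : convex_pred W -> convex_pred (fun n => W (c + n)%N).
Proof. by move=> h i j k ij jk; apply: h; rewrite leq_add2l. Qed.

Lemma block_convex a phi j r W : convex_pred W ->
  `|\sum_(2 ^ j <= p < 2 ^ j.+1 | prime p && W p) cosn a phi (r * p)|
  <= 2 * block a phi j r.
Proof. by move=> cW; rewrite block_shift; apply: convex_sum; exact: convex_shift. Qed.

Lemma pdiv_mul_eq p m : prime p -> (1 < m)%N -> (p <= pdiv m)%N -> pdiv (p * m) = p.
Proof.
move=> pp m1 pm; apply/eqP; rewrite eqn_leq; apply/andP; split.
  by apply: pdiv_min_dvd; rewrite ?prime_gt1// dvdn_mulr.
have pm1 : (1 < p * m)%N by rewrite (leq_trans m1)// leq_pmull// prime_gt0.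
have := pdiv_dvd (p * m); rewrite Euclid_dvdM ?pdiv_prime// => /orP[h|h].
  by rewrite (eqP (_ : pdiv (p * m)%N == p))// -dvdn_prime2// pdiv_prime.
by apply: (leq_trans pm); apply: pdiv_min_dvd => //; rewrite prime_gt1// pdiv_prime.
Qed.

Lemma composite_cond y X p m : (0 < m)%N -> (0 < p)%N ->
  [&& (p * m <= X)%N, rough y (p * m)%N && ((1 < p * m)%N && ~~ prime (p * m)%N) &
      pdiv (p * m)%N == p]
  = [&& (y <= p)%N, prime p & [&& (1 < m)%N, (p <= pdiv m)%N & (p * m <= X)%N]].
Proof.
move=> m0 p0; have pm0 : (0 < p * m)%N by rewrite muln_gt0 p0.
apply/idP/idP => [/and3P[-> /andP[/(roughP _ pm0) rpm /andP[pm1 npm]] /eqP pd]|].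
  have pp : prime p by rewrite -pd pdiv_prime.
  have m1 : (1 < m)%N.
    by rewrite ltn_neqAle m0 andbT; apply: contra npm => /eqP <-; rewrite muln1.
  rewrite rpm// ?dvdn_mulr// pp m1 andbT/= -{1}pd; apply: pdiv_min_dvd.
    by rewrite prime_gt1// pdiv_prime.
  by rewrite dvdn_mull// pdiv_dvd.
move=> /and5P[yp pp m1 pm ->]/=; rewrite pdiv_mul_eq// eqxx andbT.
apply/and3P; split.
- apply/roughP => // q pq; rewrite Euclid_dvdM// => /orP[|qm].
    by rewrite dvdn_prime2// => /eqP ->.
  by rewrite (leq_trans yp)// (leq_trans pm)// pdiv_min_dvd// prime_gt1.
- by rewrite (leq_trans m1)// leq_pmull.
- apply/primePn; right; exists p; last by rewrite dvdn_mulr.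
  by rewrite prime_gt1//= ltn_Pmulr.
Qed.

Lemma sum_dyadic_blocks f (W : pred nat) X j0 J : (X < 2 ^ J)%N -> (j0 <= J)%N ->
  (forall p, W p -> (p <= X)%N) ->
  \sum_(1 <= p < X.+1 | (2 ^ j0 <= p)%N && (prime p && W p)) f p
  = \sum_(j0 <= j < J) \sum_(2 ^ j <= p < 2 ^ j.+1 | prime p && W p) (f p : R).
Proof.
move=> XJ jJ WX; rewrite -dyadic_split//.
rewrite [RHS](@big_nat_widenl _ _ _ _ 1) ?expn_gt0//.
rewrite (@big_nat_widen _ _ _ _ X.+1 (2 ^ J))//.
rewrite big_nat_cond [RHS]big_nat_cond; apply: eq_bigl => p /=.
case: (boolP (1 <= p < 2 ^ J)%N) => //= _.
case: (boolP (W p)) => [/WX pX|]; rewrite ?andbF//= ltnS pX !andbT; exact: andbC.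
Qed.

Lemma composite_sum a phi X j0 J : (X < 2 ^ J)%N -> (j0 <= J)%N ->
  `|\sum_(1 <= n < X.+1 | rough (2 ^ j0) n && ((1 < n)%N && ~~ prime n)) cosn a phi n|
  <= \sum_(j0 <= j < J | (4 ^ j <= X)%N)
       2 * \sum_(0 <= r < (X %/ 2 ^ j).+1) block a phi j r.
Proof.
move=> XJ jJ; rewrite (@sum_by_divisor _ _ _ pdiv); last first.
  by move=> n n0 _; rewrite pdiv_gt0 pdiv_dvd.
apply: (le_trans (ler_norm_sum _ _ _)).
pose W m p := [&& (1 < m)%N, (p <= pdiv m)%N & (p * m <= X)%N].
have cW m : convex_pred (W m).
  move=> i j k ij jk /and3P[m1 _ _] /and3P[_ kp km]; apply/and3P; split => //.
    exact: leq_trans kp.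
  by apply: leq_trans km; rewrite leq_mul2r jk orbT.
apply: (@le_trans _ _ (\sum_(1 <= m < X.+1) \sum_(j0 <= j < J)
    if (4 ^ j <= X)%N && (m < (X %/ 2 ^ j).+1)%N then 2 * block a phi j m else 0)).
  apply: ler_sum_nat => m /andP[m0 mX].
  have -> : \sum_(1 <= p < X.+1 | [&& (p * m <= X)%N,
       rough (2 ^ j0) (p * m)%N && ((1 < p * m)%N && ~~ prime (p * m)%N) & pdiv (p * m)%N == p])
       cosn a phi (p * m) =
     \sum_(1 <= p < X.+1 | (2 ^ j0 <= p)%N && (prime p && W m p)) cosn a phi (m * p).
    rewrite big_nat_cond [RHS]big_nat_cond; apply: eq_big => p; last by rewrite mulnC.
    by case: (boolP (1 <= p < X.+1)%N) => //= /andP[p0 _]; rewrite composite_cond.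
  rewrite (@sum_dyadic_blocks _ (W m) X j0 J)//; last first.
    by move=> p /and3P[_ _]; apply: leq_trans; rewrite leq_pmulr.
  apply: (le_trans (ler_norm_sum _ _ _)); apply: ler_sum_nat => j _.
  case: ifP => [_|jm]; first exact: block_convex.
  rewrite big_nat_cond big_pred0 ?normr0// => p; apply: contraFF jm.
  move=> /andP[/andP[jp _] /andP[_ /and3P[m1 pm pmX]]].
  have h : (2 ^ j * m <= X)%N by apply: leq_trans pmX; rewrite leq_mul2r jp orbT.
  rewrite ltnS leq_divRL ?expn_gt0// mulnC h andbT.
  apply: leq_trans h; rewrite -[4%N]/(2 * 2)%N expnMn leq_mul2l.
  by rewrite (leq_trans jp)// ?(leq_trans pm)// ?orbT// pdiv_leq// ltnW.
rewrite exchange_big/= [leRHS]big_mkcond/=; apply: ler_sum => j _.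
case: ifP => /= _; last by rewrite big1.
rewrite mulr_sumr -big_mkcond/=.
rewrite [leRHS](@big_nat_widen _ _ _ _ _ X.+1) ?ltnS ?leq_div//.
rewrite [leRHS]big_mkcond [leRHS]big_ltn//= -big_mkcond/= lerDr mulr_ge0// block_ge0//.
Qed.

Lemma cosnZ a phi e l : cosn a phi (e * l) = cosn (a * e%:R) phi l.
Proof. by rewrite /cosn natrM mulrA. Qed.

Lemma typeI_sum a delta V T Q : (0 < T)%N -> 0 < delta -> 0 <= V -> sin_separated a T delta ->
  \sum_(1 <= e < Q.+1 * T) cap (V / e%:R) `|sin (a * e%:R)|
  <= Q.+1%:R * (T%:R * (delta / 2)^-1) + V / T%:R * \sum_(1 <= q < Q.+1) q%:R^-1.
Proof.
move=> T0 d0 V0 sepa; have d2 : 0 < delta / 2 by lra.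
elim: Q => [|Q IH].
  rewrite [X in _ + _ * X]big_geq// mulr0 addr0 !mul1r mul1n.
  apply: (@le_trans _ _ ((T - 1)%:R * (delta / 2)^-1)).
    apply: sum_nat_const_le => e eT; apply: cap_le_inv => //.
    by apply: le_trans (sepa _ eT); lra.
  by rewrite ler_wpM2r ?ler_nat ?leq_subr// invr_ge0 ltW.
rewrite (@big_cat_nat _ _ _ (Q.+1 * T))/= ?leq_mul2r ?leqnSn ?orbT//; last first.
  by rewrite muln_gt0.
rewrite [X in _ <= _ + _ * X]big_nat_recr//= mulrDr addrA.
rewrite -(natr1 Q.+1) mulrDl mul1r.
set S := \sum_(1 <= i < Q.+1) _ in IH *; set t := T%:R * _ in IH *.
rewrite (_ : _ + t + _ + _ = (Q.+1%:R * t + V / T%:R * S) + (t + V / T%:R * Q.+1%:R^-1)); last by ring.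
apply: lerD => //.
have QT0 : 0 < Q.+1%:R * T%:R :> R by rewrite -natrM ltr0n muln_gt0.
apply: (@le_trans _ _ (\sum_(Q.+1 * T <= e < Q.+1 * T + T)
    cap (V / (Q.+1%:R * T%:R)) `|sin (a * e%:R + 0)|)).
  rewrite (mulSn Q.+1) [(T + _)%N]addnC; apply: ler_sum_nat => e /andP[Qe _].
  have e0 : 0 < e%:R :> R by rewrite (lt_le_trans QT0)// -natrM ler_nat.
  rewrite addr0; apply: le_cap => //.
    apply: (le_trans (cap_le _ _)) => //; rewrite ler_wpM2l// lef_pV2 ?posrE//.
    by rewrite -natrM ler_nat.
  rewrite /cap; case: ifP => // h; have [->|sn] := eqVneq `|sin (a * e%:R)| 0.
    by rewrite mulr0.
  by rewrite mulVf.
apply: (le_trans (sum_cap_block 0 _ d0 _ sepa (leqnn T))).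
  by rewrite divr_ge0// ltW.
by rewrite addrC lerD2l invfM mulrA mulrAC.
Qed.

Lemma sum_smooth_cosn a phi y X N :  (X <= N)%N ->
  \sum_(1 <= e < X.+1 | smooth y e) `|\sum_(1 <= l < (X %/ e).+1) cosn a phi (e * l)|
  <= \sum_(1 <= e < N.+1 | smooth y e) cap (N%:R / e%:R) `|sin (a * e%:R)|.
Proof.
move=> XN.
apply: (@le_trans _ _ (\sum_(1 <= e < X.+1 | smooth y e) cap (N%:R / e%:R) `|sin (a * e%:R)|)).
  rewrite big_nat_cond [leRHS]big_nat_cond; apply: ler_sum => e /andP[/andP[e0 eX] _].
  under eq_bigr do rewrite cosnZ.
  apply: sum_cosn_cap; rewrite subSS subn0 ler_pdivlMr ?ltr0n// -natrM ler_nat.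
  exact: leq_trans (leq_trunc_div _ _) XN.
rewrite [leRHS](@big_cat_nat _ _ _ X.+1)//= lerDl sumr_ge0// => e _.
by apply: cap_ge0 => //; rewrite divr_ge0.
Qed.

(* Sum over primes, by the identity primes = rough numbers - 1 - rough composites *)
Lemma prime_sum a phi j0 J N Q T delta : (0 < T)%N -> 0 < delta -> sin_separated a T delta ->
  (N < 2 ^ J)%N -> (j0 <= J)%N ->
  pmax (fun p => (prime p)%:R * cosn a phi p) N.+1 <=
  (2 ^ j0)%:R + 1 + (Q.+1%:R * (T%:R * (delta / 2)^-1) + N%:R / T%:R * \sum_(1 <= q < Q.+1) q%:R^-1)
  + \sum_(1 <= e < N.+1 | smooth (2 ^ j0) e && (Q.+1 * T <= e)%N) (N%:R / e%:R)
  + \sum_(j0 <= j < J | (4 ^ j <= N)%N)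
       2 * \sum_(0 <= r < (N %/ 2 ^ j).+1) block a phi j r.
Proof.
move=> T0 d0 sepa NJ jJ.
have d2 : 0 < delta / 2 by lra.
set E1 := Q.+1%:R * _ + _; set E2 := \sum_(1 <= e < N.+1 | _) _; set E3 := \sum_(j0 <= j < J | _) _.
have E20 : 0 <= E2 by apply: sumr_ge0 => e _; rewrite divr_ge0.
have E10 : 0 <= E1.
  rewrite addr_ge0 ?mulr_ge0 ?invr_ge0 ?(ltW d2)//.
  by apply: sumr_ge0 => q _; rewrite invr_ge0.
have E30 : 0 <= E3.
  by apply: sumr_ge0 => j _; rewrite mulr_ge0//; apply: sumr_ge0 => r _; exact: block_ge0.
have y0 : 0 <= (2 ^ j0)%:R :> R by [].
apply: pmax_le; first lra.
case=> [|X] XN.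
  by rewrite big_geq// normr0; lra.
set y := (2 ^ j0)%N.
have g1 n : `|cosn a phi n| <= 1 by exact: cosn_le1.
have -> : \sum_(0 <= p < X.+1) (prime p)%:R * cosn a phi p =
   \sum_(1 <= p < X.+1 | prime p && ~~ rough y p) cosn a phi p
   + (\sum_(1 <= n < X.+1 | rough y n) cosn a phi n
      - \sum_(1 <= n < X.+1 | rough y n && ((1 < n)%N && ~~ prime n)) cosn a phi n
      - \sum_(1 <= n < X.+1 | n == 1%N) cosn a phi n).
  rewrite big_ltn//= mul0r add0r.
  rewrite [X in _ = X + _]big_mkcond [X in _ = _ + (X - _ - _)]big_mkcond.
  rewrite [X in _ = _ + (_ - X - _)]big_mkcond.
  rewrite [X in _ = _ + (_ - _ - X)]big_mkcond -!sumrB -big_split/=.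
  apply: eq_big_nat => n /andP[n0 _]; case: (ltngtP 1 n) n0 => // [n1|<-] _.
    by case: (prime n); case: (rough y n); rewrite /= ?mul1r ?mul0r ?subr0 ?addr0 ?add0r ?subrr ?subr0.
  have -> : rough y 1 by apply/roughP => // p pp; rewrite dvdn1 => /eqP p1; rewrite p1 in pp.
  by rewrite /= mul0r subr0 subrr addr0.
apply: (le_trans (ler_normD _ _)).
have h0 : `|\sum_(1 <= p < X.+1 | prime p && ~~ rough y p) cosn a phi p| <= y%:R.
  apply: (le_trans (ler_norm_sum _ _ _)).
  apply: (@le_trans _ _ (\sum_(1 <= p < X.+1 | (p < y)%N) 1%:R)).
    rewrite big_mkcond [leRHS]big_mkcond/=; apply: ler_sum => p _.
    case: (boolP (prime p)) => //= pp; last by case: ifP.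
    by rewrite rough_prime// -ltnNge; case: ifP.
  rewrite -natr_sum ler_nat sum1_count.
  rewrite -[leqRHS](size_iota 0) -size_filter.
  apply: uniq_leq_size; first by rewrite filter_uniq// iota_uniq.
  by move=> p; rewrite mem_filter mem_iota => /andP[].
have h1 : `|\sum_(1 <= n < X.+1 | n == 1%N) cosn a phi n| <= 1.
  apply: (le_trans (ler_norm_sum _ _ _)).
  apply: (@le_trans _ _ (\sum_(1 <= p < X.+1 | (p == 1)%N) 1%:R)).
    by apply: ler_sum.
  rewrite -natr_sum sum1_count -[1]/(1%:R) ler_nat.
  by rewrite -[X in (X <= _)%N]/(count_mem 1%N _) count_uniq_mem ?iota_uniq ?leq_b1.
have h2 : `|\sum_(1 <= n < X.+1 | rough y n) cosn a phi n| <= E1 + E2.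
  apply: (le_trans (legendre_sieve _ _ _)).
  apply: (le_trans (sum_smooth_cosn a phi y (_ : X <= N)%N)) => //.
  have V0 : 0 <= N%:R :> R by [].
  apply: (@le_trans _ _ (\sum_(1 <= e < Q.+1 * T) cap (N%:R / e%:R) `|sin (a * e%:R)| + E2)); last first.
    by rewrite lerD2r; apply: typeI_sum.
  have cap0 e : 0 <= cap (N%:R / e%:R) `|sin (a * e%:R)| by apply: cap_ge0 => //; rewrite divr_ge0.
  rewrite (bigID (fun e => (Q.+1 * T <= e)%N))/= addrC; apply: lerD; last first.
    by apply: ler_sum => e _; exact: cap_le.
  rewrite (eq_bigl (fun e => smooth y e && (e < Q.+1 * T)%N)); last by move=> e; rewrite ltnNge.
  have [h|h] := leqP N.+1 (Q.+1 * T).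
    rewrite [leRHS](@big_cat_nat _ _ _ N.+1)//= -[leLHS]addr0; apply: lerD; last exact: sumr_ge0.
    by rewrite big_mkcond; apply: ler_sum => e _; case: ifP.
  rewrite [leRHS](@big_nat_widen _ _ _ _ _ N.+1) 1?ltnW//.
  rewrite big_mkcond [leRHS]big_mkcond/=; apply: ler_sum => e _.
  by case: (smooth _ _); case: ltnP.
have h3 : `|\sum_(1 <= n < X.+1 | rough y n && ((1 < n)%N && ~~ prime n)) cosn a phi n| <= E3.
  have XN' : (X <= N)%N by [].
  apply: (le_trans (composite_sum a phi (leq_ltn_trans XN' NJ) jJ)).
  rewrite big_mkcond [leRHS]big_mkcond/=; apply: ler_sum => j _.
  case: ifP => jX; last first.
    by case: ifP => //; rewrite mulr_ge0//; apply: sumr_ge0 => r _; exact: block_ge0.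
  rewrite (leq_trans jX)// ler_wpM2l//.
  have XjN : ((X %/ 2 ^ j).+1 <= (N %/ 2 ^ j).+1)%N by rewrite ltnS leq_div2r.
  rewrite [leRHS](@big_cat_nat _ _ _ (X %/ 2 ^ j).+1)//= lerDl.
  by apply: sumr_ge0 => r _; exact: block_ge0.
have tri (b c d : R) : `|b - c - d| <= `|b| + `|c| + `|d|.
  by apply: (le_trans (ler_normB _ _)); rewrite lerD2r ler_normB.
apply: (le_trans (lerD h0 (tri _ _ _))).
by move: (lerD (lerD h2 h3) h1); clearbody E1 E2 E3; lra.
Qed.

End PrimeSum.

(** * Exponential sums over the sets B_I *)

Section SetB.
Variable R : realType.
Variables (K0 : nat) (I : nat -> set R).

Lemma prod_primes_gt0 s : all prime s -> (0 < \prod_(p <- s) p)%N.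
Proof.
move=> sp; rewrite big_seq; apply: prodn_cond_gt0 => p ps.
by apply: prime_gt0; exact: (allP sp).
Qed.

Lemma setB_gt0 n : setB I n -> (0 < n)%N.
Proof. by move=> [s [_ sp -> _]]; exact: prod_primes_gt0. Qed.

Lemma prime_dvd_prod s q : prime q -> all prime s -> (q %| \prod_(p <- s) p)%N -> q \in s.
Proof.
move=> pq; elim: s => [|p s IH] /=.
  by rewrite big_nil dvdn1 => _ /eqP q1; rewrite q1 in pq.
move=> /andP[pp sp]; rewrite big_cons Euclid_dvdM// inE dvdn_prime2//.
by move=> /orP[->//|/(IH sp) ->]; rewrite orbT.
Qed.

Lemma le_max_pdiv n p : prime p -> (0 < n)%N -> (p %| n)%N -> (p <= max_pdiv n)%N.
Proof. by move=> pp n0 pn; apply: max_pdiv_max; rewrite mem_primes pp n0. Qed.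

Lemma setB_mul m p : prime p -> (max_pdiv m <= p)%N ->
  setB I (p * m)%N <-> setB I m /\ I m p%:R.
Proof.
move=> pp mp; split=> [Bpm|[[s [srt sp Em HI]] Ip]].
  have /setB_gt0 : setB I (p * m)%N by [].
  rewrite muln_gt0 => /andP[_ m0].
  case: Bpm => s [srt sp E HI].
  have ps : p \in s by apply: prime_dvd_prod; rewrite -?E ?dvdn_mulr.
  case/lastP: s srt sp E HI ps => // s x srt sp E HI ps.
  have xp : x = p.
    have px : prime x by move: sp; rewrite all_rcons => /andP[].
    apply/eqP; rewrite eqn_leq; apply/andP; split.
      have : (x %| p * m)%N by rewrite E big_rcons/= dvdn_mull.
      rewrite Euclid_dvdM// dvdn_prime2// => /orP[/eqP ->//|xm].
      by apply: leq_trans mp; exact: le_max_pdiv.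
    move: srt; rewrite sorted_pairwise; last exact: leq_trans.
    rewrite pairwise_rcons => /andP[/allP h _].
    by move: ps; rewrite mem_rcons inE => /orP[/eqP ->//|/h].
  subst x; have Em : m = (\prod_(q <- s) q)%N.
    apply/eqP; rewrite -(eqn_pmul2l (prime_gt0 pp)) E.
    by rewrite -cats1 big_cat/= big_seq1 mulnC.
  have Is j : (j < size s)%N -> I (\prod_(q <- take j s) q)%N (nth 0%N s j)%:R.
    move=> js; have := HI j; rewrite size_rcons ltnS (ltnW js) => /(_ isT).
    by rewrite nth_rcons js -cats1 takel_cat// ltnW.
  split; last first.
    by have := HI (size s); rewrite size_rcons ltnSn nth_rcons ltnn eqxx -cats1 take_size_cat// -Em; apply.
  exists s; split => //.
    move: srt; rewrite !sorted_pairwise; [|exact: leq_trans..].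
    by rewrite pairwise_rcons => /andP[].
  by move: sp; rewrite all_rcons => /andP[].
have m0 := prod_primes_gt0 sp; rewrite -Em in m0.
exists (rcons s p); split.
- rewrite sorted_pairwise; last exact: leq_trans.
  rewrite pairwise_rcons -sorted_pairwise ?srt ?andbT; last exact: leq_trans.
  apply/allP => q qs /=; apply: leq_trans mp; apply: le_max_pdiv => //.
    exact: (allP sp).
  by rewrite Em (big_rem q)//= dvdn_mulr.
- by rewrite all_rcons pp.
- by rewrite Em -cats1 big_cat/= big_seq1 mulnC.
- move=> j; rewrite size_rcons ltnS leq_eqVlt => /orP[/eqP ->|js].
    by rewrite nth_rcons ltnn eqxx -cats1 take_size_cat// -Em.
  by rewrite nth_rcons js -cats1 takel_cat; [exact: HI|exact: ltnW].
Qed.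

Hypothesis famI : interval_family K0 I.

Let memB n := `[< setB I n >].
Let memI m (p : nat) := `[< I m p%:R >].

Lemma convex_mem_interval (A : set R) : is_interval A ->
  convex_pred (fun n : nat => `[< A n%:R >]).
Proof.
move=> iA i j k ij jk /asboolP Ai /asboolP Ak; apply/asboolP.
by apply: (iA _ _ Ai Ak); rewrite !ler_nat ij.
Qed.

Lemma interval_family_sum (f : nat -> R) (W : pred nat) m c N : convex_pred W ->
  `|\sum_(0 <= n < N | W n && memI m (c + n)%N) f n| <= 2 ^+ K0 * (2 * pmax f N).
Proof.
move=> cW.
have e0 : 0 <= 2 * pmax f N by rewrite mulr_ge0// pmax_ge0.
have one : 2 * pmax f N <= 2 ^+ K0 * (2 * pmax f N).
  by rewrite ler_peMl// exprn_ege1// ler1n.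
have cvx (A : set R) : is_interval A -> convex_pred (fun n : nat => `[< A (c + n)%N%:R >]).
  by move=> /convex_mem_interval /convex_shift; apply.
case: (famI m) => [I0|iI|[J iJ IJ]].
- rewrite big_pred0 ?normr0 ?(le_trans e0)// => n.
  by apply/negbTE; rewrite negb_and; apply/orP; right; apply/asboolPn; rewrite I0.
- by apply: le_trans one; apply: convex_sum; exact: (convex_predI cW (cvx _ iI)).
- pose Jp (i : 'I_K0) (n : nat) := `[< J i (c + n)%N%:R >].
  rewrite (eq_bigl (fun n => W n && has (Jp ^~ n) (enum 'I_K0))); last first.
    move=> n; congr (_ && _); rewrite /memI IJ; apply/asboolP/hasP => [[i _ Ji]|[i _ /asboolP Ji]].
      by exists i; [rewrite mem_enum|apply/asboolP].
    by exists i.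
  rewrite -[X in 2 ^+ X]card_ord cardE; apply: convex_union_sum => //.
  by move=> i; exact: cvx.
Qed.

Lemma max_pdiv_cond y X p m : (0 < y)%N -> (0 < m)%N -> (0 < p)%N ->
  [&& (p * m <= X)%N, memB (p * m)%N && ~~ smooth y (p * m)%N & max_pdiv (p * m)%N == p]
  = memB m && [&& (y <= p)%N, prime p & [&& (max_pdiv m <= p)%N, (p * m <= X)%N & memI m p]].
Proof.
move=> y0 m0 p0; have pm0 : (0 < p * m)%N by rewrite muln_gt0 p0.
apply/idP/idP => [/and3P[-> /andP[Bpm nsm] /eqP pd]|].
  have pm1 : (1 < p * m)%N.
    rewrite ltn_neqAle pm0 andbT; apply/eqP => pm1; move: nsm; rewrite -pm1 => /negP[].
    by apply/smoothP => // q pq; rewrite dvdn1 => /eqP q1; rewrite q1 in pq.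
  have pp : prime p by rewrite -pd max_pdiv_prime.
  have mp : (max_pdiv m <= p)%N.
    have [m1|m1] := leqP m 1; first by rewrite (leq_trans (max_pdiv_leq m0))// (leq_trans m1).
    by rewrite -[X in (_ <= X)%N]pd le_max_pdiv ?max_pdiv_prime// dvdn_mull// max_pdiv_dvd.
  have yp : (y <= p)%N.
    rewrite leqNgt; apply: contra nsm => py; apply/smoothP => // q pq qpm.
    by apply: leq_ltn_trans py; rewrite -pd le_max_pdiv.
  move/asboolP/(setB_mul pp mp): Bpm => [Bm Im].
  by rewrite /memB asboolT//= yp pp mp /memI asboolT.
move=> /andP[/asboolP Bm /and5P[yp pp mp -> /asboolP Im]]/=.
have pd : max_pdiv (p * m) = p.
  apply/eqP; rewrite eqn_leq le_max_pdiv ?dvdn_mulr// andbT.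
  have pm1 : (1 < p * m)%N by rewrite (leq_trans (prime_gt1 pp))// leq_pmulr.
  have := max_pdiv_dvd (p * m); rewrite Euclid_dvdM ?max_pdiv_prime// => /orP[h|h].
    by rewrite dvdn_leq.
  by apply: leq_trans mp; rewrite le_max_pdiv ?max_pdiv_prime.
rewrite pd eqxx andbT /memB asboolT/=; last by apply/setB_mul.
apply/negP => /(smoothP _ pm0) /(_ p pp (dvdn_mulr _ (dvdnn _))).
by rewrite ltnNge yp.
Qed.

(* n = m p with p the largest prime factor of n *)
Lemma cosn_sum_setB (a phi : R) X j0 J M : (X < 2 ^ J)%N -> (j0 <= J)%N ->
  `|\sum_(1 <= n < X.+1 | memB n) cosn a phi n|
  <= \sum_(1 <= n < X.+1 | smooth (2 ^ j0) n) 1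
   + 2 ^+ K0 * (2 * \sum_(1 <= m < X.+1 | (m < M)%N)
       pmax (fun p => (prime p)%:R * cosn (a * m%:R) phi p) (X %/ m).+1)
   + 2 ^+ K0 * (2 * \sum_(j0 <= j < J | (M * 2 ^ j <= X)%N)
       \sum_(0 <= r < (X %/ 2 ^ j).+1) block a phi j r).
Proof.
move=> XJ jJ; set y := (2 ^ j0)%N.
have y0 : (0 < y)%N by rewrite expn_gt0.
rewrite (bigID (smooth y))/= -addrA.
apply: (le_trans (ler_normD _ _)); apply: lerD.
  apply: (le_trans (ler_norm_sum _ _ _)).
  rewrite big_mkcond [leRHS]big_mkcond/=; apply: ler_sum => n _.
  by case: (memB n); case: (smooth y n); rewrite ?cosn_le1.
rewrite (@sum_by_divisor _ _ _ max_pdiv); last first.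
  by move=> n n0 _; rewrite max_pdiv_gt0 max_pdiv_dvd.
pose W m p := (max_pdiv m <= p)%N && (p * m <= X)%N.
have cW m : convex_pred (W m).
  move=> i j k ij jk /andP[mi _] /andP[_ kX]; rewrite /W (leq_trans mi)//=.
  by apply: leq_trans kX; rewrite leq_mul2r jk orbT.
have cW2 m : convex_pred (fun p => (y <= p)%N && W m p).
  move=> i j k ij jk /andP[yi Wi] /andP[_ Wk].
  by rewrite (leq_trans yi)//= (cW m i j k).
have B1 m : (0 < m)%N -> `|\sum_(1 <= p < X.+1 | [&& (p * m <= X)%N,
     memB (p * m)%N && ~~ smooth y (p * m)%N & max_pdiv (p * m)%N == p]) cosn a phi (p * m)|
   <= `|\sum_(1 <= p < X.+1 | (y <= p)%N && (prime p && (W m p && memI m p))) cosn a phi (m * p)|.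
  move=> m0; rewrite big_nat_cond [in leRHS]big_nat_cond.
  rewrite (eq_big (fun p => (1 <= p < X.+1)%N && (memB m && [&& (y <= p)%N, prime p & W m p && memI m p])) (fun p => cosn a phi (m * p))).
  - case: (memB m) => //=.
    by rewrite big_pred0 ?normr0// => p; rewrite andbF.
  - move=> p; case: (boolP (1 <= p < X.+1)%N) => //= /andP[p0 _].
    by rewrite max_pdiv_cond// /W -!andbA.
  - by move=> p _; rewrite mulnC.
apply: (le_trans (ler_norm_sum _ _ _)).
rewrite (bigID (fun m => (m < M)%N))/=; apply: lerD.
  rewrite !mulr_sumr big_nat_cond [leRHS]big_nat_cond.
  apply: ler_sum => m /andP[/andP[m0 mX] mM]; apply: (le_trans (B1 m m0)).
  have -> : \sum_(1 <= p < X.+1 | (y <= p)%N && (prime p && (W m p && memI m p))) cosn a phi (m * p)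
    = \sum_(0 <= p < (X %/ m).+1 | ((y <= p)%N && W m p) && memI m (0 + p)%N)
        (prime p)%:R * cosn (a * m%:R) phi p.
    have Xm : ((X %/ m).+1 <= X.+1)%N by rewrite ltnS leq_div.
    rewrite [RHS](@big_nat_widen _ _ _ _ _ X.+1)// [RHS]big_mkcond [RHS]big_ltn//= leqNgt y0 add0r.
    rewrite big_mkcond/=; apply: eq_big_nat => p /andP[p0 pX].
    rewrite ltnS leq_divRL// /W add0n; case: (y <= p)%N => //=; case: (max_pdiv m <= p)%N => //=; last by rewrite !andbF.
    case: (p * m <= X)%N => //=; last by rewrite ?andbF.
    rewrite andbT; case: (memI m p); rewrite ?andbF// andbT.
    by rewrite cosnZ; case: (prime p); rewrite ?mul1r ?mul0r.
  by apply: interval_family_sum.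
have b0 j m : 0 <= block a phi j m by exact: block_ge0.
apply: (@le_trans _ _ (\sum_(1 <= m < X.+1) \sum_(j0 <= j < J)
    if (M * 2 ^ j <= X)%N && (m < (X %/ 2 ^ j).+1)%N then 2 ^+ K0 * (2 * block a phi j m) else 0)).
  rewrite big_mkcond big_nat_cond [leRHS]big_nat_cond.
  apply: ler_sum => m /andP[/andP[m0 mX] _]; rewrite -leqNgt; case: ifP => [Mm|_]; last first.
    by apply: sumr_ge0 => j _; case: ifP => // _; rewrite !mulr_ge0// exprn_ge0.
  apply: (le_trans (B1 m m0)).
  rewrite (@sum_dyadic_blocks _ _ (fun p => W m p && memI m p) X j0 J)//; last first.
    by move=> p /andP[/andP[_ h] _]; apply: leq_trans h; rewrite leq_pmulr.
  apply: (le_trans (ler_norm_sum _ _ _)); apply: ler_sum_nat => j _.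
  case: ifP => [_|jm].
    by rewrite block_shift; apply: (@interval_family_sum _ (fun n => W m (2 ^ j + n)%N)); exact: convex_shift.
  rewrite big_nat_cond big_pred0 ?normr0// => p; apply: contraFF jm.
  move=> /andP[/andP[jp _] /andP[_ /andP[/andP[_ pmX] _]]].
  have h : (2 ^ j * m <= X)%N by apply: leq_trans pmX; rewrite leq_mul2r jp orbT.
  rewrite ltnS leq_divRL ?expn_gt0// [(m * _)%N]mulnC h andbT.
  by apply: leq_trans h; rewrite mulnC leq_mul2l Mm orbT.
rewrite exchange_big/= !mulr_sumr [leRHS]big_mkcond/=; apply: ler_sum => j _.
case: ifP => /= _; last by rewrite big1.
rewrite !mulr_sumr -big_mkcond/=.
rewrite [leRHS](@big_nat_widen _ _ _ _ _ X.+1) ?ltnS ?leq_div//.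
by rewrite [leRHS]big_mkcond [leRHS]big_ltn//= -big_mkcond/= lerDr !mulr_ge0// exprn_ge0.
Qed.

End SetB.

(** * Discrepancy by Fejer's kernel *)

Section Fejer.
Variable R : realType.
Implicit Types (s t w beta xi alpha : R).

(* H times the Fejer kernel of order H *)
Definition fejer (H : nat) s : R :=
  (\sum_(0 <= k < H) cosn (pi * s) 0 k) ^+ 2
  + (\sum_(0 <= k < H) cosn (pi * s) (- (pi / 2)) k) ^+ 2.

Lemma fejer_ge0 H s : 0 <= fejer H s.
Proof. by rewrite addr_ge0// sqr_ge0. Qed.

Lemma fejer_le H s w : 0 < w -> w <= `|sin (pi * s)| -> fejer H s <= 2 / w ^+ 2.
Proof.
move=> w0 ws; set a := pi * s.
have sq phi : (\sum_(0 <= k < H) cosn a phi k) ^+ 2 <= 1 / w ^+ 2.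
  have := sum_cosn a phi 0 H; rewrite -/a in ws *; set x := \sum_(_ <= _ < _) _ => h.
  have xw : `|x| * w <= 1 by apply: le_trans h; rewrite ler_wpM2l.
  rewrite ler_pdivlMr ?exprn_gt0// -real_normK ?num_real// -exprMn -[leRHS](expr1n _ 2).
  by rewrite lerXn2r ?nnegrE ?mulr_ge0// ltW.
by rewrite /fejer; have := sq 0; have := sq (- (pi / 2)); rewrite -/a; lra.
Qed.

Lemma fejerE H s :
  fejer H s = H%:R + 2 * \sum_(0 <= k < H) \sum_(1 <= d < k.+1) cosn (pi * s) 0 d.
Proof.
elim: H => [|H IH]; first by rewrite /fejer !big_geq// expr0n mulr0 addr0.
move: IH; rewrite /fejer !(@big_nat_recr _ _ _ H 0)//=; set a := pi * s.
set C := \sum_(0 <= k < H) cosn a 0 k; set S := \sum_(0 <= k < H) cosn a (- (pi / 2)) k.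
set D := \sum_(0 <= k < H) _ => IH.
have -> : \sum_(1 <= d < H.+1) cosn a 0 d = C * cosn a 0 H + S * cosn a (- (pi / 2)) H.
  rewrite big_nat_rev/= sum_nat_shift subSS subn0 !mulr_suml -big_split/=.
  apply: eq_big_nat => k /andP[_ kH]; rewrite /cosn !cosBpihalf !addr0.
  have -> : (1 + H.+1 - (1 + k).+1 = H - k)%N by lia.
  rewrite natrB ?(ltnW kH)// mulrBr mulrnBl cosB; ring.
have : cosn a 0 H ^+ 2 + cosn a (- (pi / 2)) H ^+ 2 = 1.
  by rewrite /cosn cosBpihalf addr0 cos2Dsin2.
by rewrite -(natr1 H); set c := cosn a 0 H; set s' := cosn a _ H; nra.
Qed.

Definition fejer_mean (H J : nat) t : R :=
  H%:R ^- 2 * \sum_(0 <= j < J) fejer H (t - j%:R / H%:R).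

Lemma sum_cosn_shift (H J d : nat) t : (0 < d < H)%N ->
  let a : R := pi * (d%:R / H%:R) in
  \sum_(0 <= j < J) cosn (pi * (t - j%:R / H%:R)) 0 d
  = sin (a * J%:R) / sin a * cos (pi * t * d%:R *+ 2 + (a - a * J%:R)).
Proof.
move=> /andP[d0 dH] a.
have H0 : 0 < H%:R :> R by rewrite ltr0n (leq_trans _ dH).
have u01 : 0 < (d%:R / H%:R : R) < 1 by rewrite divr_gt0 ?H0 ?ltr0n//= ltr_pdivrMr// mul1r ltr_nat.
have sa : 0 < sin a.
  apply: sin_gt0_pi; have := @pi_gt0 R; rewrite /a; nra.
have sa0 : sin a *+ 2 != 0 by rewrite gt_eqF// mulrn_wgt0.
rewrite (eq_bigr (fun j => cosn a (- (pi * t * d%:R *+ 2)) j)); last first.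
  by move=> j _; rewrite /cosn -cosN; congr cos; rewrite /a; field; rewrite gt_eqF.
apply: (mulIf sa0); rewrite sum_cosn_telescope// mulr0 mul0rn add0r.
set x := a * J%:R; set b := pi * t * d%:R *+ 2.
rewrite (_ : x *+ 2 - b - a = x - (b + (a - x))); last by ring.
rewrite (_ : - b - a = - x - (b + (a - x))); last by ring.
rewrite (sinB x) (sinB (- x)) sinN cosN; field; lra.
Qed.

Lemma fejer_meanE H J t : (0 < H)%N ->
  fejer_mean H J t = J%:R / H%:R + H%:R ^- 2 * (2 * \sum_(0 <= k < H) \sum_(1 <= d < k.+1)
     \sum_(0 <= j < J) cosn (pi * (t - j%:R / H%:R)) 0 d).
Proof.
move=> H0; have h0 : H%:R != 0 :> R by rewrite pnatr_eq0 -lt0n.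
rewrite /fejer_mean; under eq_bigr do rewrite fejerE.
rewrite big_split/= sumr_const_nat subn0 -mulr_sumr mulrDr; congr (_ + _).
  by rewrite -mulr_natr; field.
congr (_ * (_ * _)); rewrite exchange_big/=; apply: eq_bigr => k _.
by rewrite exchange_big.
Qed.

Lemma fejer_mean_full H t : (0 < H)%N -> fejer_mean H H t = 1.
Proof.
move=> H0; have h0 : H%:R != 0 :> R by rewrite pnatr_eq0 -lt0n.
rewrite fejer_meanE// divff// [X in _ * (_ * X)]big1_seq ?mulr0 ?addr0//.
move=> k /andP[_]; rewrite mem_index_iota => /andP[_ kH].
rewrite big1_seq// => d /andP[_]; rewrite mem_index_iota => /andP[d0 dk].
rewrite sum_cosn_shift ?d0 ?(leq_trans dk)//.
rewrite mulrAC mulrA divfK// -[pi * d%:R]add0r.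
have := @sinDpin R 0 d; rewrite sin0 normr0 => /eqP; rewrite normr_eq0 => /eqP ->.
by rewrite !mul0r.
Qed.

Lemma fejer_mean_compl H J t : (0 < H)%N -> (J <= H)%N ->
  1 - fejer_mean H J t = H%:R ^- 2 * \sum_(J <= j < H) fejer H (t - j%:R / H%:R).
Proof.
move=> H0 JH; rewrite -[X in X - _](fejer_mean_full t H0) /fejer_mean -mulrBr; congr (_ * _).
by rewrite [X in X - _](@big_cat_nat _ _ _ J)//= [X in X - _]addrC addrK.
Qed.

Lemma fejer_mean_le H (m n : nat) t w : (0 < H)%N -> 0 < w -> (n <= H)%N ->
  (forall j, (m <= j < n)%N -> w <= `|sin (pi * (t - j%:R / H%:R))|) ->
  H%:R ^- 2 * \sum_(m <= j < n) fejer H (t - j%:R / H%:R) <= 2 / (H%:R * w ^+ 2).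
Proof.
move=> H0 w0 nH ws; have h0 : 0 < H%:R :> R by rewrite ltr0n.
have w2 : 0 <= 2 / w ^+ 2 by rewrite divr_ge0// sqr_ge0.
apply: (@le_trans _ _ (H%:R ^- 2 * (H%:R * (2 / w ^+ 2)))).
  rewrite ler_wpM2l ?invr_ge0 ?sqr_ge0//.
  apply: (@le_trans _ _ ((n - m)%:R * (2 / w ^+ 2))).
    by apply: sum_nat_const_le => j /ws; exact: fejer_le.
  by rewrite ler_wpM2r// ler_nat (leq_trans (leq_subr _ _)).
by rewrite le_eqVlt; apply/orP; left; apply/eqP; field; rewrite !gt_eqF.
Qed.

Lemma fejer_mean_sum alpha (P : pred nat) X H J (E : R) : (0 < H)%N -> 0 <= E ->
  (forall h phi, (0 < h < H)%N ->
     `|\sum_(1 <= n < X.+1 | P n) cosn (pi * alpha * h%:R) phi n| <= E) ->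
  `|\sum_(1 <= n < X.+1 | P n) (fejer_mean H J (alpha * n%:R) - J%:R / H%:R)|
  <= 4 * E * \sum_(1 <= d < H) d%:R^-1.
Proof.
move=> H0 E0 HE; have h0 : 0 < H%:R :> R by rewrite ltr0n.
under eq_bigr do rewrite fejer_meanE// [_ + _ * _]addrC addrK.
rewrite -!mulr_sumr normrM [X in X * _]ger0_norm ?invr_ge0 ?sqr_ge0//.
rewrite normrM [X in _ * (X * _)]ger0_norm//.
set S := \sum_(1 <= d < H) d%:R^-1.
pose G d : R := H%:R * (d%:R^-1 + (H - d)%:R^-1).
have G0 d : 0 <= G d by rewrite /G mulr_ge0 ?addr_ge0 ?invr_ge0.
suff HS : `|\sum_(1 <= n < X.+1 | P n) \sum_(0 <= k < H) \sum_(1 <= d < k.+1)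
      \sum_(0 <= j < J) cosn (pi * (alpha * n%:R - j%:R / H%:R)) 0 d|
   <= H%:R * (E * (H%:R * (2 * S))).
  apply: (@le_trans _ _ (H%:R ^- 2 * (2 * (H%:R * (E * (H%:R * (2 * S))))))).
    by rewrite ler_wpM2l ?invr_ge0 ?sqr_ge0// ler_wpM2l.
  by rewrite le_eqVlt; apply/orP; left; apply/eqP; field; rewrite gt_eqF.
rewrite exchange_big/=; apply: (le_trans (ler_norm_sum _ _ _)).
rewrite -[X in _ <= X%:R * _]subn0; apply: sum_nat_const_le => k /andP[_ kH].
rewrite exchange_big/=; apply: (le_trans (ler_norm_sum _ _ _)).
have SG : \sum_(1 <= d < H) G d = H%:R * (2 * S).
  rewrite -mulr_sumr big_split/=; congr (_ * _); rewrite mulr_natl mulr2n; congr (_ + _).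
  by rewrite big_nat_rev/=; apply: eq_big_nat => d /andP[d0 dH]; congr (_%:R^-1); lia.
rewrite -SG mulr_sumr.
apply: (@le_trans _ _ (\sum_(1 <= d < k.+1) E * G d)); last first.
  rewrite [leRHS](@big_cat_nat _ _ _ k.+1)//= lerDl.
  by apply: sumr_ge0 => d _; rewrite mulr_ge0.
apply: ler_sum_nat => d /andP[d0 dk].
have dH : (d < H)%N by rewrite (leq_trans dk).
have dd : (0 < d < H)%N by rewrite d0.
under eq_bigr do rewrite sum_cosn_shift//.
rewrite -mulr_sumr normrM.
set a := pi * (d%:R / H%:R); set phi := a - a * J%:R.
have -> : \sum_(1 <= n < X.+1 | P n) cos (pi * (alpha * n%:R) * d%:R *+ 2 + phi)
  = \sum_(1 <= n < X.+1 | P n) cosn (pi * alpha * d%:R) phi n.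
  by apply: eq_bigr => n _; rewrite /cosn; congr cos; ring.
rewrite mulrC; apply: ler_pM => //; first exact: HE.
have d0' : 0 < d%:R :> R by rewrite ltr0n.
have Hd0 : 0 < (H - d)%:R :> R by rewrite ltr0n subn_gt0.
have EHd : (H - d)%:R = H%:R - d%:R :> R by rewrite natrB// ltnW.
have dH' : d%:R < H%:R :> R by rewrite ltr_nat.
have sa : Num.min (d%:R / H%:R) (1 - d%:R / H%:R) <= sin a.
  by apply: sin_pi_ge; rewrite divr_ge0//= ler_pdivrMr// mul1r ltW.
have m0 : 0 < Num.min (d%:R / H%:R) (1 - d%:R / H%:R) :> R.
  by rewrite lt_min divr_gt0//= subr_gt0 ltr_pdivrMr// mul1r.
rewrite normrM normfV [X in _ / X]gtr0_norm ?(lt_le_trans m0)//.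
apply: (@le_trans _ _ (sin a)^-1).
  by rewrite ler_piMl ?sin_max// invr_ge0 ltW// (lt_le_trans m0).
apply: (@le_trans _ _ (Num.min (d%:R / H%:R) (1 - d%:R / H%:R) : R)^-1).
  by rewrite lef_pV2 ?posrE// (lt_le_trans m0).
rewrite /G; have [_|_] := leP (d%:R / H%:R : R) (1 - d%:R / H%:R).
  by rewrite invf_div ler_wpM2l ?(ltW h0)// lerDl invr_ge0.
have -> : 1 - d%:R / H%:R = (H - d)%:R / H%:R :> R by rewrite EHd; field; rewrite gt_eqF.
by rewrite invf_div ler_wpM2l ?(ltW h0)// lerDr invr_ge0 ltW.
Qed.

Definition near_mod1 alpha xi w (n : nat) : bool :=
  `[< exists k : int, `|alpha * n%:R - xi - k%:~R| < w >].

Lemma count_near_mod1 alpha xi w (Y X : nat) : (0 < Y)%N ->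
  (forall (d : nat) (k : int), (0 < d < Y)%N -> 2 * w <= `|alpha * d%:R - k%:~R|) ->
  \sum_(1 <= n < X.+1 | near_mod1 alpha xi w n) 1 <= X.+1%:R / Y%:R + 1 :> R.
Proof.
move=> Y0 sep; apply: (@le_trans _ _ (\sum_(0 <= n < X.+1) (near_mod1 alpha xi w n)%:R)).
  rewrite [leRHS]big_ltn//= -[leLHS]add0r lerD// big_mkcond/=.
  by apply: ler_sum => n _; case: near_mod1.
rewrite -[leRHS]mulr1; apply: sum_blocks => // m j.
elim: j m => [|j IH] m jY; first by rewrite addn0 big_geq.
rewrite big_ltn ?addnS ?ltnS ?leq_addr//.
case: (boolP (near_mod1 alpha xi w m)) => nm; last first.
  by rewrite add0r -addSn; apply: IH; exact: ltnW.
rewrite big1_seq ?addr0// => n /andP[_]; rewrite mem_index_iota => /andP[mn nj].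
have -> // : near_mod1 alpha xi w n = false.
apply/negbTE/asboolPn => -[k hk]; move/asboolP: nm => [l hl].
have := sep (n - m)%N (k - l); rewrite subn_gt0 mn ltn_subLR ?(ltnW mn)//=.
rewrite (leq_trans nj) ?leq_add2l//; last by rewrite -addnS leq_add2l.
move=> /(_ isT); apply/negP; rewrite -ltNge natrB ?(ltnW mn)// intrB.
have := ler_normB (alpha * n%:R - xi - k%:~R) (alpha * m%:R - xi - l%:~R).
rewrite (_ : _ - _ - (_ - _ - _) = alpha * (n%:R - m%:R) - (k%:~R - l%:~R)); last by ring.
lra.
Qed.

Lemma frac_part_ge0 t : 0 <= frac_part t.
Proof. by rewrite subr_ge0 floor_le_tmp. Qed.

Lemma frac_part_lt1 t : frac_part t < 1.
Proof. by rewrite ltrBlDl -[X in _ + X]/1%:~R -intrD floorD1_gt. Qed.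

Lemma dist_int_frac v (x : R) w (k : int) : w <= v -> v <= 1 - w ->
  x = v + k%:~R -> w <= `|sin (pi * x)|.
Proof.
move=> wv v1 ->; rewrite mulrDr sinDpiz.
have [w0|w0] := leP w 0; first exact: le_trans w0 _.
apply: le_trans (ler_norm _); apply: le_trans (sin_pi_ge _); last by lra.
by rewrite le_min wv; lra.
Qed.

Lemma fejer_mean_indicator alpha beta w (H J n : nat) : (0 < H)%N -> 0 < w ->
  2 / H%:R <= w -> (J <= H)%N -> J%:R <= beta * H%:R < J.+1%:R ->
  `|(frac_part (alpha * n%:R) <= beta)%R%:R - fejer_mean H J (alpha * n%:R)|
  <= (near_mod1 alpha 0 w n)%:R + (near_mod1 alpha beta w n)%:R + 8 / (H%:R * w ^+ 2).
Proof.
move=> H0 w0 Hw JH /andP[Jb bJ].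
have h0 : 0 < H%:R :> R by rewrite ltr0n.
set x := alpha * n%:R; set u := frac_part x; set P := fejer_mean H J x.
have P0 : 0 <= P by rewrite mulr_ge0 ?invr_ge0 ?sqr_ge0// sumr_ge0// => j _; exact: fejer_ge0.
have P1 : 0 <= 1 - P.
  rewrite /P fejer_mean_compl// mulr_ge0 ?invr_ge0 ?sqr_ge0// sumr_ge0// => j _; exact: fejer_ge0.
have e0 : 0 <= 8 / (H%:R * w ^+ 2) by rewrite divr_ge0// mulr_ge0 ?sqr_ge0// ltW.
have b1 : `|(u <= beta)%R%:R - P| <= 1 by rewrite ler_norml; case: (u <= beta) => /=; lra.
case: (boolP (near_mod1 alpha 0 w n)) => n1 /=.
  by apply: (le_trans b1); case: near_mod1; rewrite /=; lra.
case: (boolP (near_mod1 alpha beta w n)) => n2 /=; first by apply: (le_trans b1); lra.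
have xu : x = u + (Num.floor x)%:~R by rewrite subrK.
have u0 := frac_part_ge0 x; have u1 := frac_part_lt1 x; rewrite -/u in u0 u1.
have wu : w <= u.
  rewrite leNgt; apply/negP => uw; move/asboolPn: n1; apply; exists (Num.floor x).
  by rewrite -/x subr0 -/(frac_part x) -/u ger0_norm.
have uw : u <= 1 - w.
  rewrite leNgt; apply/negP => wu'; move/asboolPn: n1; apply; exists (Num.floor x + 1).
  by rewrite -/x subr0 intrD opprD addrA -/(frac_part x) -/u distrC ger0_norm; lra.
have ub : w <= `|u - beta|.
  rewrite leNgt; apply/negP => uw'; move/asboolPn: n2; apply; exists (Num.floor x).
  by rewrite -/x addrAC -/(frac_part x) -/u.
have [ub1|ub1] := leP u beta; last first.
  rewrite sub0r normrN ger0_norm// add0r add0r.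
  apply: (@le_trans _ _ (2 / (H%:R * w ^+ 2))); last first.
    by move: e0; set i := (_ * _)^-1 => e0; lra.
  apply: fejer_mean_le => // j /andP[_ jJ].
  have jb : j%:R / H%:R <= beta.
    by rewrite ler_pdivrMr//; apply: le_trans Jb; rewrite ler_nat ltnW.
  have j0 : 0 <= j%:R / H%:R :> R by rewrite divr_ge0.
  apply: (@dist_int_frac (u - j%:R / H%:R) _ _ (Num.floor x)); last by rewrite {1}xu; ring.
    by rewrite gtr0_norm ?subr_gt0// in ub; lra.
  lra.
rewrite mulr1n ger0_norm// add0r add0r /P fejer_mean_compl//.
have w2 : 0 < w / 2 by lra.
rewrite (_ : 8 / (H%:R * w ^+ 2) = 2 / (H%:R * (w / 2) ^+ 2)); last by field; rewrite !gt_eqF.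
apply: fejer_mean_le => // j /andP[jJ jH].
have jb : beta - 1 / H%:R <= j%:R / H%:R.
  rewrite lerBlDr -mulrDl ler_pdivlMr//; apply: (le_trans (ltW bJ)).
  by rewrite natr1 ler_nat.
have j1 : j%:R / H%:R <= 1 :> R by rewrite ler_pdivrMr// mul1r ler_nat ltnW.
rewrite -normrN -sinN -mulrN.
apply: (@dist_int_frac (j%:R / H%:R - u) _ _ (- Num.floor x)); last by rewrite intrN {1}xu; ring.
  rewrite ler0_norm ?subr_le0// in ub; lra.
lra.
Qed.

Lemma fejer_discrepancy alpha beta w (E : R) (P : pred nat) (X H Y : nat) :
  (0 < H)%N -> (0 < Y)%N -> 0 < w -> 2 / H%:R <= w -> 0 <= beta <= 1 -> 0 <= E ->
  (forall (d : nat) (k : int), (0 < d < Y)%N -> 2 * w <= `|alpha * d%:R - k%:~R|) ->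
  (forall h phi, (0 < h < H)%N ->
     `|\sum_(1 <= n < X.+1 | P n) cosn (pi * alpha * h%:R) phi n| <= E) ->
  `|\sum_(1 <= n < X.+1 | P n && (frac_part (alpha * n%:R) <= beta)) 1
     - beta * \sum_(1 <= n < X.+1 | P n) 1|
  <= 4 * E * \sum_(1 <= d < H) d%:R^-1 + 2 * (X.+1%:R / Y%:R + 1)
     + X%:R * (8 / (H%:R * w ^+ 2) + 1 / H%:R).
Proof.
move=> H0 Y0 w0 Hw /andP[b0 b1] E0 sep HE.
have h0 : 0 < H%:R :> R by rewrite ltr0n.
pose J := Num.truncn (beta * H%:R).
have /andP[Jb bJ] : J%:R <= beta * H%:R < J.+1%:R.
  by apply: truncn_itv; rewrite mulr_ge0// ltW.
have JH : (J <= H)%N.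
  by rewrite -(ler_nat R); apply: (le_trans Jb); rewrite ler_piMl// ltW.
set c := 8 / (H%:R * w ^+ 2).
have c0 : 0 <= c by rewrite divr_ge0// mulr_ge0 ?sqr_ge0// ltW.
have JH' : `|J%:R / H%:R - beta| <= 1 / H%:R.
  rewrite distrC ger0_norm; last by rewrite subr_ge0 ler_pdivrMr.
  by rewrite lerBlDr -mulrDl ler_pdivlMr// addrC natr1 ltW.
have -> : \sum_(1 <= n < X.+1 | P n && (frac_part (alpha * n%:R) <= beta)) 1
     - beta * \sum_(1 <= n < X.+1 | P n) 1
  = \sum_(1 <= n < X.+1 | P n) (fejer_mean H J (alpha * n%:R) - J%:R / H%:R)
   + \sum_(1 <= n < X.+1 | P n)
      (((frac_part (alpha * n%:R) <= beta)%R%:R - fejer_mean H J (alpha * n%:R)) + (J%:R / H%:R - beta)).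
  rewrite -big_split mulr_sumr big_mkcondr -sumrB; apply: eq_bigr => n _ /=.
  by case: (frac_part _ <= beta); rewrite /=; ring.
apply: (le_trans (ler_normD _ _)); rewrite -addrA; apply: lerD.
  exact: fejer_mean_sum.
apply: (le_trans (ler_norm_sum _ _ _)).
apply: (@le_trans _ _ (\sum_(1 <= n < X.+1)
   ((near_mod1 alpha 0 w n)%:R + (near_mod1 alpha beta w n)%:R + (c + 1 / H%:R)))).
  rewrite big_mkcond; apply: ler_sum => n _; case: ifP => _; last first.
    by rewrite !addr_ge0// divr_ge0// ltW.
  apply: (le_trans (ler_normD _ _)); rewrite addrA; apply: lerD => //.
  by apply: fejer_mean_indicator; rewrite ?Jb.
rewrite big_split/= [X in X + _]big_split/=; apply: lerD; last first.
  by rewrite sumr_const_nat subSS subn0 mulr_natl.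
rewrite mulr_natl mulr2n; apply: lerD.
  by apply: le_trans (count_near_mod1 0 X Y0 sep); rewrite [leRHS]big_mkcond/= ler_sum// => n _; case: near_mod1.
by apply: le_trans (count_near_mod1 beta X Y0 sep); rewrite [leRHS]big_mkcond/= ler_sum// => n _; case: near_mod1.
Qed.

End Fejer.

(** * Continued fractions *)

Definition diophantine_exponent (R : realType) (alpha : R) (A T0 : nat) :=
  forall (T d : nat) (k : int), (T0 <= T)%N -> (0 < d <= T)%N ->
    T%:R ^- A <= `|alpha * d%:R - k%:~R|.

Section ContinuedFraction.
Variable (R : realType) (alpha : R).
Hypothesis irr : irrational alpha.

Let c := partial_quotient alpha.
Let q := convergent_den alpha.

Fixpoint convergent_num (j : nat) : int :=
  match j with
  | 0 => c 0%N
  | i.+1 => match i with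
            | 0 => c 1%N * c 0%N + 1
            | k.+1 => c j * convergent_num i + convergent_num k
            end
  end.
Let p := convergent_num.

Let delta j : R := (q j)%:~R * alpha - (p j)%:~R.
Let f j : R := frac_part (complete_quotient alpha j).

Lemma convergent_denSS j : q j.+2 = c j.+2 * q j.+1 + q j. Proof. by []. Qed.
Lemma convergent_numSS j : p j.+2 = c j.+2 * p j.+1 + p j. Proof. by []. Qed.

Lemma deltaSS j : delta j.+2 = (c j.+2)%:~R * delta j.+1 + delta j.
Proof. by rewrite /delta convergent_denSS convergent_numSS !intrD !intrM; ring. Qed.

Lemma complete_quotientE j : complete_quotient alpha j = (c j)%:~R + f j.
Proof. by rewrite /f /frac_part addrC subrK. Qed.

Lemma delta_neq0 j : 0 < q j -> delta j != 0.
Proof.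
move=> q0; apply/negP => /eqP d0; apply: irr; apply/rationalP.
case E : (q j) q0 => [n|n] // n0; exists (p j), n.
move/eqP: d0; rewrite /delta E subr_eq0 => /eqP <-.
by rewrite mulrAC -[n%:~R]/(n%:R) divff ?mul1r// pnatr_eq0 -lt0n.
Qed.

Lemma f_ge0 j : 0 <= f j. Proof. exact: frac_part_ge0. Qed.
Lemma f_lt1 j : f j < 1. Proof. exact: frac_part_lt1. Qed.

Lemma pq_ge1 j : f j != 0 -> 1 <= c j.+1.
Proof.
move=> fj; have f0 : 0 < f j by rewrite lt_def fj f_ge0.
by rewrite /c /partial_quotient floor_ge_int_tmp -/(f j) invf_ge1// ltW// f_lt1.
Qed.

Lemma cf_invariant j :
  [/\ 1 <= q j, 1 <= q j.+1, f j != 0 & delta j.+1 = - (delta j * f j.+1)].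
Proof.
have f00 : delta 0 = f 0%N.
  by rewrite /delta /f /frac_part/= mul1r.
elim: j => [|j [q1 q2 fj dj]].
  have f0 : f 0%N != 0 by rewrite -f00 delta_neq0.
  split => //; first exact: (pq_ge1 f0).
  have := complete_quotientE 1; rewrite /= -/(f 0%N) => E.
  rewrite /delta -[q 1%N]/(c 1%N) -[p 1%N]/(c 1%N * c 0%N + 1) intrD intrM.
  have d0 : alpha = f 0%N + (c 0%N)%:~R by rewrite -f00 /delta mul1r -[p 0%N]/(c 0%N) subrK.
  have -> : (c 1%N)%:~R = (f 0%N)^-1 - f 1%N by rewrite E addrK.
  rewrite -[p 0%N]/(c 0%N) -[q 0%N]/(1 : int).
  move: d0 f0; move: (f 0%N) (f 1%N) (c 0%N)%:~R => x y z -> x0; field; exact: x0.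
have fj1 : f j.+1 != 0.
  have := @delta_neq0 j.+1 (lt_le_trans ltr01 q2).
  by rewrite dj oppr_eq0 mulf_eq0 negb_or => /andP[].
split => //.
  by rewrite convergent_denSS; have := pq_ge1 fj1; nia.
have := complete_quotientE j.+2; rewrite [complete_quotient _ _]/= -/(f j.+1) => E.
have -> : delta j.+2 = (c j.+2)%:~R * delta j.+1 + delta j by exact: deltaSS.
have -> : (c j.+2)%:~R = (f j.+1)^-1 - f j.+2 by rewrite E addrK.
by rewrite dj; field.
Qed.

Lemma convergent_den_gt0 j : 1 <= q j.
Proof. by have [] := cf_invariant j. Qed.

Lemma convergent_den_leS j : q j <= q j.+1.
Proof.
case: j => [|j]; first exact: convergent_den_gt0.
have [q1 _ fj _] := cf_invariant j.+1; have [q0 _ _ _] := cf_invariant j.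
by rewrite convergent_denSS; have := pq_ge1 fj; nia.
Qed.

Lemma convergent_den_homo i j : (i <= j)%N -> q i <= q j.
Proof.
move=> ij; rewrite -(subnK ij); elim: (j - i)%N => // k IH.
by rewrite addSn; apply: (le_trans IH); exact: convergent_den_leS.
Qed.

Lemma convergent_den_ge j : j%:Z <= q j.
Proof.
case: j => [|j]; first by rewrite (le_trans _ (convergent_den_gt0 0)).
elim: j => [|j IH]; first exact: convergent_den_gt0.
have [q1 _ fj _] := cf_invariant j.+1; have := convergent_den_gt0 j.
by rewrite convergent_denSS; have := pq_ge1 fj; nia.
Qed.

Lemma convergent_det j : q j * p j.+1 - q j.+1 * p j = (-1) ^+ j.
Proof.
elim: j => [|j IH].
  by rewrite -[q 0%N]/1 -[q 1%N]/(c 1%N) -[p 1%N]/(c 1%N * c 0%N + 1) -[p 0%N]/(c 0%N) expr0; ring.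
by rewrite convergent_denSS convergent_numSS exprS -IH; ring.
Qed.

Lemma delta_le j : `|delta j| * (q j.+1)%:~R <= 1.
Proof.
have [q0 q1 _ dj] := cf_invariant j.
have E : (q j.+1)%:~R * delta j - (q j)%:~R * delta j.+1 = (-1) ^+ j :> R.
  have := congr1 (fun z : int => z%:~R : R) (convergent_det j).
  by rewrite /= intrB !intrM rmorphXn/= intrN /delta => <-; ring.
have h1 : 0 <= (q j)%:~R :> R by rewrite ler0z; lia.
have h2 : 0 <= (q j.+1)%:~R :> R by rewrite ler0z; lia.
have : `|delta j| * ((q j.+1)%:~R + (q j)%:~R * f j.+1) = 1.
  rewrite -[X in _ * X]ger0_norm; last by rewrite addr_ge0// mulr_ge0// f_ge0.
  rewrite -normrM (_ : _ * _ = (-1) ^+ j); last by rewrite -E dj; ring.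
  by rewrite normrX normrN1 expr1n.
have : 0 <= `|delta j| * ((q j)%:~R * f j.+1) by rewrite !mulr_ge0// f_ge0.
by rewrite mulrDr; lra.
Qed.

Lemma dist_lower_bound (j d : nat) (k : int) : (0 < d)%N -> d%:Z *+ 2 <= q j ->
  1 / ((q j)%:~R *+ 2) <= `|alpha * d%:R - k%:~R|.
Proof.
move=> d0 dq; have qj := convergent_den_gt0 j; have qj1 := convergent_den_gt0 j.+1.
have q0 : 0 < (q j)%:~R :> R by rewrite ltr0z; lia.
set N := d%:Z * p j - k * q j.
have [N0|N0] := eqVneq N 0.
  have h : d%:Z * (-1) ^+ j = q j * (d%:Z * p j.+1 - q j.+1 * k).
    rewrite -convergent_det; have E : d%:Z * p j = k * q j by apply/eqP; rewrite -subr_eq0 -/N N0.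
    transitivity (q j * (d%:Z * p j.+1) - q j.+1 * (d%:Z * p j)); first by ring.
    by rewrite E; ring.
  have := congr1 absz h; rewrite !abszM abszX abszN1 exp1n muln1.
  set z := absz (d%:Z * _ - _)%R => hz.
  have : (0 < z)%N by case: z hz => //; rewrite muln0/=; lia.
  move=> z0; have : (absz (q j) <= d)%N by rewrite -[d]/(absz d) hz leq_pmulr.
  lia.
have N1 : 1 <= `|N%:~R : R|.
  by rewrite -intr_norm -[1]/(1%:~R) ler_int; lia.
have NE : N%:~R = (q j)%:~R * (alpha * d%:R - k%:~R) - d%:R * delta j :> R.
  by rewrite /N intrB !intrM /delta; ring.
have dd : d%:R * `|delta j| <= 1 / 2 :> R.
  have : `|delta j| * (q j)%:~R <= 1.
    apply: le_trans (delta_le j); rewrite ler_wpM2l// ler_int; exact: convergent_den_leS.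
  have : (d%:R *+ 2 : R) <= (q j)%:~R.
    by rewrite -mulr_natr -natrM -[_%:R]/((Posz (d * 2))%:~R) ler_int; lia.
  have := normr_ge0 (delta j); nra.
have : 1 <= (q j)%:~R * `|alpha * d%:R - k%:~R| + d%:R * `|delta j|.
  apply: (le_trans N1); rewrite NE; apply: (le_trans (ler_normB _ _)).
  by rewrite !normrM (gtr0_norm q0) normr_nat.
rewrite ler_pdivrMr; last by rewrite mulrn_wgt0.
rewrite -mulr_natl; lra.
Qed.

Lemma measure_den_bound : (irrationality_measure alpha < +oo)%E ->
  exists A N : nat, forall j, (N <= j)%N -> (q j.+1)%:~R <= (q j)%:~R ^+ A :> R.
Proof.
rewrite /irrationality_measure; set u := (fun j : nat => _) => Hlt.
have : (limn_esup u < +oo)%E.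
  by move: Hlt; case: (limn_esup u) => [r _|/=|_]; rewrite ?ltry ?ltNyy.
rewrite /limn_esup /limf_esup => /ereal_inf_lt[_ [V [N _ NV] <-]] sV.
have uN j : (N <= j)%N -> (u j <= ereal_sup (u @` V))%E.
  by move=> Nj; apply: ereal_sup_ubound; exists j => //; exact: NV.
have [M uM] : exists M : R, forall j, (N <= j)%N -> (u j <= M%:E)%E.
  move: sV uN; case: (ereal_sup _) => // [r|] _ h; first by exists r.
  by have := h N (leqnn N); rewrite leeNy_eq.
exists (Num.bound `|M|), (maxn N 2) => j; rewrite geq_max => /andP[Nj j2].
have q2 : 2%:~R <= (q j)%:~R :> R.
  by rewrite ler_int (le_trans _ (convergent_den_ge j)).
have qp i : 0 < (q i)%:~R :> R by rewrite ltr0z (lt_le_trans _ (convergent_den_gt0 i)).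
have lq : 0 < ln (q j)%:~R :> R by apply: ln_gt0; apply: lt_le_trans q2; rewrite ltr1z.
have := uM j Nj; rewrite lee_fin ler_pdivrMr// => h.
rewrite -ler_ln ?posrE ?exprn_gt0// lnXn// -mulr_natl.
apply: (le_trans h); rewrite ler_wpM2r ?(ltW lq)//.
by apply: (le_trans (ler_norm _)); apply/ltW/archi_boundP.
Qed.

Lemma diophantine : (irrationality_measure alpha < +oo)%E ->
  exists A T0 : nat, diophantine_exponent alpha A T0.
Proof.
move=> /measure_den_bound[A [N HA]].
exists (A.*2.+1), (maxn 2 (absz (q N))) => T d k; rewrite geq_max => /andP[T2 TN] /andP[d0 dT].
have qN := convergent_den_gt0 N.
have ex : exists j, T%:Z *+ 2 <= q j.
  by exists (T.*2); apply: le_trans (convergent_den_ge _); lia.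
have [j jT jmin] := ex_minnP ex.
have Nj : (N < j)%N.
  rewrite ltnNge; apply/negP => /convergent_den_homo jN.
  have : (absz (q N))%:Z = q N by lia.
  lia.
case: j jT jmin Nj => // j jT jmin Nj.
have qjT : q j < T%:Z *+ 2.
  by rewrite ltNge; apply/negP => /jmin; rewrite ltnn.
have qp i : 0 < (q i)%:~R :> R by rewrite ltr0z (lt_le_trans _ (convergent_den_gt0 i)).
apply: le_trans (dist_lower_bound k d0 (_ : _ <= q j.+1)); last first.
  by apply: le_trans jT; lia.
have T2' : 2 <= T%:R :> R by rewrite -[2]/(2%:R) ler_nat.
have T0 : 0 < T%:R :> R by lra.
rewrite -[1 / _]mul1r mulrA mulr1 div1r lef_pV2 ?posrE ?exprn_gt0 ?mulrn_wgt0//; last by apply: ltn_trans T2.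
have qT : (q j)%:~R <= T%:R ^+ 2 :> R.
  apply: (@le_trans _ _ (T%:R *+ 2)); last by rewrite expr2 -mulr_natl; nra.
  by rewrite -mulr_natr -natrM -[_%:R]/((Posz (T * 2))%:~R) ler_int; lia.
apply: (@le_trans _ _ (T%:R ^+ 2 ^+ A *+ 2)).
  rewrite lerMn2r/=; apply: (le_trans (HA j Nj)).
  by rewrite lerXn2r ?nnegrE ?exprn_ge0 ?(ltW T0) ?(ltW (qp _)).
rewrite -exprM -muln2 mulnC exprS -mulr_natl.
by rewrite ler_wpM2r ?exprn_ge0 ?(ltW T0).
Qed.

End ContinuedFraction.

(** * Bounds in terms of the parameters *)

Section Assembly.
Variable R : realType.

(* Y ^ cutoff_exponent A separates the small m from the large ones, and the
   multiples d alpha used for small m have d <= Y ^ frequency_exponent A. *)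
Definition cutoff_exponent (A : nat) : nat := (A * (A.*2 + 5) + 2)%N.
Definition frequency_exponent (A : nat) : nat := (A.*2 + 4 + cutoff_exponent A + 1)%N.

Lemma sin_separated_mul (alpha : R) A T0 T m Y : diophantine_exponent alpha A T0 ->
  (T0 <= T)%N -> (0 < m)%N -> (m * Y <= T)%N ->
  sin_separated (pi * alpha * m%:R) Y (T%:R ^- A).
Proof.
move=> dio T0T m0 mY d /andP[d0 dY]; rewrite -!mulrA; apply: sin_dist => k.
rewrite -natrM; apply: dio => //; rewrite muln_gt0 m0 d0/=.
by apply: leq_trans mY; rewrite leq_mul2l ltnW ?orbT.
Qed.

Lemma block_sum_le (a phi delta : R) (X j0 j Y : nat) : (0 < Y)%N ->
  0 < delta -> sin_separated a Y delta ->
  (2 ^ j0 <= Y)%N -> (j0 <= j)%N -> (2 ^ j <= X)%N ->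
  Y%:R * (delta / 2)^-1 <= (X %/ 2 ^ j).+1%:R ->
  \sum_(0 <= r < (X %/ 2 ^ j).+1) block a phi j r
   <= 4 * j.+1%:R * X%:R / Num.sqrt (2 ^ j0)%:R.
Proof.
move=> Y0 d0 sepa yY jj jX hd.
have := @bilinear_sum R a phi prime j (X %/ 2 ^ j).+1 Y delta Y0 d0 sepa.
set S := \sum_(_ <= _ < _) _; set R0 : R := (X %/ 2 ^ j).+1%:R in hd *; set N := (2 ^ j)%:R.
move=> hS.
have S0 : 0 <= S by apply: sumr_ge0 => r _; exact: pmax_ge0.
set y := (2 ^ j0)%:R.
have y0 : 0 < y :> R by rewrite ltr0n expn_gt0.
have sy0 : 0 < Num.sqrt y by rewrite sqrtr_gt0.
have N0 : 0 < N :> R by rewrite ltr0n expn_gt0.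
have yN : y <= N by rewrite ler_nat leq_exp2l.
have yY' : y <= Y%:R by rewrite ler_nat.
have YY0 : 0 < Y%:R :> R by rewrite ltr0n.
have R00 : 0 < R0 by [].
have RN : R0 * N <= 2 * X%:R.
  rewrite /R0 /N; apply: (@le_trans _ _ (2 * X)%:R); last by rewrite natrM.
  rewrite -natrM ler_nat mulSn; by have := leq_trunc_div X (2 ^ j); lia.
have NY : N / Y%:R + 1 <= 2 * N / y.
  have : N / Y%:R <= N / y by rewrite ler_wpM2l ?(ltW N0)// lef_pV2.
  have : 1 <= N / y by rewrite ler_pdivlMr// mul1r.
  by rewrite -mulrA; lra.
have sq : S ^+ 2 <= (4 * j.+1%:R * X%:R / Num.sqrt y) ^+ 2.
  apply: (le_trans hS).
  apply: (@le_trans _ _ (R0 * (j.+1%:R ^+ 2 * (N * ((2 * N / y) * (2 * R0)))))).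
    rewrite ler_wpM2l ?(ltW R00)// ler_wpM2l ?sqr_ge0// ler_wpM2l ?(ltW N0)//.
    apply: ler_pM => //; first by rewrite addr_ge0// divr_ge0// ltW.
    + by rewrite addr_ge0 ?(ltW R00)// mulr_ge0// invr_ge0; lra.
    + by move: hd; set t := Y%:R * _; lra.
  rewrite (_ : R0 * _ = 4 * j.+1%:R ^+ 2 / y * (R0 * N) ^+ 2); last by field; rewrite gt_eqF.
  have -> : (4 * j.+1%:R * X%:R / Num.sqrt y) ^+ 2 = 4 * j.+1%:R ^+ 2 / y * (2 * X%:R) ^+ 2.
    by rewrite !exprMn exprVn sqr_sqrtr ?(ltW y0)//; field; rewrite gt_eqF.
  rewrite ler_wpM2l// ?lerXn2r ?nnegrE//.
  by rewrite divr_ge0// ?(ltW y0)// mulr_ge0// sqr_ge0.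
  by rewrite mulr_ge0// ltW.
by rewrite -(ler_pXn2r (ltn0Sn 1)) ?nnegrE// divr_ge0 ?(ltW sy0)// !mulr_ge0.
Qed.

Lemma leq_expn (n k : nat) : (0 < n)%N -> (0 < k)%N -> (n <= n ^ k)%N.
Proof. by move=> n0 k0; rewrite -{1}(expn1 n) leq_pexp2l. Qed.

Lemma small_terms_le (Y q y k : nat) : (4 <= Y)%N -> (y <= Y)%N ->
  (y + 1 + q.+1 * (2 * Y ^ (k + 1)) <= q.+1 * Y ^ (k + 3))%N.
Proof.
move=> Y4 yY; have Yk : (0 < Y ^ k)%N by rewrite expn_gt0; lia.
have -> : (Y ^ (k + 1) = Y * Y ^ k)%N by rewrite addn1 expnS.
have -> : (Y ^ (k + 3) = Y * (Y * (Y * Y ^ k)))%N by rewrite addn3 !expnS.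
have Yz : (Y <= Y * Y ^ k)%N by rewrite leq_pmulr.
move: (Y * Y ^ k)%N Yz => z Yz.
have z8 : (16 * z <= Y * (Y * z))%N.
  by rewrite mulnA leq_mul2r; apply/orP; right; exact: (leq_mul Y4 Y4).
have : (q.+1 * (16 * z) <= q.+1 * (Y * (Y * z)))%N by rewrite leq_mul2l z8 orbT.
have : (z <= q.+1 * z)%N by rewrite leq_pmull.
move: (q.+1 * (Y * (Y * z)))%N => w; rewrite [(q.+1 * (2 * z))%N]mulnCA [(q.+1 * (16 * z))%N]mulnCA.
move: (q.+1 * z)%N => u; lia.
Qed.

Lemma inv_le_inv_sqrt (j Y : nat) : (2 ^ j <= Y)%N ->
  1 / Y%:R <= 1 / Num.sqrt (2 ^ j)%:R :> R.
Proof.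
move=> jY; have j0 : (0 < 2 ^ j)%N by rewrite expn_gt0.
rewrite !div1r lef_pV2 ?posrE ?sqrtr_gt0 ?ltr0n ?(leq_trans j0)//.
apply: (@le_trans _ _ (2 ^ j)%:R); last by rewrite ler_nat.
rewrite -[leRHS]sqr_sqrtr// expr2 ler_peMl ?sqrtr_ge0//.
by rewrite -[X in X <= _]sqrtr1 ler_wsqrtr// ler1n.
Qed.

Lemma sum_succ_le (J j0 : nat) (P : pred nat) (c lambda : R) : 0 <= c -> J%:R <= lambda ->
  \sum_(j0 <= j < J | P j) j.+1%:R * c <= lambda ^+ 2 * c.
Proof.
move=> c0 Jl; rewrite big_mkcond.
apply: (@le_trans _ _ ((J - j0)%:R * (J%:R * c))).
  apply: sum_nat_const_le => j /andP[_ jJ]; case: ifP => _; last by rewrite mulr_ge0.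
  by rewrite ler_wpM2r// ler_nat.
rewrite mulrA ler_wpM2r// expr2; apply: ler_pM => //; apply: le_trans Jl.
by rewrite ler_nat leq_subr.
Qed.

Variables (alpha : R) (A T0 : nat).
Hypothesis dio : diophantine_exponent alpha A T0.

Local Notation b := (cutoff_exponent A).
Local Notation e := (frequency_exponent A).
Local Notation H Y := (Y ^ (A.*2 + 4))%N.

Lemma prime_sum_le (phi lambda rho : R) (X Y j0 J Q h m : nat) :
  (T0 <= Y)%N -> (4 <= Y)%N -> (2 ^ j0 <= Y)%N -> (X < 2 ^ J)%N -> (j0 <= J)%N ->
  J%:R <= lambda -> \sum_(1 <= q < X.+1) q%:R^-1 <= lambda -> 1 <= lambda ->
  (Y ^ b * (Y ^ (A * e + 2)) ^ 2 <= X)%N -> (Y ^ b * (Q.+1 * Y ^ (A * e + 4)) <= X)%N ->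
  1 / Num.sqrt (2 ^ j0)%:R <= rho ->
  (forall N, (N <= X)%N -> \sum_(1 <= i < N.+1 | smooth (2 ^ j0) i && (Q.+1 * Y <= i)%N) i%:R^-1 <= rho) ->
  (0 < h < H Y)%N -> (0 < m < Y ^ b)%N ->
  pmax (fun p => (prime p)%:R * cosn (pi * alpha * h%:R * m%:R) phi p) (X %/ m).+1
  <= (Q.+1 * Y ^ (A * e + 3))%:R + 10 * lambda ^+ 2 * rho * X%:R * m%:R^-1.
Proof.
move=> YT Y4 yY XJ jJ Jl hl l1 h4 h5 hy hs /andP[h0 hH] /andP[m0 mb].
have Y0 : (0 < Y)%N by lia.
have Ye k : (0 < Y ^ k)%N by rewrite expn_gt0 Y0.
have Y4' : 4 <= Y%:R :> R by rewrite -[4]/(4%:R) ler_nat.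
have Y0' : 0 < Y%:R :> R by lra.
set N := (X %/ m)%N.
have NX : (N <= X)%N by rewrite leq_div.
have NJ : (N < 2 ^ J)%N by exact: leq_ltn_trans XJ.
pose T := (Y ^ e)%N.
pose delta : R := T%:R ^- A.
have T0' : 0 < T%:R :> R by rewrite ltr0n /T Ye.
have d0 : 0 < delta by rewrite invr_gt0 exprn_gt0.
have sepa : sin_separated (pi * alpha * h%:R * m%:R) Y delta.
  rewrite -[pi * alpha * _ * _]mulrA -natrM; apply: (sin_separated_mul dio).
  - by rewrite (leq_trans YT)// /T leq_expn// /frequency_exponent addn1.
  - by rewrite muln_gt0 h0.
  - apply: (@leq_trans (Y ^ (A.*2 + 4) * Y ^ b * Y ^ 1)).
      by rewrite expn1 leq_mul2r leq_mul ?orbT// ltnW.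
    by rewrite -!expnD.
have dE : Y%:R * (delta / 2)^-1 = (2 * Y ^ (A * e + 1))%:R.
  by rewrite /delta /T invf_div invrK natrM !natrX addn1 exprS (mulnC A) exprM; ring.
have Zd : Y%:R * (delta / 2)^-1 <= (Y ^ (A * e + 2))%:R.
  rewrite dE ler_nat (addnS _ 1) expnS leq_mul2r.
  by rewrite (leq_trans _ Y4) ?orbT.
have NZ : ((Y ^ (A * e + 2)) ^ 2 <= N)%N.
  rewrite leq_divRL//; apply: leq_trans h4; rewrite mulnC leq_mul2r ltnW ?orbT//.
have rho0 : 0 < rho by apply: lt_le_trans hy; rewrite divr_gt0 ?sqrtr_gt0 ?ltr0n ?expn_gt0.
have mp : 0 < m%:R :> R by rewrite ltr0n.
have Nm : N%:R <= X%:R * m%:R^-1 :> R.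
  by rewrite ler_pdivlMr// -natrM ler_nat leq_trunc_div.
have Yrho : 1 / Y%:R <= rho := le_trans (inv_le_inv_sqrt yY) hy.
have c10 : 0 <= 10 * lambda ^+ 2 * rho * X%:R.
  by apply: mulr_ge0 => //; apply: mulr_ge0 (ltW rho0); rewrite mulr_ge0// sqr_ge0.
have [QN|NQ] := leqP N Q.
  apply: (@le_trans _ _ N.+1%:R).
    apply: pmax_le => // t tN; apply: (le_trans (ler_norm_sum _ _ _)).
    apply: (@le_trans _ _ ((t - 0)%:R * 1)); last by rewrite mulr1 subn0 ler_nat.
    apply: sum_nat_const_le => i _; rewrite normrM normr_nat.
    by case: (prime i); rewrite ?mul0r ?mul1r ?cosn_le1.
  rewrite -[leLHS]addr0; apply: lerD.
    by rewrite ler_nat (leq_trans (_ : N.+1 <= Q.+1)%N) ?leq_pmulr.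
  by rewrite mulr_ge0 ?invr_ge0.
have := @prime_sum R (pi * alpha * h%:R * m%:R) phi j0 J N Q Y delta Y0 d0 sepa NJ jJ.
move=> /le_trans; apply.
set E2 := \sum_(1 <= i < N.+1 | _) _; set E3 := \sum_(j0 <= j < J | _) _.
have HQ : \sum_(1 <= q < Q.+1) q%:R^-1 <= lambda.
  apply: le_trans hl; rewrite [leRHS](@big_cat_nat _ _ _ Q.+1)//=; last by rewrite ltnS (leq_trans (ltnW NQ)).
  by rewrite lerDl sumr_ge0// => i _; rewrite invr_ge0.
have hE2 : E2 <= N%:R * rho by rewrite /E2 -mulr_sumr ler_wpM2l//; exact: hs.
have hE3 : E3 <= 8 * lambda ^+ 2 * rho * N%:R.
  apply: (@le_trans _ _ (\sum_(j0 <= j < J | (4 ^ j <= N)%N) j.+1%:R * (8 * rho * N%:R))).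
    rewrite /E3 big_nat_cond [leRHS]big_nat_cond; apply: ler_sum => j /andP[/andP[jj _] jN].
    have j2N : (2 ^ j * 2 ^ j <= N)%N by rewrite -expnMn.
    have jN' : (2 ^ j <= N)%N by rewrite (leq_trans _ j2N)// leq_pmulr// expn_gt0.
    have Zj : (Y ^ (A * e + 2) <= (N %/ 2 ^ j).+1)%N.
      rewrite -leq_sqr; apply: (leq_trans NZ).
      have := ltn_ceil N (_ : 0 < 2 ^ j)%N; rewrite expn_gt0 => /(_ isT) /ltnW /leq_trans; apply.
      by rewrite -mulnn leq_mul2l/= ltnW// ltnS leq_divRL// expn_gt0.
    have hb : Y%:R * (delta / 2)^-1 <= (N %/ 2 ^ j).+1%:R by apply: (le_trans Zd); rewrite ler_nat.
    have {}hb := block_sum_le phi Y0 d0 sepa yY jj jN' hb.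
    apply: (@le_trans _ _ (2 * (4 * j.+1%:R * N%:R / Num.sqrt (2 ^ j0)%:R))).
      by rewrite ler_wpM2l.
    rewrite [leLHS](_ : _ = j.+1%:R * 8 * N%:R * (1 / Num.sqrt (2 ^ j0)%:R)); last by ring.
    rewrite [leRHS](_ : _ = j.+1%:R * 8 * N%:R * rho); last by ring.
    by rewrite ler_wpM2l// !mulr_ge0.
  apply: (le_trans (sum_succ_le _ _ _ Jl)); first by rewrite !mulr_ge0// ltW.
  by rewrite le_eqVlt; apply/orP; left; apply/eqP; ring.
have hE1 : N%:R / Y%:R * \sum_(1 <= q < Q.+1) q%:R^-1 <= N%:R * rho * lambda.
  apply: ler_pM => //.
    by apply: sumr_ge0 => i _; rewrite invr_ge0.
  by rewrite ler_wpM2l// -div1r.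
have first : (2 ^ j0)%:R + 1 + Q.+1%:R * (Y%:R * (delta / 2)^-1) <= (Q.+1 * Y ^ (A * e + 3))%:R.
  rewrite dE -[1]/(1%:R) -!natrM -!natrD ler_nat.
  exact: small_terms_le.
have lam2 : lambda <= lambda ^+ 2 by rewrite expr2; nra.
have lam1 : 1 <= lambda ^+ 2 by nra.
have N0 : 0 <= N%:R * rho by rewrite mulr_ge0// ltW.
have : 10 * lambda ^+ 2 * rho * N%:R <= 10 * lambda ^+ 2 * rho * X%:R * m%:R^-1.
  by rewrite -[leRHS]mulrA; apply: ler_wpM2l => //; apply: mulr_ge0 (ltW rho0); rewrite mulr_ge0// sqr_ge0.
have : N%:R * rho * lambda <= N%:R * rho * lambda ^+ 2 by rewrite ler_wpM2l.
have : N%:R * rho <= N%:R * rho * lambda ^+ 2 by rewrite ler_peMr.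
move: hE1 hE2 hE3 first; set u := N%:R / _ * _.
set v := Q.+1%:R * _; set w := (Q.+1 * _)%:R; set t := 10 * _ * _ * _ * _.
lra.
Qed.

Variables (K0 : nat) (I : nat -> set R).
Hypothesis famI : interval_family K0 I.

Lemma cosn_sum_setB_le (phi lambda rho : R) (X Y j0 J Q h : nat) :
  (T0 <= Y)%N -> (4 <= Y)%N -> (2 ^ j0 <= Y)%N -> (X < 2 ^ J)%N -> (j0 <= J)%N ->
  J%:R <= lambda -> \sum_(1 <= q < X.+1) q%:R^-1 <= lambda -> 1 <= lambda ->
  (Y ^ b * (Y ^ (A * e + 2)) ^ 2 <= X)%N -> (Y ^ b * (Q.+1 * Y ^ (A * e + 4)) <= X)%N ->
  1 / Num.sqrt (2 ^ j0)%:R <= rho ->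
  (forall N, (N <= X)%N -> \sum_(1 <= i < N.+1 | smooth (2 ^ j0) i && (Q.+1 * Y <= i)%N) i%:R^-1 <= rho) ->
  \sum_(1 <= n < X.+1 | smooth (2 ^ j0) n) 1 <= rho * X%:R ->
  (0 < h < H Y)%N ->
  `|\sum_(1 <= n < X.+1 | `[< setB I n >]) cosn (pi * alpha * h%:R) phi n|
  <= 2 ^+ K0 * (31 * lambda ^+ 3 * rho * X%:R).
Proof.
move=> YT Y4 yY XJ jJ Jl hl l1 h4 h5 hy hs hc hH.
have /andP[h0 hH'] := hH.
have Y0 : (0 < Y)%N by lia.
have Ye k : (0 < Y ^ k)%N by rewrite expn_gt0 Y0.
have Y4' : 4 <= Y%:R :> R by rewrite -[4]/(4%:R) ler_nat.
have Y0' : 0 < Y%:R :> R by lra.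
have rho0 : 0 < rho by apply: lt_le_trans hy; rewrite divr_gt0 ?sqrtr_gt0 ?ltr0n ?expn_gt0.
have Yrho : 1 / Y%:R <= rho := le_trans (inv_le_inv_sqrt yY) hy.
apply: (le_trans (cosn_sum_setB famI (pi * alpha * h%:R) phi (Y ^ b) XJ jJ)).
set S1 := \sum_(1 <= n < X.+1 | _) _; set S2 := \sum_(1 <= m < X.+1 | _) _.
set S3 := \sum_(j0 <= j < J | _) _.
have K1 : 1 <= 2 ^+ K0 :> R by rewrite exprn_ege1// ler1n.
have X0 : 0 <= X%:R :> R by [].
have hS2 : S2 <= 11 * lambda ^+ 3 * rho * X%:R.
  apply: (@le_trans _ _ (\sum_(1 <= m < X.+1 | (m < Y ^ b)%N)
     ((Q.+1 * Y ^ (A * e + 3))%:R + 10 * lambda ^+ 2 * rho * X%:R * m%:R^-1))).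
    rewrite /S2 big_nat_cond [leRHS]big_nat_cond; apply: ler_sum => m /andP[/andP[m0 _] mb].
    by apply: (@prime_sum_le phi lambda rho X Y j0 J Q h m) => //; rewrite m0.
  rewrite big_split/= -mulr_sumr.
  have c0 : 0 <= (Q.+1 * Y ^ (A * e + 3))%:R :> R by [].
  have s1 : \sum_(1 <= m < X.+1 | (m < Y ^ b)%N) (Q.+1 * Y ^ (A * e + 3))%:R <= X%:R * rho.
    apply: (@le_trans _ _ ((Y ^ b)%:R * (Q.+1 * Y ^ (A * e + 3))%:R)).
      apply: (@le_trans _ _ (\sum_(0 <= m < Y ^ b) (Q.+1 * Y ^ (A * e + 3))%:R)); last first.
        by rewrite sumr_const_nat subn0 mulr_natl.
      have [lt|lt] := leqP (Y ^ b) X.+1.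
        rewrite [leRHS](@big_nat_widen _ _ _ _ _ X.+1)// [leRHS]big_mkcond [leRHS]big_ltn//= -big_mkcond/=.
        by rewrite lerDr; case: ifP.
      rewrite [leRHS](@big_cat_nat _ _ _ X.+1)//= 1?ltnW// [X in _ <= X + _]big_ltn//.
      rewrite -[leLHS]addr0 -addrA [leRHS]addrCA; apply: lerD; last by rewrite addr_ge0// sumr_ge0.
      by rewrite big_mkcond; apply: ler_sum => m _; case: ifP.
    apply: (@le_trans _ _ (X%:R * (1 / Y%:R))); last by rewrite ler_wpM2l.
    by rewrite mulrA mulr1 ler_pdivlMr// -!natrM ler_nat -!mulnA -expnSr -addnS.
  have s2 : \sum_(1 <= m < X.+1 | (m < Y ^ b)%N) m%:R^-1 <= lambda.
    apply: le_trans hl; rewrite big_mkcond; apply: ler_sum => m _.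
    by case: ifP => // _; rewrite invr_ge0.
  have s3 : 10 * lambda ^+ 2 * rho * X%:R * \sum_(1 <= m < X.+1 | (m < Y ^ b)%N) m%:R^-1
     <= 10 * lambda ^+ 2 * rho * X%:R * lambda.
    apply: ler_wpM2l => //; apply: mulr_ge0 => //.
    by apply: mulr_ge0 (ltW rho0); rewrite mulr_ge0// sqr_ge0.
  have : X%:R * rho <= lambda ^+ 3 * (X%:R * rho).
    by rewrite ler_peMl ?mulr_ge0 ?(ltW rho0)// exprn_ege1.
  have : 10 * lambda ^+ 2 * rho * X%:R * lambda = 10 * (lambda ^+ 3 * (X%:R * rho)) by ring.
  have : 11 * lambda ^+ 3 * rho * X%:R = 11 * (lambda ^+ 3 * (X%:R * rho)) by ring.
  move: s1 s3; set u := 10 * _ * _ * _ * \sum_(_ <= _ < _ | _) _.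
  set v := 11 * _ * _ * _; set t := 10 * _ * _ * _ * _; set z := _ ^+ 3 * _; lra.
have hS3 : S3 <= 4 * lambda ^+ 2 * rho * X%:R.
  pose T := (Y ^ (A.*2 + 5))%N.
  pose delta : R := T%:R ^- A.
  have T0' : 0 < T%:R :> R by rewrite ltr0n /T Ye.
  have d0 : 0 < delta by rewrite invr_gt0 exprn_gt0.
  have sepa : sin_separated (pi * alpha * h%:R) Y delta.
    apply: (sin_separated_mul dio) => //.
    - by rewrite (leq_trans YT)// /T leq_expn// addnS.
    - apply: (@leq_trans (Y ^ (A.*2 + 4) * Y ^ 1)).
        by rewrite expn1 leq_mul2r ltnW ?orbT.
      by rewrite -!expnD -addnA.
  have Zd : Y%:R * (delta / 2)^-1 <= (Y ^ b)%:R.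
    rewrite /delta /T invf_div invrK -natrX -expnM -[2]/(2%:R) -!natrM ler_nat.
    rewrite /cutoff_exponent addn2 !expnS [(_ * A)%N]mulnC; set w := (Y ^ _)%N.
    by rewrite leq_mul2l leq_mul2r (leq_trans _ Y4) ?orbT.
  apply: (@le_trans _ _ (\sum_(j0 <= j < J | (Y ^ b * 2 ^ j <= X)%N) j.+1%:R * (4 * rho * X%:R))).
    rewrite /S3 big_nat_cond [leRHS]big_nat_cond; apply: ler_sum => j /andP[/andP[jj _] jX].
    have jX' : (2 ^ j <= X)%N by rewrite (leq_trans _ jX)// leq_pmull.
    have hb : Y%:R * (delta / 2)^-1 <= (X %/ 2 ^ j).+1%:R.
      by apply: (le_trans Zd); rewrite ler_nat ltnW// ltnS leq_divRL ?expn_gt0.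
    have {}hb := block_sum_le phi Y0 d0 sepa yY jj jX' hb.
    apply: (le_trans hb).
    rewrite [leLHS](_ : _ = j.+1%:R * 4 * X%:R * (1 / Num.sqrt (2 ^ j0)%:R)); last by ring.
    rewrite [leRHS](_ : _ = j.+1%:R * 4 * X%:R * rho); last by ring.
    by rewrite ler_wpM2l// !mulr_ge0.
  apply: (le_trans (sum_succ_le _ _ _ Jl)); first by rewrite !mulr_ge0// ltW.
  by rewrite le_eqVlt; apply/orP; left; apply/eqP; ring.
have z0 : 0 <= rho * X%:R by rewrite mulr_ge0// ltW.
have l3 : 1 <= lambda ^+ 3 by exact: exprn_ege1.
have l23 : lambda ^+ 2 <= lambda ^+ 3 by rewrite [leRHS]exprS ler_peMl// sqr_ge0.
have r1 : rho * X%:R <= lambda ^+ 3 * (rho * X%:R) by rewrite ler_peMl.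
have r2 : lambda ^+ 2 * (rho * X%:R) <= lambda ^+ 3 * (rho * X%:R) by rewrite ler_wpM2r.
set z := lambda ^+ 3 * (rho * X%:R) in r1 r2.
have zz : 0 <= z by apply: le_trans r1.
have hS2' : S2 <= 11 * z by apply: (le_trans hS2); rewrite /z; lra.
have hS3' : S3 <= 4 * z by apply: (le_trans hS3); move: r2; lra.
have hS1' : S1 <= 2 ^+ K0 * z by apply: (le_trans hc); apply: (le_trans r1); rewrite ler_peMl.
have -> : 31 * lambda ^+ 3 * rho * X%:R = 31 * z by rewrite /z; ring.
have k0 : 0 <= 2 ^+ K0 :> R by lra.
have q2 := ler_wpM2l k0 hS2'; have q3 := ler_wpM2l k0 hS3'.
move: hS1' q2 q3; set k := 2 ^+ K0; nra.
Qed.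

Lemma discrepancy_finite (beta lambda rho : R) (X Y j0 J Q : nat) :
  (T0 <= Y)%N -> (4 <= Y)%N -> (2 ^ j0 <= Y)%N -> (X < 2 ^ J)%N -> (j0 <= J)%N ->
  J%:R <= lambda -> \sum_(1 <= q < X.+1) q%:R^-1 <= lambda -> 1 <= lambda ->
  (Y ^ b * (Y ^ (A * e + 2)) ^ 2 <= X)%N -> (Y ^ b * (Q.+1 * Y ^ (A * e + 4)) <= X)%N ->
  (H Y <= X)%N ->
  1 / Num.sqrt (2 ^ j0)%:R <= rho ->
  (forall N, (N <= X)%N -> \sum_(1 <= i < N.+1 | smooth (2 ^ j0) i && (Q.+1 * Y <= i)%N) i%:R^-1 <= rho) ->
  \sum_(1 <= n < X.+1 | smooth (2 ^ j0) n) 1 <= rho * X%:R ->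
  0 <= beta <= 1 ->
  `|\sum_(1 <= n < X.+1 | `[< setB I n >] && (frac_part (alpha * n%:R) <= beta)) 1
     - beta * \sum_(1 <= n < X.+1 | `[< setB I n >]) 1|
  <= 2 ^+ K0 * (132 * lambda ^+ 4 * rho * X%:R).
Proof.
move=> YT Y4 yY XJ jJ Jl hl l1 h4 h5 hX hy hs hc hb.
have Y0 : (0 < Y)%N by lia.
have Ye k : (0 < Y ^ k)%N by rewrite expn_gt0 Y0.
have Y4' : 4 <= Y%:R :> R by rewrite -[4]/(4%:R) ler_nat.
have Y0' : 0 < Y%:R :> R by lra.
have rho0 : 0 < rho by apply: lt_le_trans hy; rewrite divr_gt0 ?sqrtr_gt0 ?ltr0n ?expn_gt0.
have Yrho : 1 / Y%:R <= rho := le_trans (inv_le_inv_sqrt yY) hy.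
pose w : R := Y%:R ^- A / 2.
have w0 : 0 < w by rewrite divr_gt0// invr_gt0 exprn_gt0.
have H0 : (0 < H Y)%N by exact: Ye.
have HE : (H Y)%:R = Y%:R ^+ A ^+ 2 * Y%:R ^+ 4 :> R.
  by rewrite natrX exprD -muln2 exprM.
have YA : 1 <= Y%:R ^+ A :> R by rewrite exprn_ege1//; lra.
have Y4p : 64 * Y%:R <= Y%:R ^+ 4 :> R.
  rewrite (_ : Y%:R ^+ 4 = Y%:R * Y%:R * Y%:R * Y%:R :> R); last by ring.
  rewrite ler_wpM2r ?(ltW Y0')//.
  have : 16 <= Y%:R * Y%:R :> R by nra.
  nra.
have YA0 : 0 < Y%:R ^+ A :> R by lra.
have Hw : 2 / (H Y)%:R <= w.
  rewrite /w HE ler_pdivrMr ?mulr_gt0 ?exprn_gt0//.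
  rewrite [leRHS](_ : _ = Y%:R ^+ A * (Y%:R ^+ 4 / 2)); last by field; rewrite gt_eqF.
  by nra.
pose E : R := 2 ^+ K0 * (31 * lambda ^+ 3 * rho * X%:R).
have lam0 : 0 <= lambda by lra.
have E0 : 0 <= E by rewrite /E !mulr_ge0 ?exprn_ge0 ?(ltW rho0).
have sep (d : nat) (k : int) : (0 < d < Y)%N -> 2 * w <= `|alpha * d%:R - k%:~R|.
  move=> /andP[d0 dY]; rewrite /w mulrCA divff// mulr1; apply: dio => //.
  by rewrite d0 ltnW.
have hE h phi : (0 < h < H Y)%N ->
   `|\sum_(1 <= n < X.+1 | `[< setB I n >]) cosn (pi * alpha * h%:R) phi n| <= E.
  by move=> hh; apply: (@cosn_sum_setB_le phi lambda rho X Y j0 J Q h).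
apply: (le_trans (fejer_discrepancy H0 Y0 w0 Hw hb E0 sep hE)).
have hH : \sum_(1 <= d < H Y) d%:R^-1 <= lambda.
  apply: le_trans hl; rewrite [leRHS](@big_cat_nat _ _ _ (H Y))//= 1?ltnW// ?ltnS//.
  by rewrite lerDl sumr_ge0// => i _; rewrite invr_ge0.
have X0 : 0 <= X%:R :> R by [].
have YX : (Y <= X)%N by apply: leq_trans hX; rewrite leq_expn// addnS.
have X1 : 1 <= X%:R / Y%:R :> R by rewrite ler_pdivlMr// mul1r ler_nat.
have t2 : 2 * (X.+1%:R / Y%:R + 1) <= 6 * (rho * X%:R).
  have : X%:R / Y%:R <= rho * X%:R by rewrite mulrC ler_wpM2r// -div1r.
  have : 1 / Y%:R <= 1 :> R by rewrite ler_pdivrMr//; lra.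
  by rewrite -natr1 mulrDl; lra.
have t3 : X%:R * (8 / ((H Y)%:R * w ^+ 2) + 1 / (H Y)%:R) <= 2 * (rho * X%:R).
  have a1 : 8 / ((H Y)%:R * w ^+ 2) <= rho.
    apply: le_trans Yrho; rewrite HE /w.
    rewrite [leLHS](_ : _ = 32 / Y%:R ^+ 4); last by field; rewrite !gt_eqF.
    rewrite ler_pdivrMr ?exprn_gt0// mulrAC ler_pdivlMr//; nra.
  have a2 : 1 / (H Y)%:R <= rho.
    apply: le_trans Yrho; rewrite !div1r lef_pV2 ?posrE ?ltr0n// ler_nat.
    by rewrite leq_expn// addnS.
  rewrite [leRHS](_ : _ = X%:R * (rho + rho)); last by ring.
  by rewrite ler_wpM2l// lerD.
have t1 : 4 * E * \sum_(1 <= d < H Y) d%:R^-1 <= 4 * E * lambda by rewrite ler_wpM2l// mulr_ge0.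
have z0 : 0 <= rho * X%:R by rewrite mulr_ge0// ltW.
have K1 : 1 <= 2 ^+ K0 :> R by rewrite exprn_ege1// ler1n.
have r1 : rho * X%:R <= 2 ^+ K0 * (lambda ^+ 4 * (rho * X%:R)).
  by rewrite mulrA ler_peMl// mulr_ege1// exprn_ege1.
have -> : 2 ^+ K0 * (132 * lambda ^+ 4 * rho * X%:R) = 132 * (2 ^+ K0 * (lambda ^+ 4 * (rho * X%:R))) by ring.
have : 4 * E * lambda = 124 * (2 ^+ K0 * (lambda ^+ 4 * (rho * X%:R))) by rewrite /E; ring.
move: t1 t2 t3 r1; set z := 2 ^+ K0 * _; set s := 4 * E * \sum_(_ <= _ < _) _.
set u := 4 * E * lambda; set v := 2 * (_ + _); set t := X%:R * (_ + _); lra.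
Qed.

End Assembly.

(** * Rankin's method *)

Section SmoothBounds.
Variable R : realType.
Implicit Types (eta : R).

Lemma ln2_ge_half : 1 / 2 <= ln 2 :> R.
Proof.
have : ln (1 + - (1 / 2)) <= - (1 / 2) :> R by apply: le_ln1Dx; lra.
rewrite (_ : 1 + - (1 / 2) = 2^-1 :> R); last by field.
by rewrite lnV ?posrE//; lra.
Qed.

Lemma smooth_weight_le eta (j0 X : nat) : (0 < j0)%N -> 0 <= eta <= 1 / 2 ->
  \sum_(1 <= n < X.+1 | smooth (2 ^ j0) n) expR (- (1 - eta) * ln n%:R)
  <= expR (8 * expR (eta * ln (2 ^ j0)%:R) * (1 + ln j0%:R)).
Proof.
move=> j00 /andP[e0 e1]; set w := fun n : nat => expR (- (1 - eta) * ln n%:R).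
have w34 p : prime p -> w p <= 3 / 4.
  move=> pp; have p2 : ln 2 <= ln p%:R :> R.
    by rewrite ler_ln ?posrE ?ltr0n ?prime_gt0// -[2]/(2%:R) ler_nat prime_gt1.
  have l2 := ln2_ge_half.
  have sq : expR (- (1 / 2) * ln 2) ^+ 2 = 1 / 2 :> R.
    rewrite -expRM_natl (_ : 2%:R * (- (1 / 2) * ln 2) = - ln 2); last by field.
    by rewrite expRN lnK ?posrE// div1r.
  have le1 : w p <= expR (- (1 / 2) * ln 2) by rewrite ler_expR; nra.
  have := expR_gt0 (- (1 / 2) * ln 2 : R); nra.
have w0 n : 0 <= w n by exact: expR_ge0.
have ran := @rankin R w (2 ^ j0) X w0.
apply: (le_trans (ran _ _ _)).
- move=> m n m0 n0; rewrite /w natrM lnM ?posrE ?ltr0n//.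
  by rewrite mulrDr expRD.
- by rewrite /w ln1 mulr0 expR0.
- by move=> p /w34; lra.
apply: (@le_trans _ _ (\prod_(0 <= p < 2 ^ j0 | prime p) expR (4 * w p))).
  apply: ler_prod => p pp; have := w34 p pp; have := w0 p => wp0 wp1.
  rewrite invr_ge0 subr_ge0; apply/andP; split; first lra.
  rewrite -[leRHS]invrK lef_pV2 ?posrE ?invr_gt0 ?expR_gt0//; last lra.
  rewrite -expRN; have h := expR_ge1Dx (4 * w p); have hp := expR_gt0 (4 * w p).
  rewrite expRN -[leLHS]div1r ler_pdivrMr//; nra.
rewrite -expR_sum ler_expR -mulr_sumr.
apply: (@le_trans _ _ (4 * (expR (eta * ln (2 ^ j0)%:R) * (2 * (1 + ln j0%:R))))); last first.
  by rewrite le_eqVlt; apply/orP; left; apply/eqP; ring.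
rewrite ler_wpM2l//.
apply: (@le_trans _ _ (expR (eta * ln (2 ^ j0)%:R) * \sum_(0 <= p < 2 ^ j0 | prime p) p%:R^-1)).
  rewrite mulr_sumr big_nat_cond [leRHS]big_nat_cond.
  apply: ler_sum => p /andP[/andP[_ py] pp].
  have p0 : 0 < p%:R :> R by rewrite ltr0n prime_gt0.
  rewrite /w (_ : - (1 - eta) * ln p%:R = eta * ln p%:R - ln p%:R); last by ring.
  rewrite expRB lnK ?posrE// ler_pM2r ?invr_gt0// ler_expR ler_wpM2l//.
  by rewrite ler_ln ?posrE ?ltr0n ?expn_gt0 ?prime_gt0// ler_nat ltnW.
rewrite ler_wpM2l ?expR_ge0//.
case: j0 j00 {ran} => // J _; apply: (le_trans (sum_inv_prime _ _)); rewrite ler_wpM2l//.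
case: J => [|J].
  by rewrite big_geq// ln1 addr0.
apply: (le_trans (harmonic_ln _ _)) => //; rewrite lerD2l ler_ln ?posrE//.
by rewrite ler_nat.
Qed.

Lemma smooth_tail_le eta (j0 N D : nat) : (0 < j0)%N -> (0 < D)%N -> 0 <= eta <= 1 / 2 ->
  \sum_(1 <= i < N.+1 | smooth (2 ^ j0) i && (D <= i)%N) (i%:R^-1 : R)
  <= expR (- eta * ln D%:R) * expR (8 * expR (eta * ln (2 ^ j0)%:R) * (1 + ln j0%:R)).
Proof.
move=> j00 D0 he; have /andP[e0 e1] := he.
apply: (@le_trans _ _ (expR (- eta * ln D%:R) *
  \sum_(1 <= n < N.+1 | smooth (2 ^ j0) n) expR (- (1 - eta) * ln n%:R))); last first.
  by rewrite ler_wpM2l ?expR_ge0//; exact: smooth_weight_le.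
rewrite mulr_sumr big_mkcondr/= big_nat_cond [leRHS]big_nat_cond.
apply: ler_sum => i /andP[/andP[i0 _] _]; case: ifP => [Di|_]; last by rewrite mulr_ge0 ?expR_ge0.
have i0' : 0 < i%:R :> R by rewrite ltr0n.
have -> : i%:R^-1 = expR (- ln i%:R) :> R by rewrite expRN lnK ?posrE.
rewrite -expRD ler_expR.
have : ln D%:R <= ln i%:R :> R by rewrite ler_ln ?posrE ?ltr0n// ler_nat.
nra.
Qed.

Lemma smooth_count_le eta (j0 X : nat) : (0 < j0)%N -> (0 < X)%N -> 0 <= eta <= 1 / 2 ->
  \sum_(1 <= i < X.+1 | smooth (2 ^ j0) i) (1 : R)
  <= expR (- eta * ln X%:R) * expR (8 * expR (eta * ln (2 ^ j0)%:R) * (1 + ln j0%:R)) * X%:R.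
Proof.
move=> j00 X0 he; have /andP[e0 e1] := he.
have X0' : 0 < X%:R :> R by rewrite ltr0n.
apply: (@le_trans _ _ (expR ((1 - eta) * ln X%:R) *
  \sum_(1 <= n < X.+1 | smooth (2 ^ j0) n) expR (- (1 - eta) * ln n%:R))).
  rewrite mulr_sumr big_nat_cond [leRHS]big_nat_cond.
  apply: ler_sum => i /andP[/andP[i0 iX] _].
  rewrite -expRD -{1}expR0 ler_expR.
  have : ln i%:R <= ln X%:R :> R by rewrite ler_ln ?posrE ?ltr0n// ler_nat.
  nra.
rewrite mulrAC (_ : expR (- eta * ln X%:R) * X%:R = expR ((1 - eta) * ln X%:R)).
  by rewrite ler_wpM2l ?expR_ge0//; exact: smooth_weight_le.
rewrite -{2}(lnK (_ : X%:R \in Num.pos)) ?posrE// -expRD; congr expR; ring.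
Qed.

End SmoothBounds.

(** * Choice of the parameters *)

Section Asymptotics.
Variable R : realType.
Implicit Types (l x : R).

Lemma expR_ge_sqr l : 0 <= l -> l ^+ 2 / 2 <= expR l.
Proof.
by move=> l0; have := expR_ge1Dxn 1 l0; rewrite -[2`!%:R]/(2%:R); lra.
Qed.

(* L = ln x, l = ln (ln x) and S = sqrt (L * l) for a large x *)
Record log_scale (L l S : R) : Prop := Scale {
  scale_L : L = expR l;
  scale_S : S ^+ 2 = L * l;
  scale_l1 : 1000 <= l;
  scale_Sl : 200 * l <= S;
  scale_eps : 800 * (1 + l) * expR (45 / 100 * l) <= S }.

Lemma log_scale_exists c : exists x0 : R, forall x, x0 <= x ->
  0 < x /\ let L := ln x in let l := ln L in let S := Num.sqrt (L * l) in
   log_scale L l S /\ c <= l /\ c * S <= L.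
Proof.
pose m := 1 + `|c|.
have m1 : 1 <= m by rewrite /m lerDl.
have cm : c <= m by rewrite /m; have := ler_norm c; lra.
pose l0 : R := 1000 * 1000 + 2 * m ^+ 2.
exists (expR (expR l0)) => x x0.
have x_gt0 : 0 < x by apply: lt_le_trans x0; exact: expR_gt0.
split => // L l S.
have L0 : expR l0 <= L by rewrite -[expR l0]expRK ler_ln ?posrE ?expR_gt0.
have Lp : 0 < L by apply: lt_le_trans L0; exact: expR_gt0.
have ll : l0 <= l by rewrite -[l0]expRK ler_ln ?posrE ?expR_gt0.
have LE : L = expR l by rewrite lnK ?posrE.
have mm : 0 <= m ^+ 2 by exact: sqr_ge0.
have l6 : 1000 * 1000 <= l by apply: le_trans ll; rewrite /l0 lerDl mulr_ge0.
have lp : 0 <= l by clear -l6; lra.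
have Ll : l ^+ 2 / 2 <= L by rewrite LE; exact: expR_ge_sqr.
have LL0 : 0 <= L * l by rewrite mulr_ge0// ltW.
have SE : S ^+ 2 = L * l by rewrite sqr_sqrtr.
have S0 : 0 <= S by exact: sqrtr_ge0.
have Sge z : 0 <= z -> z ^+ 2 <= L * l -> z <= S.
  move=> z0 zz; rewrite -(ler_pXn2r (ltn0Sn 1)) ?nnegrE// SE//.
have L40 : 200 * 200 * l <= L by apply: le_trans Ll; clear -l6; nra.
split.
  split => //.
  - by clear -l6; lra.
  - apply: Sge; first by rewrite mulr_ge0.
    by rewrite exprMn !expr2 mulrA; apply: ler_wpM2r.
  - have p0 : 0 <= 800 * (1 + l) * expR (45 / 100 * l).
      by apply: mulr_ge0; [apply: mulr_ge0; clear -lp; lra|exact: expR_ge0].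
    apply: Sge => //.
    have e20 : 800 * (1 + l) <= expR (5 / 100 * l).
      have /expR_ge_sqr : 0 <= 5 / 100 * l by clear -lp; lra.
      by apply: le_trans; clear -l6; nra.
    have h5 : 800 * (1 + l) * expR (45 / 100 * l) <= expR (l / 2).
      rewrite (_ : l / 2 = 5 / 100 * l + 45 / 100 * l); last by field.
      by rewrite expRD ler_wpM2r ?expR_ge0.
    apply: (@le_trans _ _ (expR (l / 2) ^+ 2)).
      by rewrite ler_pXn2r ?nnegrE ?expR_ge0.
    rewrite -expRM_natl (_ : 2%:R * (l / 2) = l); last by field.
    by rewrite -LE ler_peMr ?(ltW Lp)//; clear -l6; lra.
have ml : 2 * m ^+ 2 <= l by apply: le_trans ll; rewrite /l0; move: (_ * m ^+ 2) => z; clear; lra.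
split.
  by apply: (le_trans cm); apply: le_trans ml; clear -m1; nra.
apply: (@le_trans _ _ (m * S)); first by rewrite ler_wpM2r.
have m0 : 0 <= m by apply: le_trans m1.
rewrite -(ler_pXn2r (ltn0Sn 1)) ?nnegrE ?mulr_ge0 ?(ltW Lp)//.
rewrite exprMn SE [leRHS]expr2 mulrCA ler_wpM2l ?(ltW Lp)//.
by apply: le_trans Ll; clear -ml lp; nra.
Qed.

Lemma le_truncn_nat (n : nat) x : n%:R <= x -> (n <= Num.truncn x)%N.
Proof.
by move=> nx; rewrite -(natrK (R := R) n); exact: le_truncn.
Qed.

Lemma choose_Y (T0 k : nat) (L S : R) : 1000 <= S -> T0%:R <= S -> 40 * (k%:R * S) <= L ->
  exists Y : nat, [/\ (T0 <= Y)%N, (4 <= Y)%N, expR S < Y%:R, Y%:R <= expR (2 * S)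
    & Y%:R ^+ k <= expR (L / 20)].
Proof.
move=> S1 TS kS; exists (Num.truncn (expR S)).+1.
have /andP[Yl Yu] := truncn_itv (expR_ge0 S).
have e1 := expR_ge1Dx S.
have Y2 : (Num.truncn (expR S)).+1%:R <= expR (2 * S).
  rewrite -natr1 (_ : 2 * S = S + S); last by ring.
  rewrite expRD; apply: (@le_trans _ _ (expR S + 1)); first by rewrite lerD2r.
  by clear -S1 e1; nra.
split => //.
- by rewrite -(ler_nat R); apply: le_trans (ltW Yu); lra.
- by rewrite -(ler_nat R); apply: le_trans (ltW Yu); lra.
apply: (@le_trans _ _ (expR (2 * S) ^+ k)).
  by rewrite lerXn2r ?nnegrE ?expR_ge0.
by rewrite -expRM_natl ler_expR; lra.
Qed.

Lemma choose_j0 (S : R) : 1000 <= S -> exists j0 : nat,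
  [/\ (0 < j0)%N, (2 ^ j0)%:R <= expR (9 / 10 * S), expR (9 / 10 * S) <= 2 * (2 ^ j0)%:R,
      ln (2 ^ j0)%:R <= 9 / 10 * S & j0%:R <= 2 * S].
Proof.
move=> S1; pose n0 := Num.truncn (expR (9 / 10 * S)).
have /andP[nl nu] := truncn_itv (expR_ge0 (9 / 10 * S)).
rewrite -/n0 in nl nu.
have n00 : (1 < n0)%N.
  by apply: le_truncn_nat; apply: le_trans (expR_ge1Dx _); lra.
have j0n : (2 ^ trunc_log 2 n0 <= n0)%N by rewrite trunc_logP// ltnW.
have nj0 : (n0 < 2 ^ (trunc_log 2 n0).+1)%N by exact: trunc_log_ltn.
exists (trunc_log 2 n0); move: (trunc_log 2 n0) j0n nj0 => j0 j0n nj0.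
have j0e : (2 ^ j0)%:R <= expR (9 / 10 * S) by apply: le_trans nl; rewrite ler_nat.
have lnj0 : ln (2 ^ j0)%:R <= 9 / 10 * S.
  by rewrite -[leRHS]expRK ler_ln ?posrE ?expR_gt0 ?ltr0n ?expn_gt0.
split => //.
- by rewrite lt0n; apply: contraTneq nj0 => ->; rewrite expn1 -leqNgt.
- by rewrite -natrM -expnS; apply: (le_trans (ltW nu)); rewrite ler_nat.
have l2 := @ln2_ge_half R.
have : j0%:R * ln 2 <= 9 / 10 * S.
  by move: lnj0; rewrite natrX lnXn// => h; rewrite [leLHS]mulr_natl.
have : 0 <= j0%:R :> R by [].
clear -l2 S1; nra.
Qed.

Lemma truncn_large x : 1000 <= ln x -> 0 < x -> let X := Num.truncn x in
  [/\ (0 < X)%N, X%:R <= x, x <= 2 * X%:R, ln X%:R <= ln x & 9 / 10 * ln x <= ln X%:R].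
Proof.
move=> L1 x_gt0 X; have /andP[Xx xX] := truncn_itv (ltW x_gt0).
rewrite -/X in Xx xX.
have xE : x = expR (ln x) by rewrite lnK ?posrE.
have x1 : 2 <= x by rewrite xE; have := expR_ge1Dx (ln x); lra.
have X0 : (0 < X)%N by apply: le_truncn_nat; lra.
have X0' : 0 < X%:R :> R by rewrite ltr0n.
have x2X : x <= 2 * X%:R.
  have : 1 <= X%:R :> R by rewrite ler1n.
  by move: xX; rewrite -natr1; lra.
split => //; first by rewrite ler_ln ?posrE.
have ln21 : ln 2 <= 1 :> R by have := @le_ln1Dx R 1; rewrite (_ : 1 + 1 = 2)//; apply; lra.
have : ln x <= ln 2 + ln X%:R by rewrite -lnM ?posrE// ler_ln ?posrE// mulr_gt0.
lra.
Qed.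

Lemma choose_J (X : nat) (L : R) : (0 < X)%N -> ln X%:R <= L -> 0 <= L ->
  exists J : nat, (X < 2 ^ J)%N /\ J%:R <= 1 + 2 * L.
Proof.
move=> X0 XL L0; exists (trunc_log 2 X).+1; split; first exact: trunc_log_ltn.
have h : (trunc_log 2 X)%:R * ln 2 <= L.
  apply: le_trans XL; rewrite mulr_natl -lnXn// -natrX ler_ln ?posrE ?ltr0n ?expn_gt0//.
  by rewrite ler_nat trunc_logP.
have l2 := @ln2_ge_half R; have : 0 <= (trunc_log 2 X)%:R :> R by [].
by rewrite -natr1; clear -h l2; nra.
Qed.

Lemma choose_Q (Y k : nat) x : 1000 <= ln x -> 0 < x -> Y%:R ^+ k <= expR (ln x / 20) ->
  exists Q : nat, expR (9 / 10 * ln x) < Q.+1%:R /\ (Y ^ k * Q.+1 <= Num.truncn x)%N.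
Proof.
move=> L1 x0 Yk; exists (Num.truncn (expR (9 / 10 * ln x))).
have /andP[Ql Qu] := truncn_itv (expR_ge0 (9 / 10 * ln x)).
split => //; apply: le_truncn_nat; rewrite natrM natrX.
set L := ln x in L1 Yk Ql *.
apply: (@le_trans _ _ (expR (L / 20) * (2 * expR (9 / 10 * L)))).
  apply: ler_pM => //.
  by rewrite -natr1; have := expR_ge1Dx (9 / 10 * L); lra.
rewrite mulrCA -expRD -[x]lnK ?posrE// -/L.
rewrite [X in _ <= expR X](_ : L = L / 20 + (L / 20 + 9 / 10 * L)); last by field.
rewrite [leRHS]expRD ler_wpM2r ?expR_ge0//.
by apply: le_trans (expR_ge1Dx _); lra.
Qed.

Lemma inv_sqrt_le (z S : R) : 0 <= S -> 0 < z -> expR (9 / 10 * S) <= 2 * z ->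
  1 / Num.sqrt z <= 2 * expR (- (44 / 100 * S)).
Proof.
move=> S0 z0 ez.
rewrite -(ler_pXn2r (ltn0Sn 1)) ?nnegrE ?divr_ge0 ?sqrtr_ge0 ?mulr_ge0 ?expR_ge0//.
rewrite div1r exprVn sqr_sqrtr ?(ltW z0)// exprMn -expRM_natl.
rewrite -[leLHS]div1r ler_pdivrMr//.
have h1 : expR (- (9 / 10 * S)) <= expR (2%:R * - (44 / 100 * S)) by rewrite ler_expR; lra.
have h2 : expR (- (9 / 10 * S)) * expR (9 / 10 * S) = 1 by rewrite -expRD addNr expR0.
have p1 := expR_gt0 (- (9 / 10 * S)).
move: (expR (- (9 / 10 * S))) (expR (9 / 10 * S)) (expR (2%:R * _)) h1 h2 p1 ez => u v t h1 h2 p1 ez.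
have : u * v <= u * (2 * z) by rewrite ler_wpM2l// ltW.
have : u * z <= t * z by rewrite ler_wpM2r// ltW.
clear -h2 z0; nra.
Qed.

Lemma rankin_exponent (L l S : R) (j0 : nat) : log_scale L l S -> 1000 * S <= L -> (0 < j0)%N ->
  ln (2 ^ j0)%:R <= 9 / 10 * S -> j0%:R <= 2 * S ->
  exists eta : R, 0 <= eta <= 1 / 2 /\ forall D : nat, 9 / 10 * L <= ln D%:R ->
   expR (- eta * ln D%:R) * expR (8 * expR (eta * ln (2 ^ j0)%:R) * (1 + ln j0%:R))
   <= expR (- (44 / 100 * S)).
Proof.
move=> [LE SE l1 Sl eps] SL j00 lnj0 j0S.
have l0 : 0 < l by lra.
have S0 : 0 < S by lra.
have L0 : 0 < L by rewrite LE expR_gt0.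
have j0p : 0 < j0%:R :> R by rewrite ltr0n.
have lnj : ln j0%:R <= l.
  by rewrite -[leRHS]expRK -LE ler_ln ?posrE//; lra.
pose eta := S / (2 * L).
have etaL : eta * L = S / 2 by rewrite /eta; field; rewrite gt_eqF.
have he : 0 <= eta <= 1 / 2.
  by rewrite /eta divr_ge0 ?(ltW S0) ?mulr_ge0 ?(ltW L0)//= ler_pdivrMr ?mulr_gt0//; lra.
have eta0 : 0 <= eta by case/andP: he.
have etaS : eta * (9 / 10 * S) = 45 / 100 * l.
  rewrite (_ : eta * _ = 45 / 100 * (S ^+ 2 / L)); last by rewrite /eta; field; rewrite gt_eqF.
  by rewrite SE [L * l]mulrC mulfK// gt_eqF.
have Gle : 8 * expR (eta * ln (2 ^ j0)%:R) * (1 + ln j0%:R) <= S / 100.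
  apply: (@le_trans _ _ (8 * expR (45 / 100 * l) * (1 + l))); last by clear -eps; lra.
  apply: ler_pM.
  - by rewrite mulr_ge0 ?expR_ge0.
  - by rewrite addr_ge0// ln_ge0// ler1n.
  - by rewrite ler_wpM2l// ler_expR -etaS; exact: ler_wpM2l.
  - by rewrite lerD2l.
exists eta; split => // D hD; rewrite -expRD ler_expR.
have : eta * (9 / 10 * L) <= eta * ln D%:R by rewrite ler_wpM2l.
rewrite mulrCA etaL mulNr; move: (eta * ln D%:R) Gle => u; move: (8 * _ * _) => v.
by clear; lra.
Qed.

Lemma log_factor_le (L l S : R) : log_scale L l S ->
  264 * (1 + 2 * L) ^+ 4 * expR (- (44 / 100 * S)) <= expR (- (41 / 100 * S)).
Proof.
move=> [LE SE l1 Sl _].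
have L1 : 1 <= L by rewrite LE; have := expR_ge1Dx l; lra.
have L3 : (1 + 2 * L) ^+ 4 <= 81 * expR (4 * l).
  rewrite (_ : 81 * expR (4 * l) = (3 * L) ^+ 4).
    by rewrite lerXn2r ?nnegrE//; clear -L1; lra.
  by rewrite exprMn LE -expRM_natl; congr (_ * _); ring.
have big : 264 * 81 <= expR (2 * l).
  have /expR_ge_sqr : 0 <= 2 * l by lra.
  by apply: le_trans; clear -l1; nra.
have e6 : 264 * (81 * expR (4 * l)) <= expR (3 / 100 * S).
  apply: (@le_trans _ _ (expR (2 * l + 4 * l))).
    by rewrite expRD mulrA ler_wpM2r ?expR_ge0.
  by rewrite ler_expR; clear -Sl l1; lra.
rewrite (_ : - (41 / 100 * S) = 3 / 100 * S + - (44 / 100 * S)); last by field.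
rewrite expRD ler_wpM2r ?expR_ge0//; apply: le_trans e6.
by rewrite ler_wpM2l.
Qed.

(* Y ~ e^S, 2 ^ j0 ~ e^(9S/10), Q ~ x^(9/10), lambda = 1 + 2 ln x and
   rho = 2 e^(-44S/100), where S = sqrt (ln x * ln (ln x)) *)
Lemma parameters (T0 k : nat) : (0 < k)%N -> exists x0 : R, forall x, x0 <= x ->
  0 < x /\ exists (Y j0 J Q : nat) (lambda rho : R),
  let X := Num.truncn x in
  [/\ (T0 <= Y)%N, (4 <= Y)%N, (2 ^ j0 <= Y)%N, (X < 2 ^ J)%N & (j0 <= J)%N] /\
  [/\ J%:R <= lambda, \sum_(1 <= q < X.+1) q%:R^-1 <= lambda, 1 <= lambda,
      (Y ^ k * Q.+1 <= X)%N & 1 / Num.sqrt (2 ^ j0)%:R <= rho] /\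
  [/\ forall N, (N <= X)%N ->
        \sum_(1 <= i < N.+1 | smooth (2 ^ j0) i && (Q.+1 * Y <= i)%N) i%:R^-1 <= rho,
      \sum_(1 <= n < X.+1 | smooth (2 ^ j0) n) 1 <= rho * X%:R &
      132 * lambda ^+ 4 * rho * X%:R <= error_term (41 / 100) x].
Proof.
move=> k_gt0; have [x0 Hx0] := log_scale_exists (40 * k%:R + T0%:R + 1000).
exists x0 => x /Hx0[x_gt0 HH]; pose L := ln x; pose l := ln L; pose S := Num.sqrt (L * l).
have {HH} [sc [cl cS]] : log_scale L l S /\ (40 * k%:R + T0%:R + 1000 <= l /\
  (40 * k%:R + T0%:R + 1000) * S <= L) := HH.
split => //; have [LE _ l1 Sl _] := sc.
have k0 : 0 <= k%:R :> R by []. have T00 : 0 <= T0%:R :> R by [].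
have S1 : 1000 <= S by clear -l1 Sl; lra.
have S0 : 0 <= S by clear -S1; lra.
have TS : T0%:R <= S by clear -cl k0 Sl l1; lra.
have kS : 40 * (k%:R * S) <= L by clear -cS S0 T00; nra.
have SL : 1000 * S <= L by clear -cS S0 T00 k0; nra.
have L1 : 1000 <= L by clear -SL S1; lra.
have [X0 Xx x2X lnXL lnX9] := truncn_large L1 x_gt0.
rewrite -/L in lnXL lnX9; set X := Num.truncn x in X0 Xx x2X lnXL lnX9 *.
have [Y [T0Y Y4 eY Y2 Yk]] := choose_Y S1 TS kS.
have [j0 [j00 j0e ej0 lnj0 j0S]] := choose_j0 S1.
have [J [XJ JL]] := choose_J X0 lnXL (le_trans (ler0n _ 1000) L1).
have [Q [Qu YX]] := choose_Q L1 x_gt0 Yk.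
have [eta [he expG]] := rankin_exponent sc SL j00 lnj0 j0S.
have e44 := expR_gt0 (- (44 / 100 * S)).
have e442 : expR (- (44 / 100 * S)) <= 2 * expR (- (44 / 100 * S)) by clear -e44; lra.
have pj0 : 0 < (2 ^ j0)%:R :> R by rewrite ltr0n expn_gt0.
have Y0 : (0 < Y)%N by apply: leq_trans Y4.
have j0Y : (2 ^ j0 <= Y)%N.
  rewrite -(ler_nat R); apply: (le_trans j0e); apply: le_trans (ltW eY).
  by rewrite ler_expR; clear -S0; lra.
have YX' : (Y <= X)%N.
  by apply: leq_trans YX; rewrite (leq_trans (leq_expn Y0 k_gt0))// leq_pmulr.
exists Y, j0, J, Q, (1 + 2 * L), (2 * expR (- (44 / 100 * S))).
split; [|split]; split => //.
- by rewrite -(@leq_exp2l 2)// (leq_trans j0Y)// (leq_trans YX')// ltnW.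
- by apply: (le_trans (harmonic_ln _ X0)); clear -lnXL L1; lra.
- by clear -L1; lra.
- exact: inv_sqrt_le.
- move=> N NX; apply: (le_trans (smooth_tail_le N j00 _ he)); first by rewrite muln_gt0.
  apply: le_trans e442; apply: expG.
  rewrite -[leLHS]expRK ler_ln ?posrE ?expR_gt0 ?ltr0n ?muln_gt0//.
  by apply: (le_trans (ltW Qu)); rewrite ler_nat leq_pmulr.
- apply: (le_trans (smooth_count_le j00 X0 he)); apply: ler_wpM2r => //.
  by apply: le_trans e442; apply: expG.
- rewrite /error_term -/L -/l -/S -expRN.
  rewrite [leLHS](_ : _ = X%:R * (264 * (1 + 2 * L) ^+ 4 * expR (- (44 / 100 * S)))); last by ring.
  apply: ler_pM => //; last exact: (log_factor_le sc).
  by apply: mulr_ge0; [apply: mulr_ge0 => //; rewrite exprn_ge0//; clear -L1; lra|exact: expR_ge0].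
Qed.

End Asymptotics.

(** * The discrepancy of B_I *)

Section Final.
Variable R : realType.
Implicit Types (alpha x kappa : R).

Lemma sum1_natr (P : pred nat) m n :
  \sum_(m <= i < n | P i) 1 = (size [seq i <- index_iota m n | P i])%:R :> R.
Proof. by rewrite size_filter -sum1_count natr_sum. Qed.

Lemma card_uptoE (B : set nat) x : 0 <= x -> (forall n, B n -> (0 < n)%N) ->
  (card_upto B x)%:R = \sum_(1 <= n < (Num.truncn x).+1 | `[< B n >]) 1 :> R.
Proof.
move=> x0 B0; rewrite sum1_natr; congr (_%:R).
set s := [seq n <- _ | _].
have us : undup s = s by apply: undup_id; rewrite filter_uniq// iota_uniq.
rewrite -[in RHS]us -card_fseq /card_upto.
congr (#|` _|); apply/fsetP => n.
rewrite in_fset_set; last exact: finite_upto.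
rewrite !inE mem_filter mem_index_iota; apply/idP/idP.
  rewrite inE => -[Bn /= nx]; rewrite asboolT//= B0//= ltnS; exact: le_truncn_nat.
move=> /andP[/asboolP Bn /andP[n0 nX]]; rewrite inE; split => //=.
have /andP[h _] := truncn_itv x0; apply: le_trans h; by rewrite ler_nat.
Qed.

Lemma discrepancy_bound alpha : irrational alpha ->
  (irrationality_measure alpha < +oo)%E ->
  exists x0 : R, forall (K0 : nat) (I : nat -> set R) x beta,
    interval_family K0 I -> x0 <= x -> 0 <= beta <= 1 ->
    `|(cardfrac_upto (setB I) x beta alpha)%:R - beta * (card_upto (setB I) x)%:R|
      <= 2 ^+ K0 * error_term (41 / 100) x.
Proof.
move=> irr mu; have [A [T0 dio]] := diophantine irr mu.
set b := cutoff_exponent A; set e := frequency_exponent A.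
have k0 : (0 < b + (A * e + 2) * 2 + (A.*2 + 4))%N by rewrite !addnS.
have [x0 Hx0] := @parameters R T0 _ k0.
exists x0 => K0 I x beta famI xx0 hb.
have [x_gt0 [Y [j0 [J [Q [lambda [rho]]]]]]] := Hx0 x xx0.
set X := Num.truncn x => -[[h1 h2 h3 h4 h5] [[h6 h7 h8 h9 h10] [h11 h12 h13]]].
have Y0 : (0 < Y)%N by apply: leq_trans h2.
have pow i : (i <= b + (A * e + 2) * 2 + (A.*2 + 4))%N -> (Y ^ i * Q.+1 <= X)%N.
  by move=> ik; apply: leq_trans h9; rewrite leq_mul2r leq_pexp2l ?orbT.
have pos n : setB I n -> (0 < n)%N by exact: setB_gt0.
rewrite /cardfrac_upto !card_uptoE ?(ltW x_gt0)//; last by move=> n [/pos].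
rewrite -/X.
have -> : \sum_(1 <= n < X.+1 | `[< (setB I `&` [set n | frac_part (alpha * n%:R) <= beta]) n >]) 1
  = \sum_(1 <= n < X.+1 | `[< setB I n >] && (frac_part (alpha * n%:R) <= beta)) 1 :> R.
  apply: eq_bigl => n; apply/asboolP/andP => [[? ?]|[/asboolP ? ?]]; split => //.
  exact/asboolP.
apply: (@le_trans _ _ (2 ^+ K0 * (132 * lambda ^+ 4 * rho * X%:R))); last first.
  by rewrite ler_wpM2l// exprn_ge0.
apply: (@discrepancy_finite R alpha A T0 dio K0 I famI beta lambda rho X Y j0 J Q) => //.
- rewrite -/b -/e -expnM -expnD; apply: leq_trans (pow (b + (A * e + 2) * 2)%N _).
    by rewrite leq_pmulr.
  exact: leq_addr.
- rewrite -/b -/e mulnCA mulnC -expnD; apply: pow.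
  rewrite -addnA leq_add2l (@leq_trans ((A * e + 2) * 2))// ?leq_addr//.
  by move: (A * e)%N => n; clear; lia.
- apply: leq_trans (pow (A.*2 + 4)%N (leq_addl _ _)).
  by rewrite leq_pmulr.
Qed.

Lemma sqrt6_lt : 1 / Num.sqrt 6 < 41 / 100 :> R.
Proof.
have s6 : 0 < Num.sqrt 6 :> R by rewrite sqrtr_gt0.
rewrite ltr_pdivrMr// mulrC.
have sq : Num.sqrt 6 ^+ 2 = 6 :> R by rewrite sqr_sqrtr.
move: (Num.sqrt 6) s6 sq => s s6 sq; nra.
Qed.

Lemma error_term_le kappa kappa' x : 0 <= x -> kappa <= kappa' ->
  error_term kappa' x <= error_term kappa x.
Proof.
move=> x0 kk; rewrite /error_term ler_wpM2l// lef_pV2 ?posrE ?expR_gt0// ler_expR.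
by rewrite ler_wpM2r// sqrtr_ge0.
Qed.

Lemma error_term_vanish kappa kappa' (eps : R) : kappa < kappa' -> kappa' <= 1 -> 0 < eps ->
  exists x0 : R, forall x, x0 <= x ->
   [/\ 0 < x, 1 <= error_term kappa' x & error_term kappa' x <= eps * error_term kappa x].
Proof.
move=> kk k1 e0; pose c := (eps * (kappa' - kappa))^-1.
have [x0 Hx0] := log_scale_exists (c + 1).
have dk : 0 < kappa' - kappa by rewrite subr_gt0.
have c0 : 0 < c by rewrite invr_gt0 mulr_gt0.
exists x0 => x /Hx0[x_gt0 HH]; pose S := Num.sqrt (ln x * ln (ln x)).
have {HH} [[LE SE l1 Sl _] [cl cS]] : log_scale (ln x) (ln (ln x)) S /\
  (c + 1 <= ln (ln x) /\ (c + 1) * S <= ln x) := HH.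
have Sc : c <= S by clear -Sl l1 cl; lra.
have S0 : 0 <= S by exact: sqrtr_ge0.
have SL : S <= ln x.
  apply: le_trans cS; rewrite mulrDl mul1r lerDr mulr_ge0// ltW//.
have Ex : x = expR (ln x) by rewrite lnK// posrE.
split => //.
  rewrite /error_term -/S [X in X / _]Ex -expRB.
  rewrite -[leLHS]expR0 ler_expR subr_ge0; apply: le_trans SL.
  by rewrite ler_piMl.
rewrite /error_term -/S mulrCA ler_wpM2l ?(ltW x_gt0)//.
rewrite -!expRN (_ : - (kappa' * S) = - ((kappa' - kappa) * S) + - (kappa * S)); last by ring.
rewrite expRD ler_wpM2r ?expR_ge0// expRN -[eps]invrK lef_pV2 ?posrE ?invr_gt0 ?expR_gt0//.
apply: (@le_trans _ _ ((kappa' - kappa) * S)); last first.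
  by apply: le_trans (expR_ge1Dx _); rewrite lerDr.
apply: (@le_trans _ _ ((kappa' - kappa) * c)); last by rewrite ler_wpM2l ?(ltW dk).
by rewrite /c invfM mulrCA divff ?mulr1// gt_eqF.
Qed.

Lemma sum_unique_le1 (P : pred nat) X :
  (forall m n, (m < n)%N -> P m -> P n -> False) -> \sum_(1 <= n < X | P n) 1 <= 1 :> R.
Proof.
move=> H; rewrite sum1_natr -[leRHS]/(1%:R) ler_nat.
have : uniq [seq n <- index_iota 1 X | P n] by rewrite filter_uniq// iota_uniq.
have : all P [seq n <- index_iota 1 X | P n] by exact: filter_all.
case: [seq n <- _ | _] => [|m [|n s]]//= /andP[Pm /andP[Pn _]].
rewrite inE negb_or => /andP[/andP[+ _] _].
by have [h|h|//] := ltngtP m n; [case: (H _ _ h Pm Pn)|case: (H _ _ h Pn Pm)].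
Qed.

Lemma frac_part_inj alpha (m n : nat) : irrational alpha -> (m < n)%N ->
  frac_part (alpha * m%:R) = frac_part (alpha * n%:R) -> False.
Proof.
move=> irr mn; rewrite /frac_part => E; apply: irr; apply/rationalP.
exists (Num.floor (alpha * n%:R) - Num.floor (alpha * m%:R)), (n - m)%N.
have d0 : (n - m)%:R != 0 :> R by rewrite pnatr_eq0 -lt0n subn_gt0.
apply: (mulIf d0); rewrite divfK// natrB ?(ltnW mn)// intrB.
move: E; move: (Num.floor _)%:~R (Num.floor _)%:~R => u v; lra.
Qed.

End Final.

Theorem theorem4 (R : realType) :
  (exists C : R -> nat -> R,
     forall alpha : R, irrational alpha ->
       (irrationality_measure alpha < +oo)%E ->
     exists x0 : R,
     forall (kappa : R) (K0 : nat) (I : nat -> set R) (x : R),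
       kappa < 1 / Num.sqrt 6 -> interval_family K0 I -> x0 <= x ->
       sup_discrepancy (setB I) alpha x <= C kappa K0 * error_term kappa x)
  /\
  (forall (alpha : R) (K0 : nat) (I : nat -> set R),
     irrational alpha -> (irrationality_measure alpha < +oo)%E ->
     interval_family K0 I ->
     (exists kappa' c x1 : R,
        [/\ kappa' < 1 / Num.sqrt 6, 0 < c &
            forall x : R, x1 <= x ->
              c * error_term kappa' x <= (card_upto (setB I) x)%:R]) ->
     equidistributed_mod1 (setB I) alpha).
Proof.
split.
  exists (fun _ K0 => 2 ^+ K0) => alpha irr mu.
  have [x0 Hx0] := discrepancy_bound irr mu.
  exists (Num.max 0 x0) => kappa K0 I x kap famI; rewrite ge_max => /andP[x_ge0 xx0].
  apply: ge_sup; first by exists (`|(cardfrac_upto (setB I) x 0 alpha)%:R - 0 * (card_upto (setB I) x)%:R|), 0 => //=; rewrite lexx ler01.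
  move=> _ [beta hb <-]; apply: (le_trans (Hx0 K0 I x beta famI xx0 hb)).
  rewrite ler_wpM2l ?exprn_ge0//; apply: error_term_le => //.
  by apply/ltW/(lt_trans kap); exact: sqrt6_lt.
move=> alpha K0 I irr mu famI [kappa [c [x1 [kap c0 Hc]]]] a b a0 ab b1.
have [x0 Hx0] := discrepancy_bound irr mu.
have kap' : kappa < 41 / 100 := lt_trans kap (@sqrt6_lt R).
apply/cvgrPdist_le => eps eps0.
set C : R := 2 ^+ K0.
have C1 : 1 <= C by rewrite exprn_ege1// ler1n.
have e0 : 0 < eps * c / (3 * C) by rewrite !divr_gt0 ?mulr_gt0//; lra.
have h41 : 41 / 100 <= 1 :> R by lra.
have [x2 Hx2] := error_term_vanish kap' h41 e0.
near=> x.
have xx0 : x0 <= x by near: x; apply: nbhs_pinfty_ge; rewrite num_real.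
have xx1 : x1 <= x by near: x; apply: nbhs_pinfty_ge; rewrite num_real.
have xx2 : x2 <= x by near: x; apply: nbhs_pinfty_ge; rewrite num_real.
have [x_gt0 E1 E2] := Hx2 x xx2.
have pos n : setB I n -> (0 < n)%N by exact: setB_gt0.
have ha := Hx0 K0 I x a famI xx0; have hb := Hx0 K0 I x b famI xx0.
have {}ha := ha ltac:(lra); have {}hb := hb ltac:(lra).
have cB := Hc x xx1.
set E := error_term (41 / 100) x in E1 E2 ha hb.
set B := (card_upto (setB I) x)%:R in ha hb cB *.
set Na := (cardfrac_upto _ x a _)%:R in ha; set Nb := (cardfrac_upto _ x b _)%:R in hb.
set N := (card_upto _ x)%:R.
have [N1 N2] : Nb - Na <= N /\ N <= Nb - Na + 1.
  rewrite /N /Na /Nb /cardfrac_upto !card_uptoE ?(ltW x_gt0)//; try by move=> n [/pos].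
  set X := (Num.truncn x).+1.
  pose F y n := `[< (setB I `&` [set n | frac_part (alpha * n%:R) <= y]) n >].
  pose P n := `[< setB I n >] && (frac_part (alpha * n%:R) == a).
  have hP : \sum_(1 <= n < X | P n) 1 <= 1 :> R.
    apply: sum_unique_le1 => m n mn /andP[_ /eqP fm] /andP[_ /eqP fn].
    by apply: (frac_part_inj irr mn); rewrite fm fn.
  have hP0 : 0 <= \sum_(1 <= n < X | P n) 1 :> R by apply: sumr_ge0.
  have -> : \sum_(1 <= n < X | `[< (setB I `&` [set n | a <= frac_part (alpha * n%:R) <= b]) n >]) 1
    = \sum_(1 <= n < X | F b n) 1 - \sum_(1 <= n < X | F a n) 1 + \sum_(1 <= n < X | P n) 1 :> R.
    rewrite [LHS]big_mkcond [X in _ = X - _ + _]big_mkcond [X in _ = _ - X + _]big_mkcond.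
    rewrite [X in _ = _ + X]big_mkcond -sumrB -big_split/=; apply: eq_bigr => n _.
    rewrite /F /P /=; case: (pselect (setB I n)) => Bn; last first.
      have nB Z : `[< setB I n /\ Z >] = false by apply/asboolPn => -[].
      by rewrite !nB (asboolF Bn)/= subr0 addr0.
    have yB (Z : bool) : `[< setB I n /\ Z >] = Z by apply/asboolP/idP => [[]|].
    rewrite !yB asboolT//=.
    move: (frac_part _) => u; case: (ltgtP a u) => [au|ua|<-]/=.
    - by case: (u <= b); rewrite subr0 addr0.
    - by rewrite (le_trans (ltW ua) (ltW ab)) subrr addr0.
    - by rewrite (ltW ab) subrr add0r.
  by move: hP hP0; rewrite -/(F b) -/(F a); set t := \sum_(_ <= _ < _ | P _) _; lra.
have B0 : 0 < B.
  apply: lt_le_trans cB; rewrite mulr_gt0//.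
  by rewrite /error_term divr_gt0// expR_gt0.
rewrite -(ler_pM2r B0) -[X in _ * X <= _](gtr0_norm B0) -normrM mulrBl divfK ?gt_eqF//.
have E0 : 0 < E by lra.
have key : 3 * C * E <= eps * B.
  have C0 : 0 < 3 * C by lra.
  apply: (@le_trans _ _ (eps * (c * error_term kappa x))); last by rewrite ler_pM2l.
  rewrite mulrC -ler_pdivlMr//; apply: (le_trans E2).
  suff -> : eps * c / (3 * C) * error_term kappa x = eps * (c * error_term kappa x) / (3 * C) by [].
  by rewrite [LHS]mulrAC -[in LHS](mulrA eps).
have CE : E <= C * E by rewrite ler_peMl// ltW.
apply: le_trans key; move: ha hb; rewrite !ler_norml => /andP[ha1 ha2] /andP[hb1 hb2].
rewrite -/C in ha1 ha2 hb1 hb2.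
by apply/andP; split; lra.
Unshelve. all: by end_near.
Qed.
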